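(* Let $\mathcal{A}$ be an arrangement in $V=\mathbb{K}^\ell$, $H\in\mathcal{A}$, $\mathcal{A}'=\mathcal{A}\setminus\{H\}$ and $d:=|\mathcal{A}'|-|\mathcal{A}^H|$. Assume that for every $0\le p\le\ell$, setting $k:=\operatorname{pd}_SD^p(\mathcal{A})$, one has $k<\ell-2$ and $\overline{\partial^p}:D^p(\mathcal{A}')\to D^{p-1}(\mathcal{A}^H)\overline{B}$ is surjective in codimension $k+2$ along $H$. Then $$\Psi(\mathcal{A}';x,t)=\Psi(\mathcal{A};x,t)+x^d(t(x-1)-1)\Psi(\mathcal{A}^H;x,t)$$ and $$\Psi(\mathcal{A}';x,-1)=\Psi(\mathcal{A};x,-1)-x^{d+1}\Psi(\mathcal{A}^H;x,-1).$$
   Context: $\mathbb{K}$ a field, $S=\mathbb{K}[x_1,\dots,x_\ell]$, standard grading. For an arrangement (finite set of linear hyperplanes) $\mathcal{A}$, $\alpha_H$ is a defining linear form of $H$, $Q(\mathcal{A})=\prod\alpha_H$. $\operatorname{Der}^pS=\wedge^p_S\operatorname{Der}S$ (elements viewed as alternating multiderivations $S^p\to S$), graded with $\deg\partial_{x_i}=0$; $D^p(\mathcal{A})=\{\theta\in\operatorname{Der}^pS:\theta(\alpha_H,f_2,\dots,f_p)\in\alpha_HS\ \forall H\in\mathcal{A},f_j\in S\}$, $D^0=S$. $\overline{S}=S/\alpha_HS$; $\mathcal{A}^H=\{L\cap H:L\in\mathcal{A}'\}$ (arrangement in $H$), with $D^q(\mathcal{A}^H)\subset\wedge^q\operatorname{Der}\overline{S}$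 analogous and $D^{-1}(\mathcal{A}^H)=0$. $\overline{B}=\overline{Q(\mathcal{A}')}/Q(\mathcal{A}^H)\in\overline{S}$ where $Q(\mathcal{A}^H)$ is the product of defining forms of $\mathcal{A}^H$; $\overline{\partial^p}(\theta)(\overline{f_2},\dots,\overline{f_p})=\overline{\theta(\alpha_H,f_2,\dots,f_p)}$ for $p\ge1$, $\overline{\partial^0}=0$; its image lies in $D^{p-1}(\mathcal{A}^H)\overline{B}$. For $X$ in the intersection lattice $L(\mathcal{A}^H)$, $\mathcal{A}_X=\{L\in\mathcal{A}:X\subset L\}$. $\overline{\partial^p}$ is surjective in codimension $k$ along $H$ if for every $X\in L(\mathcal{A}^H)$ with $\operatorname{codim}_VX=k$, the corresponding map $\overline{\partial^p}$ defined for the localized arrangement $\mathcal{A}_X$ and $H$, namely $D^p(\mathcal{A}_X\setminus\{H\})\to D^{p-1}((\mathcal{A}_X)^H)\overline{B_X}$ (with $\overline{B_X}$ the corresponding element for $\mathcal{A}_X$), is surjective. $\operatorname{Hilb}(M;x)=\sum_j\dim M_jx^j$; $\Psi(\mathcal{A};x,t)=\sum_{p=0}^\ell\operatorname{Hilb}(D^p(\mathcal{A});x)(t(x-1)-1)^p$ (likewise for $\mathcal{A}'$, and for $\mathcal{A}^H$ over $\overline{S}$ with $\ell-1$ in place of $\ell$). *)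

(* Defs.v *)
From HB Require Import structures.
From mathcomp Require Import all_boot all_order all_algebra ring_quotient.
From mathcomp Require Import finmap boolp classical_sets functions mpoly.

Set Implicit Arguments.
Unset Strict Implicit.
Unset Printing Implicit Defensive.

Import GRing.Theory.
Local Open Scope quotient_scope.
Local Open Scope classical_set_scope.
Local Open Scope fset_scope.
Local Open Scope ring_scope.

Section Modules.

Definition projective_module (R : nzRingType) (P : lmodType R) : Prop :=
  forall (M N : lmodType R) (g : {linear M -> N}) (f : {linear P -> N}),
    (forall y, exists x, g x = y) ->
    exists h : {linear P -> M}, forall x, g (h x) = f x.

(* A projective resolution 0 -> P_k -> ... -> P_0 -> M -> 0 of a submodule M *)
(* of V; the augmentation P_0 -> M is seen as a map e into V with image M.   *)
Definition has_projective_resolution (R : nzRingType) (V : lmodType R)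
    (M : set V) (k : nat) : Prop :=
  exists (P : nat -> lmodType R) (d : forall i, {linear P i.+1 -> P i})
         (e : {linear P 0%N -> V}),
  [/\ forall i, projective_module (P i),
      forall i, (k < i)%N -> forall x : P i, x = 0,
      forall v, M v <-> exists x, e x = v,
      forall x, e x = 0 <-> exists y, d 0%N y = x
    & forall i x, d i x = 0 <-> exists y, d i.+1 y = x].

Definition projective_dimension (R : nzRingType) (V : lmodType R)
    (M : set V) (k : nat) : Prop :=
  has_projective_resolution M k /\
  forall k', has_projective_resolution M k' -> (k <= k')%N.

Definition has_dimension (K : fieldType) (V : lmodType K) (U : set V)
    (m : nat) : Prop :=
  exists b : 'I_m -> V,
    injective (fun c : 'rV[K]_m => \sum_i c 0 i *: b i) /\
    forall v, U v <-> exists c : 'rV[K]_m, v = \sum_i c 0 i *: b i.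

(* 0 on infinite-dimensional subspaces. *)
Definition dimension (K : fieldType) (V : lmodType K) (U : set V) : nat :=
  xget 0%N [set m | has_dimension U m].

End Modules.

Section Multiderivations.
Variables (K : fieldType) (R : comAlgType K).

Definition set_arg p (f : 'I_p -> R) (i : 'I_p) (a : R) : 'I_p -> R :=
  fun j => if j == i then a else f j.

Definition cons_arg p (a : R) (f : 'I_p -> R) : 'I_p.+1 -> R :=
  fun i => if unlift ord0 i is Some j then f j else a.

(* The elements of Der^p R. *)
Definition multiderivation p (theta : ('I_p -> R) -> R) : Prop :=
  [/\ forall f i (c : K) a b, theta (set_arg f i (c *: a + b)) =
        c *: theta (set_arg f i a) + theta (set_arg f i b),
      forall f i a b, theta (set_arg f i (a * b)) =
        a * theta (set_arg f i b) + b * theta (set_arg f i a)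
    & forall f i j, i != j -> f i = f j -> theta f = 0].

(* The condition on theta (alpha_L, f_2, ..., f_p) quantifies over the whole *)
(* argument tuple f with f_1 = alpha_L; it is void for p = 0, so D^0 = R.    *)
Definition logder (I : choiceType) (alpha : I -> R) (A : {fset I}) p :
    set (('I_p -> R) -> R) :=
  [set theta | multiderivation theta /\
     forall L, L \in A -> forall (f : 'I_p -> R) (i : 'I_p),
       i = 0%N :> nat -> f i = alpha L -> exists g, theta f = alpha L * g].

(* gr j is the degree j part of R. As deg (d/dx_i) = 0, theta is homogeneous *)
(* of degree j when it maps tuples of linear forms to degree j elements.     *)
Definition Hilb (gr : nat -> set R) p (M : set (('I_p -> R) -> R)) (j : nat) :
    nat :=
  dimension [set theta | M theta /\
    forall f : 'I_p -> R, (forall i, gr 1%N (f i)) -> gr j (theta f)].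

End Multiderivations.

Arguments logder {K R I} alpha A p _.

(* A formal power series over T is its coefficient sequence nat -> T; this   *)
(* is the product of a polynomial and a power series.                        *)
Definition psmul (T : comNzRingType) (q : {poly T}) (u : nat -> T) : nat -> T :=
  fun m => \sum_(i < m.+1) q`_i * u (m - i)%N.

Notation "q *ps u" := (psmul q u) (at level 40, no associativity).

(* t (x - 1) - 1 as a polynomial in x over Z[t]: x is the outer variable.    *)
Definition tx1 : {poly {poly int}} := 'X%:P * ('X - 1) - 1.

(* Psi (x, t), summed over 0 <= p <= l, as a power series in x over Z[t].    *)
Definition Psi (K : fieldType) (R : comAlgType K) (gr : nat -> set R)
    (I : choiceType) (alpha : I -> R) (A : {fset I}) (l : nat) :
    nat -> {poly int} :=
  fun m => \sum_(p < l.+1)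
    ((tx1 ^+ p) *ps (fun j => (Hilb gr (logder alpha A p) j)%:R)) m.

Definition at_t (c : int) (u : nat -> {poly int}) : nat -> int :=
  fun m => (u m).[c].

Section QuotientByLinearForm.
Variables (K : fieldType) (n : nat).
Local Notation S := {mpoly K[n]}.

Record linform := LinForm {
  linform_val :> S;
  linform_homog : linform_val \is 1.-homog;
  linform_neq0 : linform_val != 0 }.

Definition principal (a : linform) : pred S :=
  fun f => `[< exists g : S, f = (a : S) * g >].

Lemma principal_idealr a : idealr_closed (principal a).
Proof.
split=> [||c u v].
- by apply/asboolP; exists 0; rewrite mulr0.
- apply/negP => /asboolP[g /(congr1 (mcoeff 0%MM))].
  rewrite rmorphM /= (dhomog_nemf_coeff (linform_homog a)) ?mdeg0 ?mf0 //.
  by rewrite mul0r mcoeff1 eqxx => /eqP; rewrite oner_eq0.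
- move=> /asboolP[g ->] /asboolP[h ->]; apply/asboolP.
  by exists (c * g + h); rewrite mulrDr mulrCA.
Qed.

HB.instance Definition _ a := isIdealr.Build S (principal a) (principal_idealr a).

Definition principal_ideal (a : linform) : idealr S := principal a.

Definition Sbar (a : linform) : Type := {ideal_quot (principal_ideal a)}.

HB.instance Definition _ a := GRing.ComNzRing.on (Sbar a).

Definition bar (a : linform) (f : S) : Sbar a := \pi_({ideal_quot (principal_ideal a)}) f.

Definition bar_repr (a : linform) (x : Sbar a) : S :=
  repr (x : {ideal_quot (principal_ideal a)}).

Lemma barK a : cancel (@bar_repr a) (@bar a).
Proof. by move=> x; rewrite /bar reprK. Qed.

Lemma bar_is_zmod_morphism a : zmod_morphism (@bar a).
Proof. by move=> x y; rewrite /bar rmorphB. Qed.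

Lemma bar_is_monoid_morphism a : monoid_morphism (@bar a).
Proof. by split=> [|x y]; rewrite /bar ?rmorph1 ?rmorphM. Qed.

HB.instance Definition _ a :=
  GRing.isZmodMorphism.Build S (Sbar a) (@bar a) (bar_is_zmod_morphism a).
HB.instance Definition _ a :=
  GRing.isMonoidMorphism.Build S (Sbar a) (@bar a) (bar_is_monoid_morphism a).

Definition Sbar_scale a (c : K) (x : Sbar a) : Sbar a := bar a c%:MP * x.

Lemma Sbar_scaleA a c d x :
  Sbar_scale c (@Sbar_scale a d x) = Sbar_scale (c * d) x.
Proof. by rewrite /Sbar_scale mulrA -rmorphM -mpolyCM. Qed.

Lemma Sbar_scale1 a : left_id 1 (@Sbar_scale a).
Proof. by move=> x; rewrite /Sbar_scale mpolyC1 rmorph1 mul1r. Qed.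

Lemma Sbar_scaleDr a : right_distributive (@Sbar_scale a) +%R.
Proof. by move=> c x y; rewrite /Sbar_scale mulrDr. Qed.

Lemma Sbar_scaleDl a x : {morph (@Sbar_scale a)^~ x : c d / c + d}.
Proof. by move=> c d; rewrite /Sbar_scale mpolyCD rmorphD mulrDl. Qed.

HB.instance Definition _ a := GRing.Zmodule_isLmodule.Build K (Sbar a)
  (@Sbar_scaleA a) (@Sbar_scale1 a) (@Sbar_scaleDr a) (@Sbar_scaleDl a).

Lemma Sbar_scaleAl a (c : K) (x y : Sbar a) : c *: (x * y) = c *: x * y.
Proof. by rewrite /GRing.scale /= /Sbar_scale mulrA. Qed.

HB.instance Definition _ a :=
  GRing.Lmodule_isLalgebra.Build K (Sbar a) (@Sbar_scaleAl a).
HB.instance Definition _ a :=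
  GRing.Lalgebra_isComAlgebra.Build K (Sbar a).

Definition S_gr (j : nat) : set S := [set f | f \is j.-homog].

Definition Sbar_gr (a : linform) (j : nat) : set (Sbar a) :=
  [set x | exists2 f, S_gr j f & x = bar a f].

End QuotientByLinearForm.

Section Arrangements.
Variables (K : fieldType) (n : nat).
Local Notation S := {mpoly K[n]}.
Local Notation subspace := {vspace 'rV[K]_n}.
Implicit Types (A : {fset subspace}) (H X : subspace).

Definition arrangement A : Prop := forall L, L \in A -> (\dim L).+1 = n.

Definition defining_form (a : S) (L : subspace) : Prop :=
  forall v, (v \in L) = (a.@[v 0] == 0).

(* b is a linear form on H with zero set U, for U a hyperplane of H. *)
Definition defining_form_in H (a : linform K n) (b : Sbar a) (U : subspace) :
    Prop :=
  exists f : S, [/\ f \is 1.-homog, b = bar a f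
    & forall v, (v \in U) = (v \in H) && (f.@[v 0] == 0)].

Definition restriction A H : {fset subspace} :=
  [fset (L :&: H)%VS | L in A `\ H].

Definition localization A X : {fset subspace} := [fset L in A | (X <= L)%VS].

(* The intersection lattice of an arrangement C in the space H. *)
Definition in_lattice H (C : {fset subspace}) X : Prop :=
  exists2 E : {fset subspace}, E `<=` C & X = (H :&: \bigcap_(U <- E) U)%VS.

Variables (alpha : subspace -> linform K n) (H : subspace).
Variable beta : subspace -> Sbar (alpha H).

(* The quotient of the image of Q(A') by Q(A^H): it exists because every form *)
(* of A^H divides some image of a form of A', and is unique as Sbar is a     *)
(* domain.                                                                   *)
Definition Bbar A : Sbar (alpha H) :=
  xget 0 [set b | b * \prod_(U <- restriction A H) beta U
                  = bar (alpha H) (\prod_(L <- A `\ H) (alpha L : S))].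

(* The value does not depend on the representatives when theta is a          *)
(* multiderivation: theta (a, ..., a * h, ...) is a multiple of a = alpha H. *)
Definition dbar p : (('I_p -> S) -> S) ->
    ('I_p.-1 -> Sbar (alpha H)) -> Sbar (alpha H) :=
  match p with
  | 0 => fun _ _ => 0
  | q.+1 => fun theta g =>
      bar (alpha H) (theta (cons_arg (alpha H : S) (fun i => bar_repr (g i))))
  end.

(* D^{p-1}(A^H) Bbar, with D^{-1}(A^H) = 0. *)
Definition dbar_codomain A p :
    set (('I_p.-1 -> Sbar (alpha H)) -> Sbar (alpha H)) :=
  match p with
  | 0 => [set eta | eta = (fun=> 0)]
  | q.+1 => [set eta | exists2 eta',
       logder beta (restriction A H) q eta' & eta = (fun g => Bbar A * eta' g)]
  end.

Definition dbar_surjective A p : Prop :=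
  forall eta, @dbar_codomain A p eta ->
  exists2 theta, logder (fun L => alpha L : S) (A `\ H) p theta &
    @dbar p theta = eta.

Definition surjective_in_codim A p (k : nat) : Prop :=
  forall X, in_lattice H (restriction A H) X -> (\dim X + k)%N = n ->
    dbar_surjective (localization A X) p.

End Arrangements.

(* Main.v *)
(* For each p the sequence 0 -> D^p(A) -> D^p(A') -> D^(p-1)(A^H) Bbar -> 0, whose last
   map is dbar, is exact, and comparing the dimensions of its graded pieces gives the
   recursion. The point is surjectivity. Let k = pd D^p(A) and suppose some eta is not
   in the image of dbar. By the local hypothesis in codimension k + 2, eta can be
   multiplied by forms of A' until it is killed, modulo the image, by k + 3 linearly
   independent forms alpha_L; here the rank of A has to be at least k + 2. These forms
   are a regular sequence, so the Koszul cohomology H^2 of D^p(A) vanishes by dimension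
   shifting along a resolution of length k, and this lets one divide preimages of
   the alpha_L eta simultaneously, a contradiction. If the rank of A is below k + 2, then
   D^p(A) is defined over a polynomial ring in rank A variables and the minimality of
   k forces A = {H}, where exterior multiplication by a constant derivation inverts
   dbar. *)

Require Import Defs.
From HB Require Import structures.
From mathcomp.multinomials Require Import freeg.
From mathcomp Require Import all_boot all_order all_algebra ring_quotient.
From mathcomp Require Import zify ring.
From mathcomp Require Import perm finmap boolp classical_sets functions mpoly.

Set Implicit Arguments.
Unset Strict Implicit.
Unset Printing Implicit Defensive.

Import GRing.Theory.
Local Open Scope classical_set_scope.
Local Open Scope fset_scope.
Local Open Scope ring_scope.

(** Two counts fix the constants. Shifting a 2-cochain with values in D^p(A) along a resolution of
    length k ends in degree k + 2 of a projective module, where exactness takes more than k + 2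
    forms; hence k + 3. One of them is alpha_H, which annihilates every eta since eta has values in
    S / alpha_H S; a flat of codimension k + 2 inside the common zeros of the forms found supplies
    the next one, up to k + 3. In low rank there is no such flat, the local hypothesis is void, and
    only the minimality of k is left. Resolutions consist of arbitrary projective modules, so the
    last differential has to be split directly: for length k + 1, the identity of P_{k+1} is
    extended along d_k, first K-linearly, then corrected to commute with one coordinate after
    another. Each coordinate costs one position of the complex, except those absent from the
    equations of D^p(A). Prolonging the complex by the two free modules of these equations gains two
    positions, just enough for rank at most k + 2. *)

(** * Koszul cochains and regular sequences *)

Section Koszul.
Variable R : comNzRingType.
Implicit Types (M N P : lmodType R) (ys : seq R).

(* The Koszul cochain complex: the bits of b mark the factors of the wedge monomial. *)
Fixpoint koszul M ys (c : bitseq -> M) (b : bitseq) : M :=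
  match ys, b with
  | y :: ys', true :: b' =>
      y *: c (false :: b') - koszul ys' (fun t => c (true :: t)) b'
  | _ :: ys', false :: b' => koszul ys' (fun t => c (false :: t)) b'
  | _, _ => 0
  end.

Fixpoint in_ideal M ys (m : M) : Prop :=
  if ys is y :: ys' then exists a, in_ideal ys' (m - y *: a) else m = 0.

(** Regularity is read from the end of the list: each element acts injectively modulo the ideal of
    those behind it, so that the recursion peels off the head as in [koszul]. *)
Fixpoint weakly_regular M ys : Prop :=
  if ys is y :: ys' then
    weakly_regular M ys' /\ (forall m : M, in_ideal ys' (y *: m) -> in_ideal ys' m)
  else True.

Definition weight_of (s w : nat) (b : bitseq) : Prop :=
  size b = s /\ count id b = w.

(** Cochains are total functions on bit sequences, so cocycles and equality are tested only at the
    right length and weight; by [eq_koszul] the differential sees nothing else. *)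
Definition koszul_exact_at M ys w : Prop :=
  forall c : bitseq -> M,
    (forall b, weight_of (size ys) w.+1 b -> koszul ys c b = 0) ->
    exists c', forall b, weight_of (size ys) w b -> c b = koszul ys c' b.

Lemma koszul_weight0 M ys (c : bitseq -> M) b :
  size b = size ys -> count id b = 0%N -> koszul ys c b = 0.
Proof.
elim: ys b c => [|z ys IH] [|[] b] //= c [sb]; rewrite add0n => cb.
exact: IH.
Qed.

Lemma eq_koszul M ys w (c c' : bitseq -> M) :
  (forall b, weight_of (size ys) w b -> c b = c' b) ->
  forall b, weight_of (size ys) w.+1 b -> koszul ys c b = koszul ys c' b.
Proof.
elim: ys w c c' => [|y ys IH] w c c' cc' [|[] b] [//=] /eqP; rewrite eqSS => /eqP sb.
  case=> wb; rewrite cc'; last by split; rewrite /= ?sb.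
  congr (_ - _); case: w wb cc' => [|w] wb cc'; first by rewrite !koszul_weight0.
  by apply: (IH w) => // b' [sb' wb']; apply: cc'; split; rewrite /= ?sb' ?wb'.
rewrite add0n => wb; apply: (IH w) => // b' [sb' wb'].
by apply: cc'; split; rewrite /= ?sb' ?wb'.
Qed.

Lemma koszulB M ys (c c' : bitseq -> M) b :
  koszul ys (fun t => c t - c' t) b = koszul ys c b - koszul ys c' b.
Proof.
elim: ys c c' b => [|y ys IH] c c' [|[] b] //=; rewrite ?subr0 //.
rewrite IH scalerBr !opprB [X in _ + X = _]addrC addrACA.
by rewrite [X in _ + X = _]addrC.
Qed.

Lemma koszulZ M ys y (c : bitseq -> M) b :
  koszul ys (fun t => y *: c t) b = y *: koszul ys c b.
Proof.
elim: ys c b => [|z ys IH] c [|[] b] //=; rewrite ?scaler0 //.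
by rewrite IH scalerBr !scalerA mulrC.
Qed.

Lemma koszul_linear M N ys (f : {linear M -> N}) (c : bitseq -> M) b :
  koszul ys (fun t => f (c t)) b = f (koszul ys c b).
Proof.
elim: ys c b => [|z ys IH] c [|[] b] //=; rewrite ?linear0 //.
by rewrite IH linearB linearZ.
Qed.

Lemma koszul_koszul M ys (c : bitseq -> M) b : koszul ys (koszul ys c) b = 0.
Proof.
elim: ys c b => [|z ys IH] c [|[] b] //=.
by rewrite koszulB koszulZ IH subr0 subrr.
Qed.

Lemma in_idealN M ys (m : M) : in_ideal ys m -> in_ideal ys (- m).
Proof.
elim: ys m => [|y ys IH] m /=; first by move=> ->; rewrite oppr0.
by case=> a /IH h; exists (- a); rewrite scalerN -opprD.
Qed.

(** In top degree the coboundaries are the ideal times M; this is where regularity of the head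
    enters [koszul_exact]. *)
Lemma in_idealP M ys (m : M) :
  in_ideal ys m <-> exists c, m = koszul ys c (nseq (size ys) true).
Proof.
elim: ys m => [|y ys IH] m /=.
  by split=> [->|[]//]; exists (fun=> 0).
split=> [[a /in_idealN/IH[c hc]]|[c ->]].
  exists (fun t => if t is true :: t' then c t' else a).
  by rewrite -[koszul _ _ _]hc opprK addrC subrK.
exists (c (false :: nseq (size ys) true)); rewrite addrC addKr.
by apply/in_idealN/IH; exists (fun t => c (true :: t)).
Qed.

Lemma weight_of_full s b : weight_of s s b -> b = nseq s true.
Proof.
elim: s b => [|s IH] [|[] b] [//=] [sb].
  by case=> cb; congr cons; apply: IH.
by rewrite add0n => cb; have := count_size id b; rewrite cb sb ltnn.
Qed.

(** The complex of [y :: ys] is the cone of y on the complex of ys: by its first bit a cocycle is a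
    pair (c0, c1) with c0 closed and y c0 equal to the differential of c1. *)
Lemma koszul_exact M ys w :
  weakly_regular M ys -> (w < size ys)%N -> koszul_exact_at M ys w.
Proof.
elim: ys w => [|y ys IH] w //= [rys ry] ws c hc.
have hc0 b : weight_of (size ys) w.+1 b ->
    koszul ys (fun t => c (false :: t)) b = 0.
  by case=> sb cb; apply: (hc (false :: b)); split; rewrite /= ?sb ?cb.
have hc1 b : weight_of (size ys) w b ->
    y *: c (false :: b) = koszul ys (fun t => c (true :: t)) b.
  case=> sb cb; apply/eqP; rewrite -subr_eq0; apply/eqP.
  by apply: (hc (true :: b)); split; rewrite /= ?sb ?cb.
(* Induction makes c0 a coboundary, except in the top degree of ys; there y c0 lies in the ideal and
   regularity of y applies. *)
have [e0 he0] : exists e0, forall b, weight_of (size ys) w b ->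
    c (false :: b) = koszul ys e0 b.
  move: ws; rewrite ltnS leq_eqVlt => /orP[/eqP ew|ws]; last by case: (IH w rys ws _ hc0) => e he; exists e.
  have full : weight_of (size ys) w (nseq (size ys) true).
    by split; rewrite ?size_nseq // count_nseq mul1n ew.
  have /in_idealP[e he] : in_ideal ys (c (false :: nseq (size ys) true)).
    apply: ry; apply/in_idealP; exists (fun t => c (true :: t)).
    exact: hc1.
  by exists e => b; rewrite ew => /weight_of_full ->.
case: w ws hc hc0 hc1 he0 => [|w] ws hc hc0 hc1 he0.
  exists (fun t => if t is false :: t' then e0 t' else 0) => -[|[] b] [//= [sb] cb].
  by apply: he0.
(* The differential of y e0 - c1 is y c0 - y c0 = 0; a primitive e1 completes the cochain. *)
have [e1 he1] : exists e1, forall b, weight_of (size ys) w b ->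
    y *: e0 b - c (true :: b) = koszul ys e1 b.
  case: (IH w rys ws (fun b => y *: e0 b - c (true :: b))) => [b wb|e he]; last by exists e.
  rewrite koszulB koszulZ -hc1 //; apply/eqP; rewrite subr_eq0; apply/eqP.
  by congr (_ *: _); rewrite he0.
exists (fun t => match t with true :: t' => e1 t' | false :: t' => e0 t' | _ => 0 end).
case=> [|[] b] [//= [sb]]; last by move=> cb; apply: he0.
by case=> cb; rewrite -he1 // opprB addrC subrK.
Qed.

End Koszul.

(** * Projective modules and dimension shifting *)

Section Projective.
Variable R : comNzRingType.
Implicit Types (M N P : lmodType R) (ys : seq R).

Lemma linear_of_fun M N (f : M -> N) : linear f ->
  exists F : {linear M -> N}, F =1 f.
Proof.
move=> lf; pose F := GRing.isLinear.Build R M N *:%R f lf.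
by exists (HB.pack_for {linear M -> N} f F).
Qed.

(** A dual basis indexed by the elements of P themselves. The expansion holds over any
    duplicate-free list containing [supp x], so that several elements can be expanded over one
    list. *)
Definition dual_basis P (phi : P -> {linear P -> R^o}) (supp : P -> seq P) :=
  (forall x q, q \notin supp x -> phi q x = 0) /\
  forall x (s : seq P), uniq s -> {subset supp x <= s} ->
    x = \sum_(q <- s) (phi q x : R) *: q.

Lemma fglift_is_linear P : linear (fglift (fun q : P => q) : {freeg P / R} -> P).
Proof.
pose g : {freeg P / R} -> P := fglift (fun q : P => q).
have gB : {morph g : x y / x - y} by move=> x y; rewrite /g lift_is_additive.
have gD : {morph g : x y / x + y}.
  move=> x y; rewrite -{1}[y]opprK gB -[- y]sub0r !gB.
  by rewrite -[0]subr0 gB subrr sub0r opprK.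
have gsum x : g x = \sum_(q <- dom x) coeff q x *: q.
  rewrite -{1}[x]freeg_sumE (big_morph g gD (id1 := 0)) /=; last first.
    by rewrite /g -freeg_nil fglift_Freeg prelift_nil.
  by apply: eq_bigr => q _; rewrite /g liftU.
(* Scaling may shrink the support, so the expansion is also needed over larger lists. *)
have gs x s : uniq s -> {subset dom x <= s} -> g x = \sum_(q <- s) coeff q x *: q.
  move=> us ss; rewrite gsum [RHS](bigID (fun q => q \in dom x)) /= [X in _ = _ + X]big1 => [|q nq]; last first.
    by rewrite coeff_outdom // scale0r.
  rewrite addr0 -[RHS]big_filter; apply: perm_big; apply: uniq_perm.
  - exact: uniq_dom.
  - exact: filter_uniq.
  - by move=> q; rewrite mem_filter; apply/idP/andP => [h|[]//]; split=> //; apply: ss.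
move=> a x y; rewrite -!/(g _) gD; congr (_ + _).
rewrite (gs _ (dom x)) ?uniq_dom //; last exact: domZ_subset.
by rewrite gsum scaler_sumr; apply: eq_bigr => q _; rewrite coeffZ scalerA.
Qed.

(** The identity of P is lifted through the free module on the set P; the coefficients of the lift
    are the functionals. *)
Lemma dual_basis_exists P : projective_module P ->
  exists phi supp, @dual_basis P phi supp.
Proof.
move=> projP.
have [g gE] := linear_of_fun (@fglift_is_linear P).
have [id' idE] := linear_of_fun (fun (a : R) (x y : P) => erefl (a *: x + y)).
have [|h hK] := projP _ _ g id'.
  by move=> y; exists (Freeg [:: (1, y)]); rewrite gE liftU scale1r.
have /choice[phi phiE] : forall q : P, exists f : {linear P -> R^o}, forall x, f x = coeff q (h x).
  move=> q; have lin : linear (fun x => coeff q (h x) : R^o).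
    by move=> a x y; rewrite linearP coeffD coeffZ.
  by have [f fE] := linear_of_fun lin; exists f.
exists phi, (fun x => dom (h x)); split=> [x q nq|x s us ss].
  by rewrite phiE coeff_outdom.
rewrite -{1}[x]idE -hK gE -{1}[h x]freeg_sumE -gE linear_sum /=.
rewrite [RHS](bigID (fun q => q \in dom (h x))) /= [X in _ = _ + X]big1 ?addr0 => [|q nq]; last first.
  by rewrite phiE coeff_outdom // scale0r.
rewrite -[RHS]big_filter.
under eq_bigr do rewrite gE liftU -phiE.
apply: perm_big; apply: uniq_perm.
- exact: uniq_dom.
- exact: filter_uniq.
- by move=> q; rewrite mem_filter; apply/idP/andP => [hq|[]//]; split=> //; apply: ss.
Qed.

Lemma in_ideal_linear M N ys (f : {linear M -> N}) m :
  in_ideal ys m -> in_ideal ys (f m).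
Proof.
elim: ys m => [|y ys IH] m /=; first by move=> ->; rewrite linear0.
by case=> a /IH h; exists (f a); rewrite -linearZ -linearB.
Qed.

Lemma in_ideal0 M ys : in_ideal ys (0 : M).
Proof. by elim: ys => [|y ys IH] //=; exists 0; rewrite scaler0 subr0. Qed.

Lemma in_idealD M ys (m m' : M) : in_ideal ys m -> in_ideal ys m' -> in_ideal ys (m + m').
Proof.
elim: ys m m' => [|y ys IH] m m' /=; first by move=> -> ->; rewrite addr0.
by move=> [a ha] [a' ha']; exists (a + a'); rewrite scalerDr opprD addrACA; apply: IH.
Qed.

Lemma in_ideal_scale M ys (a : R^o) (q : M) : in_ideal ys a -> in_ideal ys ((a : R) *: q).
Proof.
elim: ys a => [|y ys IH] a /=; first by move=> ->; rewrite scale0r.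
case=> b /IH h; exists ((b : R) *: q); move: h.
by rewrite scalerBl scalerA.
Qed.

(** Membership can be checked on coordinates: m is the sum of the phi_q(m) q, and each phi_q(m) is
    in the ideal by regularity on R. *)
Lemma projective_regular P ys : projective_module P ->
  weakly_regular R^o ys -> weakly_regular P ys.
Proof.
move=> /dual_basis_exists[phi [supp [phi0 phiE]]].
elim: ys => [|y ys IH] //= [rys ry]; split; first exact: IH.
move=> m hm; rewrite (phiE m (undup (supp m))) ?undup_uniq //; last first.
  by move=> q; rewrite mem_undup.
apply: (big_ind (fun z : P => in_ideal ys z)) => [||q _].
- exact: in_ideal0.
- exact: in_idealD.
- apply: in_ideal_scale; apply: ry.
  by rewrite -linearZ; apply: in_ideal_linear.
Qed.

(** Dimension shifting. Lift c to c1 in P i; the differential of c1 has degree w + 1 and values in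
    the image of P i.+1, so by induction c1 can be corrected to a cocycle of P i, which is a
    coboundary. The degree grows up to w + (k - i), whence the bound. *)
Lemma koszul_exact_resolution (P : nat -> lmodType R)
    (d : forall i, {linear P i.+1 -> P i}) k ys :
  (forall i, projective_module (P i)) ->
  (forall i, (k < i)%N -> forall x : P i, x = 0) ->
  (forall i x, d i x = 0 <-> exists y, d i.+1 y = x) ->
  weakly_regular R^o ys ->
  forall i (V : lmodType R) (e : {linear P i -> V}) w,
  (forall x, e x = 0 <-> exists y, d i y = x) ->
  ((i <= k)%N -> (w + (k - i) < size ys)%N) ->
  forall c : bitseq -> V,
  (forall b, weight_of (size ys) w b -> exists x, e x = c b) ->
  (forall b, weight_of (size ys) w.+1 b -> koszul ys c b = 0) ->
  exists a : bitseq -> P i,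
    forall b, weight_of (size ys) w b -> c b = koszul ys (fun t => e (a t)) b.
Proof.
move=> projP P0 exP rys i.
have [m] := ubnP (k.+1 - i); elim: m i => // m IH i kim V e w exe wk c ce cc.
case: (ltnP k i) => [ki|ik].
  exists (fun=> 0) => b wb; have [x <-] := ce b wb.
  by rewrite koszul_linear (P0 _ ki x) (P0 _ ki (koszul _ _ _)).
have ws : (w < size ys)%N by apply: leq_ltn_trans (wk ik); rewrite leq_addr.
have [c1 hc1] : exists c1 : bitseq -> P i,
    forall b, weight_of (size ys) w b -> e (c1 b) = c b.
  have /choice[c1 h] : forall b, exists x, weight_of (size ys) w b -> e x = c b.
    move=> b; case: (pselect (weight_of (size ys) w b)) => [wb|nwb]; last by exists 0.
    by have [x ex] := ce b wb; exists x.
  by exists c1.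
have [|||||a' ha'] := IH i.+1 _ (P i) (d i) w.+1 _ _ (koszul ys c1).
- by lia.
- exact: exP.
- by move=> ik1; have := wk ik; lia.
- move=> b wb; apply/exe; rewrite -koszul_linear.
  by rewrite -(cc b wb); apply: eq_koszul wb.
- by move=> b _; rewrite koszul_koszul.
have [|a ha] := koszul_exact (w := w) (projective_regular (projP i) rys) ws (c := fun b => c1 b - d i (a' b)).
  by move=> b wb; rewrite koszulB ha' // subrr.
exists a => b wb; rewrite -hc1 // koszul_linear -ha // linearB.
by rewrite (_ : e (d i (a' b)) = 0) ?subr0 //; apply/exe; exists (a' b).
Qed.

End Projective.

(** * Linear forms, projections, and primality of their ideals *)

Section LinearForms.
Variables (K : fieldType) (n : nat).
Local Notation S := {mpoly K[n]}.
Implicit Types (f g y : S) (v : 'rV[K]_n).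

Lemma mpoly_morph_ext (T : nzRingType) (s1 s2 : {rmorphism S -> T}) :
  (forall c, s1 c%:MP = s2 c%:MP) -> (forall i, s1 'X_i = s2 'X_i) -> s1 =1 s2.
Proof.
move=> hC hX f; rewrite [f]mpolyE !rmorph_sum /=; apply: eq_bigr => m _.
rewrite -mul_mpolyC !rmorphM /= hC; congr (_ * _).
by rewrite mpolyXE_id !rmorph_prod /=; apply: eq_bigr => i _; rewrite !rmorphXn /= hX.
Qed.

Lemma dhomog1E y : y \is 1.-homog -> y = \sum_i y@_(U_(i))%MM *: 'X_i.
Proof.
move=> hy; apply/mpolyP => m; rewrite raddf_sum /=.
under eq_bigr do rewrite mcoeffZ mcoeffX.
have [/eqP/mdeg1P[i /eqP ->]|nm] := eqVneq (mdeg m) 1%N.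
  rewrite (bigD1 i) //= eqxx mulr1 big1 ?addr0 // => j ji.
  by rewrite eq_mnm1 (negbTE ji) mulr0.
rewrite (dhomog_nemf_coeff hy nm) big1 // => i _.
by rewrite (_ : (_ == m) = false) ?mulr0 //; apply: contraNF nm => /eqP <-; rewrite mdeg1.
Qed.

Lemma dhomog1X i : 'X_i \is [in K[n], 1.-homog].
Proof. by rewrite dhomogX /= mdeg1. Qed.

Lemma meval_linear y v : y \is 1.-homog -> y.@[v 0] = \sum_i y@_(U_(i))%MM * v 0 i.
Proof.
move=> hy; rewrite {1}(dhomog1E hy) raddf_sum /=.
by apply: eq_bigr => i _; rewrite mevalZ mevalXU.
Qed.

Lemma meval_linearP y a v u : y \is 1.-homog ->
  y.@[(a *: v + u) 0] = a * y.@[v 0] + y.@[u 0].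
Proof.
move=> hy; rewrite !meval_linear // mulr_sumr -big_split /=.
by apply: eq_bigr => i _; rewrite !mxE mulrDr mulrCA.
Qed.

Lemma dhomog1_eq0 y : y \is 1.-homog -> (forall v, y.@[v 0] = 0) -> y = 0.
Proof.
move=> hy y0; rewrite (dhomog1E hy) big1 // => i _.
have := y0 (delta_mx 0 i); rewrite meval_linear // (bigD1 i) //= big1 => [|j ji].
  by rewrite mxE !eqxx mulr1 addr0 => ->; rewrite scale0r.
by rewrite mxE (negbTE ji) andbF mulr0.
Qed.

Lemma dhomog1_neq0 y : y \is 1.-homog -> y != 0 -> exists v, y.@[v 0] != 0.
Proof.
move=> hy; apply: contra_neqP => /forallNP h; apply: dhomog1_eq0 => // v.
by apply/eqP/negPn/negP; apply: h.
Qed.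

(* Precomposition with x |-> x - y(x) v; when y(v) = 1 this is the projection onto y = 0 along v. *)
Definition shift y v : S -> S :=
  mmap (@mpolyC n K) (fun i => 'X_i - v 0 i *: y).

HB.instance Definition _ y v := GRing.RMorphism.on (shift y v).

Lemma shiftC y v c : shift y v c%:MP = c%:MP.
Proof. exact: mmapC. Qed.

Lemma shiftX y v i : shift y v 'X_i = 'X_i - v 0 i *: y.
Proof. by rewrite /shift mmapX mmap1U. Qed.

Lemma shiftZ y v c f : shift y v (c *: f) = c *: shift y v f.
Proof. by rewrite -!mul_mpolyC rmorphM /= shiftC. Qed.

Lemma shift_linear y v f : f \is 1.-homog -> shift y v f = f - f.@[v 0] *: y.
Proof.
move=> hf; rewrite meval_linear // {1 2}(dhomog1E hf) raddf_sum /= scaler_suml -sumrB.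
by apply: eq_bigr => i _; rewrite shiftZ shiftX scalerBr scalerA.
Qed.

Lemma shift_homog y v j f : y \is 1.-homog -> f \is j.-homog -> shift y v f \is j.-homog.
Proof.
move=> hy hf; rewrite [f]mpolyE raddf_sum /= big_seq; apply: rpred_sum => m mf.
rewrite shiftZ; apply: rpredZ; rewrite mpolyXE_id rmorph_prod /=.
have -> : j = (\sum_i m i)%N by have := dhomog_mf hf mf; rewrite /= mdegE => <-.
elim/big_ind2: _ => [|x1 x2 y1 y2 h1 h2|i _].
- exact: dhomog1.
- exact: dhomogM.
have hs : 'X_i - v 0 i *: y \is [in K[n], 1.-homog].
  by apply: rpredB; rewrite ?dhomog1X // rpredZ.
by rewrite rmorphXn /= shiftX; have := dhomogMn (m i) hs; rewrite mul1n.
Qed.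

Lemma meval_shift y v f (u : 'rV[K]_n) : y.@[u 0] = 0 -> (shift y v f).@[u 0] = f.@[u 0].
Proof.
move=> yu; pose s : {rmorphism S -> K} := meval (u 0) \o shift y v.
apply: (mpoly_morph_ext (s1 := s) (s2 := meval (u 0))) => [c|i] /=.
  by rewrite shiftC.
by rewrite shiftX mevalB mevalZ yu mulr0 subr0.
Qed.

Lemma shift_cong y v f : exists g, f - shift y v f = y * g.
Proof.
elim/mpolyind: f => [|c m f _ _ [g hg]]; first by exists 0; rewrite rmorph0 subr0 mulr0.
suff [h hh] : exists h, 'X_[m] - shift y v 'X_[m] = y * h.
  exists (c *: h + g); rewrite rmorphD /= shiftZ opprD addrACA hg -scalerBr hh.
  by rewrite mulrDr scalerAr.
rewrite mpolyXE_id rmorph_prod /=.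
elim/big_ind2: _ => [|x1 x2 y1 y2 [h hh] [k hk]|i _].
- by exists 0; rewrite subrr mulr0.
- exists (h * y1 + x2 * k).
  by rewrite mulrDr mulrA -hh mulrCA -hk; ring.
rewrite rmorphXn /= shiftX; elim: (m i) => [|a [h hh]].
  by exists 0; rewrite !expr0 subrr mulr0.
exists ('X_i * h + v 0 i *: ('X_i - v 0 i *: y) ^+ a).
by rewrite !exprS mulrDr mulrCA -hh -!mul_mpolyC; ring.
Qed.

Definition vanishing (ys : seq S) v := forall y, y \in ys -> y.@[v 0] = 0.

(* each form is nonzero at a point where all the following ones vanish *)
Fixpoint independent (ys : seq S) : Prop :=
  if ys is y :: ys' then
    [/\ independent ys', y \is 1.-homog
      & exists2 v : 'rV[K]_n, y.@[v 0] != 0 & forall z, z \in ys' -> z.@[v 0] = 0]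
  else True.

Lemma independent_homog ys y : independent ys -> y \in ys -> y \is 1.-homog.
Proof.
elim: ys => // z ys IH [iys hz _]; rewrite inE => /orP[/eqP ->//|].
exact: IH.
Qed.

Lemma in_ideal_sum (ys : seq S) (f : S^o) :
  in_ideal ys f <-> exists g : nat -> S, f = \sum_(i < size ys) ys`_i * g i.
Proof.
elim: ys f => [|y ys IH] f /=.
  by split=> [->|[g]]; [exists (fun=> 0)|]; rewrite big_ord0.
split=> [[a /IH[g hg]]|[g ->]].
  exists (fun i => if i is j.+1 then g j else a); rewrite big_ord_recl /=.
  by rewrite -hg addrC subrK.
exists (g 0%N); apply/IH; exists (fun i => g i.+1).
by rewrite big_ord_recl /= addrC addKr.
Qed.

(** Such an endomorphism has the ideal of ys as kernel and realises S / (ys) inside the domain S,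
    which gives primality. *)
Definition retraction (ys : seq S) (s : {rmorphism S -> S}) :=
  [/\ forall y, y \in ys -> s y = 0,
      forall f, in_ideal ys (f - s f : S^o)
    & forall v : 'rV[K]_n, (forall y, y \in ys -> y.@[v 0] = 0) ->
        forall f, (s f).@[v 0] = f.@[v 0]].

Lemma meval_linearZ y a v : y \is 1.-homog -> y.@[(a *: v) 0] = a * y.@[v 0].
Proof.
move=> hy; rewrite !meval_linear // mulr_sumr.
by apply: eq_bigr => i _; rewrite !mxE mulrCA.
Qed.

(** The retraction of ys is composed with the projection along w onto y = 0. As y(w) = 1 and ys
    vanish at w, this projection kills y and fixes the forms of ys. *)
Lemma independent_retraction ys : independent ys -> exists s, retraction ys s.
Proof.
elim: ys => [_|y ys IH [iys hy [v yv ysv]]].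
  by exists idfun; split=> //= f; rewrite subrr.
have [s [s0 sf sv]] := IH iys.
pose w := (y.@[v 0])^-1 *: v.
have yw : y.@[w 0] = 1 by rewrite meval_linearZ // mulVf.
have ysw z : z \in ys -> z.@[w 0] = 0.
  move=> zys; have hz := independent_homog (ys := ys) iys zys.
  by rewrite (meval_linearZ _ _ hz) (ysv _ zys) mulr0.
exists (s \o shift y w); split=> [z|f|u hu f] /=.
- rewrite inE => /orP[/eqP ->|zys].
    by rewrite shift_linear // yw scale1r subrr rmorph0.
  rewrite shift_linear; last exact: (independent_homog (ys := ys) iys zys).
  by rewrite ysw // scale0r subr0 s0.
- have [g hg] := shift_cong y w f; exists g.
  rewrite /GRing.scale /= -hg opprB addrC addrA subrK; exact: sf.
- rewrite sv; last by move=> z zys; rewrite hu // inE zys orbT.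
  by rewrite meval_shift // hu // inE eqxx.
Qed.

Lemma in_ideal_retraction ys s (f : S^o) : retraction ys s -> in_ideal ys f <-> s f = 0.
Proof.
move=> [s0 sf _]; split=> [/in_ideal_sum[g ->]|sf0]; last by have := sf f; rewrite sf0 subr0.
by rewrite rmorph_sum big1 // => i _; rewrite rmorphM /= s0 ?mul0r // mem_nth.
Qed.

Lemma independent_prime ys (f g : S) : independent ys ->
  in_ideal ys (f * g : S^o) -> in_ideal ys (f : S^o) \/ in_ideal ys (g : S^o).
Proof.
case/independent_retraction=> s rs; rewrite !(in_ideal_retraction _ rs) rmorphM.
by move/eqP; rewrite mulf_eq0 => /orP[]/eqP ->; [left|right].
Qed.

Lemma in_ideal_vanishing ys v (f : S) :
  vanishing ys v -> in_ideal ys (f : S^o) -> f.@[v 0] = 0.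
Proof.
move=> ysv /in_ideal_sum[g ->]; rewrite raddf_sum big1 // => i _ /=.
by rewrite mevalM ysv ?mul0r // mem_nth.
Qed.

(** The ideal of the following forms is prime and does not contain y, which is nonzero at one of
    their common zeros. *)
Lemma independent_regular ys : independent ys -> weakly_regular S^o ys.
Proof.
elim: ys => //= y ys IH [iys hy [v yv ysv]]; split; first exact: IH.
move=> f /(independent_prime iys)[|//] /(in_ideal_vanishing ysv) y0.
by rewrite y0 eqxx in yv.
Qed.

Lemma in_ideal1 (a : S) (f : S) : in_ideal [:: a] (f : S^o) <-> exists g, f = a * g.
Proof.
by split=> -[g hg]; exists g => /=; [apply/eqP; rewrite -subr_eq0; apply/eqP | rewrite hg subrr].
Qed.

Lemma in_ideal2 (a b : S) (f : S) :
  in_ideal [:: a; b] (f : S^o) <-> exists g h, f = a * g + b * h.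
Proof.
split=> [[g /in_ideal1[h hh]]|[g [h ->]]].
  by exists g, h; rewrite -hh addrC subrK.
by exists g; apply/in_ideal1; exists h; rewrite addrC addKr.
Qed.

Lemma linform_independent (a : linform K n) : independent [:: (a : S)].
Proof.
split=> //=; first exact: linform_homog.
have [v av] := dhomog1_neq0 (linform_homog a) (linform_neq0 a).
by exists v.
Qed.

Lemma linform_prime (a : linform K n) (f g : S) :
  (exists h, f * g = (a : S) * h) ->
  (exists h, f = (a : S) * h) \/ (exists h, g = (a : S) * h).
Proof.
by move/in_ideal1/(independent_prime (linform_independent a)) => [] /in_ideal1; [left|right].
Qed.

End LinearForms.

(** * The quotient by a linear form as a subring of S *)

Section QuotientRing.
Variables (K : fieldType) (n : nat) (a : linform K n).
Local Notation S := {mpoly K[n]}.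

Lemma bar_eq0 (f : S) : bar a f = 0 <-> exists g, f = (a : S) * g.
Proof.
have E : (f \in principal_ideal a) = (bar a f == bar a 0).
  by rewrite -[f in LHS]subr0 Quotient.idealrBE.
split=> [h|h]; first by apply/asboolP; move: E; rewrite h rmorph0 eqxx.
by apply/eqP; rewrite -(rmorph0 (bar a)) -E; apply/asboolP.
Qed.

Lemma bar_surj (x : Sbar a) : exists f, bar a f = x.
Proof. by exists (bar_repr x); rewrite barK. Qed.

Definition lift_form_vec : 'rV[K]_n :=
  xget 0 [set v : 'rV[K]_n | (a : S).@[v 0] = 1].

Lemma lift_form_vecE : (a : S).@[lift_form_vec 0] = 1.
Proof.
rewrite /lift_form_vec; case: xgetP => [v -> //|/forallNP no].
have [v av] := dhomog1_neq0 (linform_homog a) (linform_neq0 a).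
case: no; exists ((a : S).@[v 0]^-1 *: v) => /=.
by rewrite meval_linearZ ?linform_homog // mulVf.
Qed.

(** A section of [bar] that is a ring morphism: the projection onto a = 0 kills a, so the
    representative does not matter. Integrality and homogeneity in [Sbar a] are pulled back along
    it. *)
Definition lift_bar (x : Sbar a) : S := shift a lift_form_vec (bar_repr x).

Lemma lift_bar_bar f : lift_bar (bar a f) = shift a lift_form_vec f.
Proof.
rewrite /lift_bar; apply/eqP; rewrite -subr_eq0 -rmorphB /=; apply/eqP.
have /bar_eq0[g ->] : bar a (bar_repr (bar a f) - f) = 0 by rewrite rmorphB /= barK subrr.
by rewrite rmorphM /= shift_linear ?linform_homog // lift_form_vecE scale1r subrr mul0r.
Qed.

Lemma lift_barK : cancel lift_bar (bar a).
Proof.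
move=> x; have [f <-] := bar_surj x; rewrite lift_bar_bar.
apply/eqP; rewrite eq_sym -subr_eq0 -rmorphB /=; apply/eqP/bar_eq0.
exact: shift_cong.
Qed.

Lemma lift_bar_is_zmod_morphism : zmod_morphism lift_bar.
Proof.
move=> x y; have [f <-] := bar_surj x; have [g <-] := bar_surj y.
by rewrite -rmorphB !lift_bar_bar rmorphB.
Qed.

Lemma lift_bar_is_monoid_morphism : monoid_morphism lift_bar.
Proof.
split=> [|x y]; first by rewrite -(rmorph1 (bar a)) lift_bar_bar rmorph1.
have [f <-] := bar_surj x; have [g <-] := bar_surj y.
by rewrite -rmorphM !lift_bar_bar rmorphM.
Qed.

HB.instance Definition _ :=
  GRing.isZmodMorphism.Build (Sbar a) S lift_bar lift_bar_is_zmod_morphism.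
HB.instance Definition _ :=
  GRing.isMonoidMorphism.Build (Sbar a) S lift_bar lift_bar_is_monoid_morphism.

Lemma Sbar_scaleE (c : K) (x : Sbar a) : c *: x = bar a c%:MP * x.
Proof. by []. Qed.

Lemma barZ (c : K) (f : S) : bar a (c *: f) = c *: bar a f.
Proof. by rewrite Sbar_scaleE -mul_mpolyC rmorphM. Qed.

Lemma lift_barZ (c : K) (x : Sbar a) : lift_bar (c *: x) = c *: lift_bar x.
Proof. by rewrite Sbar_scaleE rmorphM /= lift_bar_bar shiftC mul_mpolyC. Qed.

Lemma Sbar_integral (x y : Sbar a) : x * y = 0 -> x = 0 \/ y = 0.
Proof.
move/(congr1 lift_bar)/eqP; rewrite rmorphM rmorph0 mulf_eq0 => /orP[]/eqP h; [left|right].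
  by rewrite -[x]lift_barK h rmorph0.
by rewrite -[y]lift_barK h rmorph0.
Qed.

Lemma Sbar_mulI (x y z : Sbar a) : x <> 0 -> x * y = x * z -> y = z.
Proof.
move=> nx /eqP; rewrite -subr_eq0 -mulrBr => /eqP/Sbar_integral[//|/eqP].
by rewrite subr_eq0 => /eqP.
Qed.

Lemma Sbar_grP j (x : Sbar a) : Sbar_gr j x <-> lift_bar x \is j.-homog.
Proof.
split=> [[f hf ->]|h]; last by exists (lift_bar x); rewrite ?lift_barK.
by rewrite lift_bar_bar shift_homog ?linform_homog.
Qed.

End QuotientRing.

(** * Argument tuples *)

Section Args.
Variables (K : fieldType) (R : comAlgType K).

Lemma set_arg_id p (f : 'I_p -> R) i : set_arg f i (f i) = f.
Proof. by apply/funext => j; rewrite /set_arg; case: eqP => [->|]. Qed.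

Lemma set_argE p (f : 'I_p -> R) i a : set_arg f i a i = a.
Proof. by rewrite /set_arg eqxx. Qed.

Lemma set_arg_neq p (f : 'I_p -> R) i a j : j != i -> set_arg f i a j = f j.
Proof. by rewrite /set_arg => /negbTE ->. Qed.

Lemma set_argC p (f : 'I_p -> R) i j a b : i != j ->
  set_arg (set_arg f i a) j b = set_arg (set_arg f j b) i a.
Proof.
move=> ij; apply/funext => k; rewrite /set_arg.
by case: (eqVneq k j) => // ->; rewrite eq_sym (negbTE ij).
Qed.

Lemma cons_arg0 p (a : R) (f : 'I_p -> R) : cons_arg a f ord0 = a.
Proof. by rewrite /cons_arg unlift_none. Qed.

Lemma cons_argS p (a : R) (f : 'I_p -> R) i : cons_arg a f (lift ord0 i) = f i.
Proof. by rewrite /cons_arg liftK. Qed.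

Lemma cons_arg_eta p (f : 'I_p.+1 -> R) : cons_arg (f ord0) (fun i => f (lift ord0 i)) = f.
Proof.
apply/funext => i; case: (unliftP ord0 i) => [j ->|->]; first by rewrite cons_argS.
by rewrite cons_arg0.
Qed.

Lemma set_arg_cons0 p a b (f : 'I_p -> R) : set_arg (cons_arg a f) ord0 b = cons_arg b f.
Proof.
apply/funext => i; case: (unliftP ord0 i) => [j ->|->].
  by rewrite set_arg_neq ?cons_argS // eq_sym neq_lift.
by rewrite set_argE cons_arg0.
Qed.

Lemma set_arg_consS p a (f : 'I_p -> R) i b :
  set_arg (cons_arg a f) (lift ord0 i) b = cons_arg a (set_arg f i b).
Proof.
apply/funext => j; case: (unliftP ord0 j) => [k ->|->].
  by rewrite cons_argS /set_arg (inj_eq lift_inj) cons_argS.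
by rewrite set_arg_neq ?cons_arg0 // neq_lift.
Qed.

End Args.

Lemma mderiv_var (K : fieldType) n (i j : 'I_n) : 'X_i^`M(j) = ((i == j)%:R : K)%:MP_[n].
Proof.
apply/mpolyP => m; rewrite mcoeff_deriv mcoeffX mcoeffC.
case: (eqVneq i j) => [<-|ij].
  rewrite -{1}[U_(i)%MM]add0m eqm_add2r eq_sym mul1r; case: eqP => [->|_]; last by rewrite mul0rn.
  by rewrite mnm0E.
rewrite mul0r; case: eqP => [/(congr1 (fun u : 'X_{1..n} => u j))|_]; last by rewrite mul0rn.
by rewrite mnmDE !mnmE eqxx (negbTE ij) addn1.
Qed.

(** * Multiderivations along a morphism and their values on variables *)

Section MultiDerivationAlong.
Variables (K : fieldType) (n : nat) (R : comAlgType K).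
Local Notation S := {mpoly K[n]}.
Variable h : {rmorphism S -> R}.
Hypothesis hZ : forall c f, h (c *: f) = c *: h f.

(** Alternation is left out because [mder_of] has it only for suitable c. *)
Definition mder_along p (psi : ('I_p -> S) -> R) : Prop :=
  (forall f i (c : K) a b, psi (set_arg f i (c *: a + b)) =
     c *: psi (set_arg f i a) + psi (set_arg f i b)) /\
  (forall f i a b, psi (set_arg f i (a * b)) =
     h a * psi (set_arg f i b) + h b * psi (set_arg f i a)).

(** The multiderivation with value c s on the variables x_s. The sum runs over all index tuples, not
    only increasing ones, so no factorials occur and the characteristic is arbitrary. *)
Definition mder_of p (c : {ffun 'I_p -> 'I_n} -> R) (f : 'I_p -> S) : R :=
  \sum_(s : {ffun 'I_p -> 'I_n}) (\prod_i h ((f i)^`M(s i))) * c s.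

Lemma mder_of_along p c : mder_along (@mder_of p c).
Proof.
have prodE f i a (s : {ffun 'I_p -> 'I_n}) :
    \prod_j h ((set_arg f i a j)^`M(s j)) =
    h (a^`M(s i)) * \prod_(j | j != i) h ((f j)^`M(s j)).
  rewrite (bigD1 i) //= set_argE; congr (_ * _).
  by apply: eq_bigr => j ji; rewrite set_arg_neq.
split=> [f i k a b|f i a b]; rewrite /mder_of.
  rewrite scaler_sumr -big_split /=; apply: eq_bigr => s _.
  by rewrite !prodE linearP rmorphD /= hZ !mulrDl !scalerAl.
rewrite !mulr_sumr -big_split /=; apply: eq_bigr => s _.
rewrite !prodE mderivM rmorphD !rmorphM /=; ring.
Qed.

Lemma mder_along0 p psi (f : 'I_p -> S) i : mder_along psi -> f i = 0 -> psi f = 0.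
Proof.
case=> lin _ fi; have := lin f i (-1) 0 0.
rewrite scaler0 addr0 -fi set_arg_id scaleN1r addNr; exact.
Qed.

Lemma mder_along1 p psi (f : 'I_p -> S) i : mder_along psi -> f i = 1 -> psi f = 0.
Proof.
case=> _ lei fi; have := lei f i 1 1; rewrite mulr1 -fi set_arg_id fi rmorph1 mul1r.
by move/eqP; rewrite -subr_eq0 opprD addrA subrr sub0r oppr_eq0 => /eqP.
Qed.

(** Induction on the number k of leading arguments that may be arbitrary; the last of these is
    treated by induction on polynomials. *)
Lemma mder_along_eq0 p psi : @mder_along p psi ->
  (forall s : 'I_p -> 'I_n, psi (fun i => 'X_(s i)) = 0) -> forall f, psi f = 0.
Proof.
move=> dpsi psiX; have [lin lei] := dpsi.
suff H k f : (forall i : 'I_p, (k <= i)%N -> exists j, f i = 'X_j) -> psi f = 0.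
  by move=> f; apply: (H p) => i; rewrite leqNgt ltn_ord.
elim: k f => [|k IH] f hf.
  have /choice[s hs] : forall i, exists j, f i = 'X_j by move=> i; apply: hf.
  by have -> : f = (fun i => 'X_(s i)) by apply/funext.
case: (ltnP k p) => [kp|pk]; last first.
  by apply: IH => i ki; have := ltn_ord i; rewrite ltnNge (leq_trans pk ki).
pose i0 := Ordinal kp; rewrite -[f](set_arg_id _ i0); move: (f i0) => a.
have psiV j : psi (set_arg f i0 'X_j) = 0.
  apply: IH => i ki; rewrite /set_arg; case: eqP => [_|/eqP ne]; first by exists j.
  by apply: hf; rewrite ltn_neqAle ki andbT; apply: contraNneq ne => e; apply/eqP/val_inj; rewrite /= e.
have psiM b c : psi (set_arg f i0 b) = 0 -> psi (set_arg f i0 c) = 0 ->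
    psi (set_arg f i0 (b * c)) = 0 by move=> hb hc; rewrite lei hb hc !mulr0 addr0.
have psi1 : psi (set_arg f i0 1) = 0 by apply: (mder_along1 (i := i0)); rewrite ?set_argE.
elim/mpolyind: a => [|c m g _ _ hg].
  by apply: (mder_along0 (i := i0)); rewrite ?set_argE.
rewrite lin hg addr0 mpolyXE_id.
suff -> : psi (set_arg f i0 (\prod_(i < n) 'X_i ^+ m i)) = 0 by rewrite scaler0.
elim/big_ind: _ => [//|x y|i _]; first exact: psiM.
elim: (m i) => [|e IHe]; first by rewrite expr0.
by rewrite exprS; apply: psiM.
Qed.

Lemma mder_ofX p c (t : {ffun 'I_p -> 'I_n}) : mder_of c (fun i => 'X_(t i)) = c t.
Proof.
rewrite /mder_of (bigD1 t) //= big1 => [|i _]; last by rewrite mderiv_var eqxx mpolyC1 rmorph1.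
rewrite mul1r big1 ?addr0 // => s st.
have [i ti] : exists i, t i != s i.
  by apply/existsP; apply: contraNT st; rewrite negb_exists => /forallP e; apply/eqP/ffunP => i; apply/eqP; rewrite eq_sym; have := e i; rewrite negbK.
by rewrite (bigD1 i) //= mderiv_var (negbTE ti) mpolyC0 rmorph0 !mul0r.
Qed.

Lemma mder_along_formula p psi f : @mder_along p psi ->
  psi f = mder_of (fun s => psi (fun i => 'X_(s i))) f.
Proof.
move=> dpsi; set c := (fun s => _); have [lin lei] := dpsi.
have [lin' lei'] := mder_of_along c.
apply/eqP; rewrite -subr_eq0; apply/eqP; move: f.
apply: (@mder_along_eq0 p (fun f => psi f - mder_of c f)) => [|s].
  split=> [f i k a b|f i a b]; first by rewrite lin lin' scalerBr opprD addrACA.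
  by rewrite lei lei' !mulrBr opprD addrACA.
have -> : (fun i => 'X_(s i)) = (fun i => 'X_([ffun i => s i] i)) :> ('I_p -> S).
  by apply/funext => i; rewrite ffunE.
by rewrite mder_ofX subrr.
Qed.

(** The terms of s and of s with its entries at i and j exchanged cancel. Splitting by the order of
    s i and s j avoids a division by 2. *)
Lemma mder_of_alternating p (c : {ffun 'I_p -> 'I_n} -> R) (f : 'I_p -> S) i j :
  (forall s : {ffun 'I_p -> 'I_n}, s i = s j -> c s = 0) ->
  (forall s : {ffun 'I_p -> 'I_n}, c [ffun k => s (tperm i j k)] = - c s) ->
  i != j -> f i = f j -> mder_of c f = 0.
Proof.
move=> c0 cN ij fij; rewrite /mder_of.
pose F (s : {ffun 'I_p -> 'I_n}) := (\prod_i h ((f i)^`M(s i))) * c s.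
pose sw (s : {ffun 'I_p -> 'I_n}) := [ffun k => s (tperm i j k)].
have swK : involutive sw by move=> s; apply/ffunP => k; rewrite !ffunE tpermK.
have Fsw s : F (sw s) = - F s.
  rewrite /F cN mulrN; congr (- (_ * _)).
  rewrite [RHS](reindex_inj (@perm_inj _ (tperm i j))) /=.
  apply: eq_bigr => k _; rewrite ffunE; congr (h (mderiv _ _)).
  by case: tpermP => [->|->|].
rewrite (bigID (fun s : {ffun 'I_p -> 'I_n} => (s i < s j)%N)) /=.
rewrite [X in _ + X](bigID (fun s : {ffun 'I_p -> 'I_n} => (s j < s i)%N)) /=.
rewrite [X in _ + (_ + X)]big1 => [|s /andP[h1 h2]]; last first.
  have e : s i = s j by apply: ord_inj; apply/eqP; rewrite eqn_leq [(s i <= _)%N]leqNgt h2 leqNgt h1.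
  by rewrite (c0 _ e) mulr0.
rewrite addr0 [X in _ + X](reindex_inj (inv_inj swK)) /=.
rewrite [X in _ + X](eq_big (fun s : {ffun 'I_p -> 'I_n} => (s i < s j)%N) (fun s => - F s)).
- by rewrite sumrN subrr.
- by move=> s; rewrite !ffunE tpermL tpermR; case: ltngtP.
- by move=> s _; exact: Fsw.
Qed.

End MultiDerivationAlong.

(** * Multiderivations and logarithmic multiderivations *)

Section MultiDerivations.
Variables (K : fieldType) (R : comAlgType K).

Lemma multider_set0 p (theta : ('I_p -> R) -> R) f i :
  multiderivation theta -> theta (set_arg f i 0) = 0.
Proof.
case=> lin _ _; have := lin f i (-1) 0 0.
by rewrite scaler0 addr0 scaleN1r addNr.
Qed.

Lemma multider_setD p (theta : ('I_p -> R) -> R) f i a b :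
  multiderivation theta ->
  theta (set_arg f i (a + b)) = theta (set_arg f i a) + theta (set_arg f i b).
Proof. by case=> lin _ _; have := lin f i 1 a b; rewrite !scale1r. Qed.

Lemma multider_setZ p (theta : ('I_p -> R) -> R) f i (c : K) a :
  multiderivation theta ->
  theta (set_arg f i (c *: a)) = c *: theta (set_arg f i a).
Proof.
move=> mt; have [lin _ _] := mt; have := lin f i c a 0.
by rewrite (multider_set0 _ _ mt) !addr0.
Qed.

Lemma multider_swap p (theta : ('I_p -> R) -> R) f i j :
  multiderivation theta -> i != j -> theta (fun k => f (tperm i j k)) = - theta f.
Proof.
move=> mt ij; have [_ _ alt] := mt.
pose F a b := theta (set_arg (set_arg f i a) j b).
have Faa a : F a a = 0.
  apply: (alt _ i j ij); rewrite set_argE set_arg_neq // set_argE //.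
have FDr a b c : F a (b + c) = F a b + F a c by rewrite /F multider_setD.
have FDl a b c : F (a + b) c = F a c + F b c.
  by rewrite /F !(set_argC _ _ _ ij) multider_setD.
have : F (f i + f j) (f i + f j) = 0 by [].
rewrite FDl !FDr !Faa add0r addr0 => /eqP; rewrite addrC addr_eq0 => /eqP Fji.
have -> : theta f = F (f i) (f j) by rewrite /F set_arg_id set_arg_id.
rewrite -Fji /F; congr theta; apply/funext => k; rewrite /set_arg.
case: tpermP => [->|->|/eqP/negbTE -> /eqP/negbTE ->] //; last by rewrite eqxx.
by rewrite (negbTE ij) eqxx.
Qed.

Lemma multider_perm p (theta : ('I_p -> R) -> R) f (s : 'S_p) :
  multiderivation theta -> theta (fun k => f (s k)) = (-1) ^+ s * theta f.
Proof.
move=> mt; case: (prod_tpermP s) => ts -> {s} hts.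
elim: ts f hts => [|t ts IH] f /=.
  move=> _; rewrite big_nil odd_perm1 expr0 mul1r; congr theta.
  by apply/funext => k; rewrite perm1.
case/andP=> dt hts; rewrite big_cons odd_mul_tperm dt.
have -> : (fun k => f ((tperm t.1 t.2 * \prod_(t0 <- ts) tperm t0.1 t0.2)%g k)) =
          (fun k => (fun l => f ((\prod_(t0 <- ts) tperm t0.1 t0.2)%g l)) (tperm t.1 t.2 k)).
  by apply/funext => k; rewrite permM.
rewrite (multider_swap (fun l => f ((\prod_(t0 <- ts) tperm t0.1 t0.2)%g l)) mt dt).
by rewrite IH // signr_addb expr1 mulN1r mulNr.
Qed.

Lemma multider_scale p (theta : ('I_p -> R) -> R) a :
  multiderivation theta -> multiderivation (fun f => a * theta f).
Proof.
case=> lin lei alt; split=> [f i c x y|f i x y|f i j ij fij].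
- by rewrite lin mulrDr scalerAr.
- by rewrite lei mulrDr !(mulrCA a).
- by rewrite (alt _ _ _ ij fij) mulr0.
Qed.

Lemma multider_add p (theta eta : ('I_p -> R) -> R) :
  multiderivation theta -> multiderivation eta ->
  multiderivation (fun f => theta f + eta f).
Proof.
move=> [lin lei alt] [lin' lei' alt']; split=> [f i c x y|f i x y|f i j ij fij].
- by rewrite lin lin' scalerDr addrACA.
- by rewrite lei lei' !mulrDr addrACA.
- by rewrite (alt _ _ _ ij fij) (alt' _ _ _ ij fij) addr0.
Qed.

Lemma multider0 p : @multiderivation K R p (fun=> 0).
Proof. by split=> *; rewrite ?scaler0 ?mulr0 ?addr0. Qed.

Lemma multider_cancel p (theta : ('I_p -> R) -> R) a :
  (forall x y, a * x = a * y -> x = y) ->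
  multiderivation (fun f => a * theta f) -> multiderivation theta.
Proof.
move=> ai [lin lei alt]; split=> [f i c x y|f i x y|f i j ij fij]; apply: ai.
- by rewrite lin mulrDr scalerAr.
- by rewrite lei mulrDr !(mulrCA a).
- by rewrite (alt _ _ _ ij fij) mulr0.
Qed.

Variables (I : choiceType) (alpha : I -> R) (A : {fset I}).

Lemma logderP q (theta : ('I_q.+1 -> R) -> R) :
  logder alpha A q.+1 theta <-> multiderivation theta /\
  forall L, L \in A -> forall g, exists k, theta (cons_arg (alpha L) g) = alpha L * k.
Proof.
split=> -[mt h]; split=> // L LA.
  by move=> g; apply: (h L LA _ ord0); rewrite ?cons_arg0.
move=> f i i0 fi; have -> : f = cons_arg (alpha L) (fun j => f (lift ord0 j)).
  by rewrite -fi (_ : i = ord0) ?cons_arg_eta //; apply: val_inj.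
exact: h.
Qed.

Lemma logder0P (theta : ('I_0 -> R) -> R) :
  logder alpha A 0 theta <-> multiderivation theta.
Proof. by split=> [[]//|mt]; split=> // L _ f []. Qed.

Lemma logder_scale p theta a :
  logder alpha A p theta -> logder alpha A p (fun f => a * theta f).
Proof.
case=> mt h; split=> [|L LA f i i0 fi]; first exact: multider_scale.
by have [g ->] := h L LA f i i0 fi; exists (a * g); rewrite mulrCA.
Qed.

Lemma logder_add p theta eta :
  logder alpha A p theta -> logder alpha A p eta ->
  logder alpha A p (fun f => theta f + eta f).
Proof.
move=> [mt h] [mt' h']; split=> [|L LA f i i0 fi]; first exact: multider_add.
have [g ->] := h L LA f i i0 fi; have [g' ->] := h' L LA f i i0 fi.
by exists (g + g'); rewrite mulrDr.
Qed.

Lemma logder0 p : logder alpha A p (fun=> 0).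
Proof.
by split=> [|L LA f i i0 fi]; [exact: multider0|exists 0; rewrite mulr0].
Qed.

End MultiDerivations.

Section MultiDerivationsOnPolynomials.
Variables (K : fieldType) (n : nat) (R : comAlgType K).
Local Notation S := {mpoly K[n]}.
Variable h : {rmorphism S -> R}.
Hypothesis hZ : forall c f, h (c *: f) = c *: h f.

Lemma multider_along p (eta : ('I_p -> R) -> R) :
  multiderivation eta -> mder_along h (fun f => eta (fun i => h (f i))).
Proof.
have hset (f : 'I_p -> S) i a :
    (fun j => h (set_arg f i a j)) = set_arg (fun j => h (f j)) i (h a).
  by apply/funext => j; rewrite /set_arg; case: eqP.
case=> lin lei _; split=> [f i c a b|f i a b]; rewrite !hset.
  by rewrite rmorphD /= hZ lin.
by rewrite rmorphM lei.
Qed.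

(** Pulled back along h, both sides are determined by their values on variables; identities over
    [Sbar] are checked this way. *)
Lemma multider_ext p (eta eta' : ('I_p -> R) -> R) :
  (forall x, exists f, h f = x) ->
  multiderivation eta -> multiderivation eta' ->
  (forall s : 'I_p -> 'I_n, eta (fun i => h 'X_(s i)) = eta' (fun i => h 'X_(s i))) ->
  eta = eta'.
Proof.
move=> surj /multider_along me /multider_along me' E; apply/funext => g.
have /choice[f hf] : forall i, exists f, h f = g i by move=> i; apply: surj.
have -> : g = (fun i => h (f i)) by apply/funext => i.
rewrite (mder_along_formula hZ f me) (mder_along_formula hZ f me').
by apply: eq_bigr => s _; rewrite E.
Qed.

End MultiDerivationsOnPolynomials.

(** * Divisibility by products of primes *)

Section PrimeDivisibility.
Variable R : comNzRingType.
Implicit Types (x y z f : R).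

Definition divides x y := exists z, y = x * z.

Lemma prime_pow_dvd x y z (e d : nat) :
  (forall u v, x * u = x * v -> u = v) ->
  (forall u v, divides x (u * v) -> divides x u \/ divides x v) ->
  ~ divides x y -> divides (x ^+ e) (y ^+ d * z) -> divides (x ^+ e) z.
Proof.
move=> xI xp nxy; have nxyd : ~ divides x (y ^+ d).
  elim: d => [|d IH]; last by rewrite exprS => /xp[].
  by rewrite expr0 => -[u xu]; apply: nxy; exists (u * y); rewrite mulrA -xu mul1r.
elim: e => [|e IH]; first by exists z; rewrite expr0 mul1r.
case=> k hk; have [g hg] : divides (x ^+ e) z.
  by apply: IH; exists (x * k); rewrite hk exprSr mulrA.
have xeI u v : x ^+ e * u = x ^+ e * v -> u = v.
  elim: (e) => [|a IHa]; first by rewrite expr0 !mul1r.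
  by rewrite exprS -!mulrA => /xI.
have /xp[//|[w hw]] : divides x (y ^+ d * g).
  by exists k; apply: xeI; rewrite [RHS]mulrA -exprSr -hk hg mulrCA.
by exists w; rewrite hg hw exprSr mulrA.
Qed.

(** One prime power is split off; by [prime_pow_dvd] the others still divide the cofactor. This
    serves for the alpha_L in S and for the beta_U in Sbar. *)
Lemma prod_prime_dvd (I : eqType) (s : seq I) (P : I -> R) (e : I -> nat) f :
  uniq s ->
  (forall i, i \in s -> forall u v, P i * u = P i * v -> u = v) ->
  (forall i, i \in s -> forall u v, divides (P i) (u * v) ->
     divides (P i) u \/ divides (P i) v) ->
  (forall i j, i \in s -> j \in s -> i != j -> ~ divides (P i) (P j)) ->
  (forall i, i \in s -> divides (P i ^+ e i) f) ->
  divides (\prod_(i <- s) P i ^+ e i) f.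
Proof.
elim: s f => [|i s IH] f /=; first by exists f; rewrite big_nil mul1r.
case/andP=> nis us PI Pp Pn Pf.
have [g fg] := Pf i (mem_head _ _).
have sub j : j \in s -> j \in i :: s by move=> js; rewrite inE js orbT.
have [||||k gk] := IH g us.
- by move=> j /sub; apply: PI.
- by move=> j /sub; apply: Pp.
- by move=> j l /sub js /sub ls; apply: Pn.
- move=> j js; have jis := sub j js.
  apply: (prime_pow_dvd (y := P i) (d := e i)); [exact: PI|exact: Pp| |].
    by apply: Pn; rewrite ?mem_head //; apply: contraNneq nis => <-.
  by rewrite -fg; apply: Pf.
by exists k; rewrite big_cons fg gk mulrA.
Qed.

End PrimeDivisibility.

(** * Linear forms with prescribed zeros on a hyperplane *)

Section LinearFormsOnHyperplane.
Variables (K : fieldType) (n : nat).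
Local Notation S := {mpoly K[n]}.

Lemma vanishing_on_hyperplane (a : linform K n) (y : S) : y \is 1.-homog ->
  (forall v : 'rV[K]_n, (a : S).@[v 0] = 0 -> y.@[v 0] = 0) ->
  exists e : K, y = e *: (a : S).
Proof.
move=> hy ya; have ha := linform_homog a.
have a1 := lift_form_vecE a; set u := lift_form_vec a in a1.
exists y.@[u 0]; apply/eqP; rewrite -subr_eq0; apply/eqP.
apply: dhomog1_eq0; first by rewrite rpredB ?rpredZ.
move=> v; rewrite mevalB mevalZ.
have := ya (- (a : S).@[v 0] *: u + v); rewrite !meval_linearP // a1 mulr1 addNr => /(_ erefl).
by move/eqP; rewrite mulNr addrC subr_eq0 => /eqP ->; rewrite mulrC subrr.
Qed.

(** The multiple of y with the same value as z at u is subtracted; the rest vanishes on all of a =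
    0, which is spanned by u and the zeros of y in it. *)
Lemma proportional_on_hyperplane (a : linform K n) (y z : S) (u : 'rV[K]_n) :
  y \is 1.-homog -> z \is 1.-homog ->
  (a : S).@[u 0] = 0 -> y.@[u 0] != 0 ->
  (forall v : 'rV[K]_n, (a : S).@[v 0] = 0 -> y.@[v 0] = 0 -> z.@[v 0] = 0) ->
  exists e, z = (z.@[u 0] / y.@[u 0]) *: y + e *: (a : S).
Proof.
move=> hy hz au yu yz; have ha := linform_homog a.
have [|v av|e he] := vanishing_on_hyperplane (a := a) (y := z - (z.@[u 0] / y.@[u 0]) *: y).
- by rewrite rpredB ?rpredZ.
- rewrite mevalB mevalZ; have := yz (- (y.@[v 0] / y.@[u 0]) *: u + v).
  rewrite !meval_linearP // au av mulr0 addr0 mulNr divfK // addNr => /(_ erefl erefl)/eqP.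
  rewrite mulNr addrC subr_eq0 => /eqP ->.
  by rewrite mulrAC [z.@[_] / _ * _]mulrAC [z.@[_] * _]mulrC subrr.
- by exists e; rewrite -he addrC subrK.
Qed.

End LinearFormsOnHyperplane.

(** * The map [dbar] and its kernel *)

Section Dbar.
Variables (K : fieldType) (n : nat).
Local Notation S := {mpoly K[n]}.
Local Notation subspace := {vspace 'rV[K]_n}.
Variables (alpha : subspace -> linform K n) (H : subspace).
Local Notation a := (alpha H).
Local Notation bara := (bar (alpha H)).

Lemma bar_consS q (theta : ('I_q.+1 -> S) -> S) f i (x : S) :
  multiderivation theta ->
  bara (theta (cons_arg (a : S) (set_arg f i ((a : S) * x)))) = 0.
Proof.
case=> _ lei alt; rewrite -set_arg_consS lei rmorphD !rmorphM /=.
have -> : bara (a : S) = 0 by apply/bar_eq0; exists 1; rewrite mulr1.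
rewrite mul0r add0r (alt _ ord0 (lift ord0 i)) ?rmorph0 ?mulr0 ?neq_lift //.
by rewrite set_argE set_arg_neq ?neq_lift // cons_arg0.
Qed.

Lemma bar_cons_ext q (theta : ('I_q.+1 -> S) -> S) f f' :
  multiderivation theta -> (forall i, bara (f i) = bara (f' i)) ->
  bara (theta (cons_arg (a : S) f)) = bara (theta (cons_arg (a : S) f')).
Proof.
(* [F k] takes its first k arguments from f' and the others from f: arguments are exchanged one at a
   time. *)
move=> mt ff'; pose F k (i : 'I_q) := if (i < k)%N then f' i else f i.
have E k : bara (theta (cons_arg (a : S) f)) = bara (theta (cons_arg (a : S) (F k))).
  elim: k => [|k IH]; first by congr (bara (theta (cons_arg _ _))); apply/funext.
  rewrite {}IH; case: (ltnP k q) => [kq|qk]; last first.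
    congr (bara (theta (cons_arg _ _))); apply/funext => i.
    have ik := leq_trans (ltn_ord i) qk.
    by rewrite /F ltnS ik (ltnW ik).
  pose i0 := Ordinal kq.
  have [g fg] : exists g, f' i0 - f i0 = (a : S) * g.
    by apply/bar_eq0; rewrite rmorphB /= ff' subrr.
  have -> : F k.+1 = set_arg (F k) i0 (F k i0 + (a : S) * g).
    apply/funext => i; rewrite /set_arg /F; case: (eqVneq i i0) => [->|ni].
      by rewrite ltnSn ltnn -fg addrC subrK.
    rewrite ltnS leq_eqVlt; case: eqP => // ik.
    by case/eqP: ni; apply: val_inj.
  rewrite -set_arg_consS multider_setD // !set_arg_consS set_arg_id rmorphD /=.
  by rewrite bar_consS // addr0.
by rewrite (E q); congr (bara (theta (cons_arg _ _))); apply/funext => i; rewrite /F ltn_ord.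
Qed.

Lemma dbar_bar q (theta : ('I_q.+1 -> S) -> S) f : multiderivation theta ->
  dbar (H := H) theta (fun i => bara (f i)) = bara (theta (cons_arg (a : S) f)).
Proof.
by move=> mt; rewrite /dbar; apply: bar_cons_ext => // i; rewrite barK.
Qed.

Lemma lift_args q (g : 'I_q -> Sbar a) : exists f, g = (fun i => bara (f i)).
Proof.
have /choice[f hf] : forall i, exists f, bara f = g i by move=> i; apply: bar_surj.
by exists f; apply/funext => i; rewrite hf.
Qed.

Lemma bar_set_arg q (f : 'I_q -> S) i x :
  (fun j => bara (set_arg f i x j)) = set_arg (fun j => bara (f j)) i (bara x).
Proof. by apply/funext => j; rewrite /set_arg; case: eqP. Qed.

Lemma dbar_multider q (theta : ('I_q.+1 -> S) -> S) :
  multiderivation theta -> multiderivation (dbar (alpha := alpha) (H := H) theta).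
Proof.
move=> mt; have [lin lei alt] := mt; split=> [g i c x y|g i x y|g i j ij gij].
- have [f ->] := lift_args g; have [u <-] := bar_surj x; have [v <-] := bar_surj y.
  rewrite -barZ -rmorphD -!bar_set_arg !dbar_bar // -!set_arg_consS lin.
  by rewrite rmorphD /= barZ.
- have [f ->] := lift_args g; have [u <-] := bar_surj x; have [v <-] := bar_surj y.
  rewrite -rmorphM -!bar_set_arg !dbar_bar // -!set_arg_consS lei.
  by rewrite rmorphD !rmorphM.
- have [f ef] := lift_args g.
  (* Equal arguments of g are given equal representatives, so that alternation of theta applies. *)
  have -> : g = (fun k => bara (set_arg f j (f i) k)).
    apply/funext => k; rewrite /set_arg; case: eqP => [->|_]; last by rewrite ef.
    by rewrite -gij ef.
  rewrite dbar_bar // (alt _ (lift ord0 i) (lift ord0 j)) ?rmorph0 ?(inj_eq lift_inj) //.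
  by rewrite !cons_argS set_argE set_arg_neq.
Qed.

Lemma dbarB p (theta eta : ('I_p -> S) -> S) g :
  dbar (alpha := alpha) (H := H) (theta - eta) g = dbar theta g - dbar eta g.
Proof.
by case: p theta eta g => [|q] theta eta g /=; rewrite ?subr0 // rmorphB.
Qed.

Lemma dbarM p (f : S) (theta : ('I_p -> S) -> S) g :
  dbar (alpha := alpha) (H := H) (fun x => f * theta x) g = bara f * dbar theta g.
Proof. by case: p theta g => [|q] theta g /=; rewrite ?mulr0 // rmorphM. Qed.

Lemma dbar_kernel (A : {fset subspace}) q theta : H \in A ->
  logder (fun L => alpha L : S) A q.+1 theta <->
  logder (fun L => alpha L : S) (A `\ H) q.+1 theta /\
  dbar (alpha := alpha) (H := H) theta = (fun=> 0).
Proof.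
move=> HA; rewrite !logderP; split=> [[mt h]|[[mt h] d0]].
  split; first by split=> // L; rewrite in_fsetD1 => /andP[_]; apply: h.
  by apply/funext => g; rewrite /dbar; apply/bar_eq0; apply: h.
split=> // L LA g; case: (eqVneq L H) => [->|LH]; last by apply: h; rewrite in_fsetD1 LH.
by apply/bar_eq0; rewrite -dbar_bar // d0.
Qed.

End Dbar.

(** * Restricted forms and the element [Bbar] *)

Section ArrangementForms.
Variables (K : fieldType) (n : nat).
Local Notation S := {mpoly K[n]}.
Local Notation subspace := {vspace 'rV[K]_n}.
Variables (alpha : subspace -> linform K n) (H : subspace).
Variable beta : subspace -> Sbar (alpha H).
Local Notation a := (alpha H).
Local Notation bara := (bar (alpha H)).

Record arrangement_data (A : {fset subspace}) : Prop := ArrangementData {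
  ad_arr : arrangement A;
  ad_H : H \in A;
  ad_form : forall L, L \in A -> defining_form (alpha L) L;
  ad_rform : forall U, U \in restriction A H -> defining_form_in H (beta U) U }.

Variable A : {fset subspace}.
Hypothesis dA : arrangement_data A.

Lemma in_formE L v : L \in A -> v \in L <-> (alpha L : S).@[v 0] = 0.
Proof. by move=> LA; rewrite (ad_form dA LA); split=> /eqP. Qed.

Lemma hyperplane_eq L L' : L \in A -> L' \in A -> (L <= L')%VS -> L = L'.
Proof.
move=> LA L'A LL'; apply/eqP; rewrite eqEdim LL' /=.
by have := ad_arr dA LA; have := ad_arr dA L'A; lia.
Qed.

Lemma form_not_divides L L' : L \in A -> L' \in A -> L != L' ->
  ~ divides (alpha L : S) (alpha L' : S).
Proof.
move=> LA L'A nLL' [g hg]; case/eqP: nLL'; apply: hyperplane_eq => //.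
apply/subvP => v /(in_formE _ LA) vL; apply/(in_formE _ L'A).
by rewrite hg mevalM vL mul0r.
Qed.

Lemma mem_restriction L : L \in A `\ H -> (L :&: H)%VS \in restriction A H.
Proof. by move=> LA; apply/imfsetP; exists L. Qed.

Lemma restriction_mem U : U \in restriction A H ->
  exists2 L, L \in A `\ H & U = (L :&: H)%VS.
Proof. by case/imfsetP => L /= LA ->; exists L. Qed.

Lemma dim_cap_hyperplane (X L : subspace) : L \in A -> ~~ (X <= L)%VS ->
  (\dim (X :&: L)).+1 = \dim X.
Proof.
move=> LA nXL; have dL := ad_arr dA LA; have := dimv_sum_cap X L.
have LXL : (L <= X + L)%VS by apply: addvSr.
have : (\dim L < \dim (X + L))%N.
  rewrite ltn_neqAle dimvS // andbT; apply: contraNneq nXL => e.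
  have /eqP -> : L == (X + L)%VS by rewrite eqEdim LXL e leqnn.
  exact: addvSl.
have : (\dim (X + L) <= n)%N.
  by apply: leq_trans (dimvS (subvf _)) _; rewrite dimvf /dim /= mul1n.
lia.
Qed.

(** U is smaller than H because it is cut out by some L not containing H; this gives the point u of
    H where y is nonzero. *)
Lemma restriction_lift U : U \in restriction A H -> exists y : S,
  [/\ y \is 1.-homog, bara y = beta U,
      forall v : 'rV[K]_n, v \in U <-> (a : S).@[v 0] = 0 /\ y.@[v 0] = 0 &
      exists2 u : 'rV[K]_n, (a : S).@[u 0] = 0 & y.@[u 0] != 0].
Proof.
move=> UA; have [y [hy by_ zy]] := ad_rform dA UA; exists y.
have zU v : v \in U <-> (a : S).@[v 0] = 0 /\ y.@[v 0] = 0.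
  rewrite zy; split=> [/andP[/(in_formE _ (ad_H dA)) -> /eqP ->]//|[av yv]].
  by rewrite yv eqxx andbT; apply/in_formE => //; apply: ad_H.
split=> //; have [L] := restriction_mem UA; rewrite in_fsetD1 => /andP[LH LA] UE.
have nHL : ~~ (H <= L)%VS.
  by apply: contraNN LH => HL; apply/eqP/esym/hyperplane_eq => //; apply: ad_H.
have /subvPn[u uH nuU] : ~~ (H <= U)%VS.
  by rewrite UE subv_cap negb_and nHL.
exists u; first by apply/in_formE => //; apply: ad_H.
by apply: contraNneq nuU => yu; apply/zU; split=> //; apply/in_formE => //; apply: ad_H.
Qed.

Lemma form_decomposition (U : subspace) y L :
  (forall v : 'rV[K]_n, v \in U <-> (a : S).@[v 0] = 0 /\ y.@[v 0] = 0) ->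
  y \is 1.-homog -> (exists2 u : 'rV[K]_n, (a : S).@[u 0] = 0 & y.@[u 0] != 0) ->
  L \in A `\ H -> (L :&: H)%VS = U ->
  exists c e : K, c != 0 /\ (alpha L : S) = c *: y + e *: (a : S).
Proof.
move=> zU hy [u au yu]; rewrite in_fsetD1 => /andP[LH LA] LU.
have HA := ad_H dA.
have [|v av yv|e he] := proportional_on_hyperplane (a := a) (z := alpha L) (u := u) hy _ au yu.
- exact: linform_homog.
- apply/(in_formE _ LA); have /zU : (a : S).@[v 0] = 0 /\ y.@[v 0] = 0 by [].
  by rewrite -LU memv_cap => /andP[].
- exists ((alpha L : S).@[u 0] / y.@[u 0]), e; split=> //.
  rewrite mulf_neq0 ?invr_eq0 //; apply/negP => /eqP/(in_formE _ LA) uL.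
  have : u \in U by rewrite -LU memv_cap uL; apply/(in_formE _ HA).
  by case/zU => _ /eqP; rewrite (negbTE yu).
Qed.

(** Divisibility by beta_U in Sbar is membership in the ideal (y, a) of S, which is prime because y
    and a are independent. *)
Lemma beta_prime U x z : U \in restriction A H ->
  divides (beta U) (x * z) -> divides (beta U) x \/ divides (beta U) z.
Proof.
move=> UA; have [y [hy <- _ [u au yu]]] := restriction_lift UA.
have [f <-] := bar_surj x; have [g <-] := bar_surj z.
have iy : independent [:: y; (a : S)].
  split; [exact: linform_independent|exact: hy|exists u => // w].
  by rewrite inE => /eqP ->.
have toS f' : divides (bara y) (bara f') <-> in_ideal [:: y; (a : S)] (f' : S^o).
  rewrite in_ideal2; split=> [[k]|[k [l ->]]].
    have [k' <-] := bar_surj k; rewrite -rmorphM => /eqP; rewrite -subr_eq0 -rmorphB.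
    move/eqP/bar_eq0 => [l hl]; exists k', l.
    by rewrite -hl addrC subrK.
  exists (bara k); rewrite rmorphD !rmorphM /=.
  by have -> : bara (a : S) = 0; [apply/bar_eq0; exists 1; rewrite mulr1|rewrite mul0r addr0].
by rewrite -rmorphM !toS => /(independent_prime iy).
Qed.

Lemma beta_neq0 U : U \in restriction A H -> beta U <> 0.
Proof.
move=> UA; have [y [hy <- _ [u au yu]]] := restriction_lift UA.
by case/bar_eq0 => g yg; move: yu; rewrite yg mevalM au mul0r eqxx.
Qed.

Lemma dim_restriction U : U \in restriction A H -> (\dim U).+2 = n.
Proof.
move=> UA; have [L] := restriction_mem UA; rewrite in_fsetD1 => /andP[LH LA] ->.
rewrite (dim_cap_hyperplane (ad_H dA)) ?(ad_arr dA) //.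
by apply: contraNN LH => HL; apply/eqP/hyperplane_eq => //; apply: ad_H.
Qed.

Lemma beta_not_divides U U' : U \in restriction A H -> U' \in restriction A H ->
  U != U' -> ~ divides (beta U) (beta U').
Proof.
move=> UA UA'; have [y [hy yb zU _]] := restriction_lift UA.
have [y' [hy' yb' zU' _]] := restriction_lift UA'.
move=> /eqP nUU' [k]; have [k' <-] := bar_surj k; rewrite -yb -yb' -rmorphM => /eqP.
rewrite -subr_eq0 -rmorphB => /eqP/bar_eq0 [l hl]; apply: nUU'.
apply/eqP; rewrite eqEdim; apply/andP; split; last first.
  by have := dim_restriction UA; have := dim_restriction UA'; lia.
apply/subvP => v /zU[av yv]; apply/zU'; split=> //.
have -> : y' = (a : S) * l + y * k' by rewrite -hl subrK.
by rewrite mevalD !mevalM av yv !mul0r addr0.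
Qed.

Definition multiplicity U := count (fun L => (L :&: H)%VS == U) (enum_fset (A `\ H)).

Lemma bar_prod_over U : U \in restriction A H -> exists2 c : K, c != 0 &
  \prod_(L <- A `\ H | (L :&: H)%VS == U) bara (alpha L : S) = c *: beta U ^+ multiplicity U.
Proof.
move=> UA; have [y [hy yb zU uy]] := restriction_lift UA.
have bL L : L \in A `\ H -> (L :&: H)%VS = U -> exists2 c : K, c != 0 & bara (alpha L : S) = c *: beta U.
  move=> LA LU; have [c [e [c0 ->]]] := form_decomposition zU hy uy LA LU.
  exists c => //; rewrite rmorphD /= !barZ yb.
  by have -> : bara (a : S) = 0; [apply/bar_eq0; exists 1; rewrite mulr1|rewrite scaler0 addr0].
rewrite /multiplicity; have : {subset enum_fset (A `\ H) <= A `\ H} by [].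
elim: (enum_fset _) => [|L s IH] sub.
  by exists 1; rewrite ?oner_neq0 // big_nil expr0 scale1r.
have [|c c0 hc] := IH; first by move=> M Ms; apply: sub; rewrite inE Ms orbT.
rewrite big_cons /=; case: eqP => [LU|_]; last by exists c.
have [d d0 hd] := bL L (sub _ (mem_head _ _)) LU.
exists (d * c); rewrite ?mulf_neq0 // hc hd exprS.
by rewrite -scalerAl -scalerAr scalerA.
Qed.

Lemma multiplicity_gt0 U : U \in restriction A H -> (0 < multiplicity U)%N.
Proof.
by move=> /restriction_mem[L LA ->]; rewrite -has_count; apply/hasP; exists L.
Qed.

(** Each alpha_L with L meeting H in U restricts to a nonzero multiple of beta_U. The image of Q(A')
    thus has the multiplicities as exponents, and dividing by Q(A^H) lowers each by 1. In particular
    the [xget] in [Bbar] does not fall back on its default. *)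
Lemma BbarE : exists2 c : K, c != 0 &
  Bbar beta A = c *: \prod_(U <- restriction A H) beta U ^+ (multiplicity U).-1.
Proof.
have [c c0 hc] : exists2 c : K, c != 0 & bara (\prod_(L <- A `\ H) (alpha L : S)) =
    c *: \prod_(U <- restriction A H) beta U ^+ (multiplicity U).
  rewrite rmorph_prod (partition_big_imfset _ (fun L => (L :&: H)%VS)) /=.
  rewrite -/(restriction A H); have : {subset enum_fset (restriction A H) <= restriction A H} by [].
  elim: (enum_fset _) => [|U s IH] sub.
    by exists 1; rewrite ?oner_neq0 // !big_nil scale1r.
  have [|c c0 hc] := IH; first by move=> M Ms; apply: sub; rewrite inE Ms orbT.
  have [d d0 hd] := bar_prod_over (sub _ (mem_head _ _)).
  exists (d * c); rewrite ?mulf_neq0 // !big_cons hc hd.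
  by rewrite -scalerAl -scalerAr scalerA.
have prodE : \prod_(U <- restriction A H) beta U ^+ (multiplicity U) =
    \prod_(U <- restriction A H) beta U ^+ (multiplicity U).-1 * \prod_(U <- restriction A H) beta U.
  rewrite -big_split /= !big_seq; apply: eq_bigr => U UA.
  by rewrite -exprSr prednK // multiplicity_gt0.
have prod0 : \prod_(U <- restriction A H) beta U <> 0.
  rewrite big_seq; elim/big_ind: _ => [|x z x0 z0 /Sbar_integral[]//|U]; first exact/eqP/oner_neq0.
  exact: beta_neq0.
exists c => //; rewrite /Bbar; case: xgetP => [b _ /= hb|/forallNP no].
  apply: (Sbar_mulI prod0); rewrite [LHS]mulrC hb hc prodE -scalerAr.
  by congr (_ *: _); rewrite mulrC.
case: no; exists (c *: \prod_(U <- restriction A H) beta U ^+ (multiplicity U).-1) => /=.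
by rewrite hc prodE scalerAl.
Qed.

End ArrangementForms.

(** * The image of [dbar] lies in D^{p-1}(A^H) Bbar *)

Section ImageOfDbar.
Variables (K : fieldType) (n : nat).
Local Notation S := {mpoly K[n]}.
Local Notation subspace := {vspace 'rV[K]_n}.
Variables (alpha : subspace -> linform K n) (H : subspace).
Variable beta : subspace -> Sbar (alpha H).
Local Notation a := (alpha H).
Local Notation bara := (bar (alpha H)).
Variable A : {fset subspace}.
Hypothesis dA : arrangement_data beta A.

Lemma bar_form : bara (a : S) = 0.
Proof. by apply/bar_eq0; exists 1; rewrite mulr1. Qed.

Lemma linform_mulI (c : linform K n) (x z : S) : (c : S) * x = (c : S) * z -> x = z.
Proof. by move/(mulfI (linform_neq0 c)). Qed.

Lemma beta_mulI U x z : U \in restriction A H -> beta U * x = beta U * z -> x = z.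
Proof. by move=> UA; apply: Sbar_mulI; apply: (beta_neq0 dA). Qed.

Lemma scale_mulI (b : Sbar a) (c : K) x z : c != 0 ->
  (forall u v, b * u = b * v -> u = v) -> (c *: b) * x = (c *: b) * z -> x = z.
Proof.
by move=> c0 bI; rewrite -!scalerAl => /(scalerI c0)/bI.
Qed.

Lemma prod_beta_mulI (e : subspace -> nat) x z :
  \prod_(U <- restriction A H) beta U ^+ e U * x =
  \prod_(U <- restriction A H) beta U ^+ e U * z -> x = z.
Proof.
apply: Sbar_mulI; rewrite big_seq.
elim/big_ind: _ => [|u v u0 v0 /Sbar_integral[]//|U UA]; first exact/eqP/oner_neq0.
elim: (e U) => [|k IH]; first exact/eqP/oner_neq0.
by rewrite exprS => /Sbar_integral[/(beta_neq0 dA UA)|].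
Qed.

(** The alpha_L over U are primes, none dividing another, so their product divides f; its image is a
    nonzero scalar times the power of beta_U. *)
Lemma prod_over_dvd U (f : S) : U \in restriction A H ->
  (forall L, L \in A `\ H -> (L :&: H)%VS = U -> divides (alpha L : S) f) ->
  divides (beta U ^+ multiplicity H A U) (bara f).
Proof.
move=> UA hf; have [c c0 hc] := bar_prod_over dA UA.
have [|||||g hg] := @prod_prime_dvd _ _ (filter (fun L => (L :&: H)%VS == U) (enum_fset (A `\ H)))
   (fun L => alpha L : S) (fun=> 1%N) f.
- by rewrite filter_uniq // fset_uniq.
- by move=> L _ u v; apply: linform_mulI.
- by move=> L _ u v; apply: linform_prime.
- move=> L L'; rewrite !mem_filter => /andP[_ LA] /andP[_ LA'] LL'.
  move: LA LA'; rewrite !in_fsetD1 => /andP[_ LA] /andP[_ LA'].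
  exact: (form_not_divides dA).
- by move=> L; rewrite mem_filter => /andP[/eqP LU LA]; rewrite expr1; apply: hf.
exists (c *: bara g); rewrite hg rmorphM rmorph_prod big_filter /=.
under eq_bigr do rewrite expr1.
by rewrite hc -scalerAl scalerAr.
Qed.

Lemma cons_form_decomposition q (theta : ('I_q.+1 -> S) -> S) y (c e : K) L f :
  multiderivation theta -> (alpha L : S) = c *: y + e *: (a : S) ->
  theta (cons_arg (alpha L : S) f) = c *: theta (cons_arg y f) + e *: theta (cons_arg (a : S) f).
Proof.
move=> mt ->; have [lin _ _] := mt.
rewrite -(set_arg_cons0 0) lin set_arg_cons0; congr (_ + _).
by rewrite multider_setZ // set_arg_cons0.
Qed.

(* with x = a: alpha_L divides x theta(alpha_L) - alpha_L theta(x), a multiple of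
   x theta(y) - y theta(x) that does not depend on L *)
Lemma dbar_divisible_over U q theta f : U \in restriction A H ->
  logder (fun L => alpha L : S) (A `\ H) q.+1 theta ->
  divides (beta U ^+ (multiplicity H A U).-1) (bara (theta (cons_arg (a : S) f))).
Proof.
move=> UA /logderP[mt ht]; have [y [hy yb zU uy]] := restriction_lift dA UA.
set P := theta _; pose R := theta (cons_arg y f).
have [|k hk] := @prod_over_dvd U ((a : S) * R - y * P) UA.
  move=> L LA LU; have [c [e [c0 cE]]] := form_decomposition dA zU hy uy LA LU.
  have [g hg] := ht L LA f; rewrite (cons_form_decomposition _ mt cE) in hg.
  exists (c^-1 *: ((a : S) * g - P)); rewrite -scalerAr; apply: (scalerI c0).
  rewrite scalerA divff // scale1r mulrBr mulrCA -hg cE -/P -/R -!mul_mpolyC; ring.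
(* Modulo a only - y P is left; cancelling one factor beta_U costs 1 in the exponent. *)
move: hk; rewrite rmorphB !rmorphM /= bar_form mul0r sub0r yb.
rewrite -{1}(prednK (multiplicity_gt0 UA)) exprS -mulrA -mulrN => /(beta_mulI UA) hP.
by exists (- k); rewrite mulrN -hP opprK.
Qed.

(** As theta (a, a, f) = 0, divisibility of theta (alpha_L, a, f) by alpha_L passes to theta (a, y,
    f) itself. With y among the arguments the full multiplicity is reached, one more than in
    [dbar_divisible_over]. *)
Lemma dbar_divisible_form U q theta y f : U \in restriction A H ->
  bara y = beta U ->
  logder (fun L => alpha L : S) (A `\ H) q.+2 theta ->
  divides (beta U ^+ multiplicity H A U) (bara (theta (cons_arg (a : S) (cons_arg y f)))).
Proof.
move=> UA yb /logderP[mt ht]; have [y' [hy' yb' zU uy]] := restriction_lift dA UA.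
have -> : bara (theta (cons_arg (a : S) (cons_arg y f))) =
          bara (theta (cons_arg (a : S) (cons_arg y' f))).
  apply: bar_cons_ext => // i; case: (unliftP ord0 i) => [j ->|->].
    by rewrite !cons_argS.
  by rewrite !cons_arg0 yb yb'.
apply: prod_over_dvd => // L LA LU.
have [c [e [c0 cE]]] := form_decomposition dA zU hy' uy LA LU.
have [g hg] := ht L LA (cons_arg (a : S) f).
exists (- c^-1 *: g); rewrite -scalerAr -hg (cons_form_decomposition _ mt cE).
have [_ _ alt] := mt.
rewrite (alt (cons_arg (a : S) (cons_arg (a : S) f)) ord0 (lift ord0 ord0)) //.
  rewrite scaler0 addr0 scalerA mulNr mulVf // scaleN1r.
  rewrite -(multider_swap _ mt (i := ord0) (j := lift ord0 ord0)) //.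
  congr theta; apply/funext => i; case: tpermP => [->|->|/eqP i0 /eqP i1].
  - by rewrite cons_argS !cons_arg0.
  - by rewrite cons_argS !cons_arg0.
  - case: (unliftP ord0 i) i0 i1 => [j ->|-> /eqP//] _ i1.
    case: (unliftP ord0 j) i1 => [l ->|-> /eqP//] _.
    by rewrite !cons_argS.
by rewrite cons_argS !cons_arg0.
Qed.

Lemma Bbar_mulI x z : Bbar beta A * x = Bbar beta A * z -> x = z.
Proof.
have [c c0 ->] := BbarE dA; apply: scale_mulI => // u v.
exact: prod_beta_mulI.
Qed.

Lemma dbar_divisible q theta f :
  logder (fun L => alpha L : S) (A `\ H) q.+1 theta ->
  divides (Bbar beta A) (bara (theta (cons_arg (a : S) f))).
Proof.
move=> ht; have [c c0 ->] := BbarE dA.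
have [|||||k hk] := @prod_prime_dvd _ _ (enum_fset (restriction A H)) beta
   (fun U => (multiplicity H A U).-1) (bara (theta (cons_arg (a : S) f))).
- exact: fset_uniq.
- by move=> U UA u v; apply: beta_mulI.
- by move=> U UA u v; apply: (beta_prime dA).
- by move=> U U' UA UA'; apply: (beta_not_divides dA).
- by move=> U UA; apply: dbar_divisible_over.
exists (c^-1 *: k); rewrite hk -scalerAl -scalerAr scalerA divff // scale1r.
by [].
Qed.

(** eta is the quotient by Bbar. It is logarithmic along U since, with beta_U among the arguments,
    the value contains beta_U once more than Bbar does. *)
Lemma dbar_image q theta :
  logder (fun L => alpha L : S) (A `\ H) q.+1 theta ->
  exists2 eta, logder beta (restriction A H) q eta &
    dbar (H := H) theta = (fun g => Bbar beta A * eta g).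
Proof.
move=> ht; have [mt _] := ht.
have /choice[eta hE] : forall g, exists x, dbar (H := H) theta g = Bbar beta A * x.
  move=> g; have [f ->] := lift_args g; rewrite dbar_bar //.
  by have [x ->] := dbar_divisible f ht; exists x.
have E : dbar (H := H) theta = (fun g => Bbar beta A * eta g) by apply/funext.
exists eta => //.
have meta : multiderivation eta.
  by apply: (multider_cancel (a := Bbar beta A)) => [x z|]; [apply: Bbar_mulI|rewrite -E; apply: dbar_multider].
case: q theta ht mt eta hE E meta => [|q] theta ht mt eta hE E meta; first exact/logder0P.
apply/logderP; split=> // U UA g; have [f gE] := lift_args g.
have [y [_ yb _ _]] := restriction_lift dA UA.
have consE : cons_arg (beta U) g = (fun i => bara (cons_arg y f i)).
  apply/funext => i; case: (unliftP ord0 i) => [j ->|->].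
    by rewrite !cons_argS gE.
  by rewrite !cons_arg0.
pose e U' := if U' == U then multiplicity H A U else (multiplicity H A U').-1.
have [|||||k hk] := @prod_prime_dvd _ _ (enum_fset (restriction A H)) beta e
   (bara (theta (cons_arg (a : S) (cons_arg y f)))).
- exact: fset_uniq.
- by move=> U' UA' u v; apply: beta_mulI.
- by move=> U' UA' u v; apply: (beta_prime dA).
- by move=> U' U'' UA' UA''; apply: (beta_not_divides dA).
- move=> U' UA'; rewrite /e; case: eqP => [->|_]; last exact: dbar_divisible_over.
  exact: dbar_divisible_form.
have prodE : \prod_(U' <- restriction A H) beta U' ^+ e U' =
    \prod_(U' <- restriction A H) beta U' ^+ (multiplicity H A U').-1 * beta U.
  rewrite (big_fsetD1 U) //= [in RHS](big_fsetD1 U) //= /e eqxx.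
  rewrite [RHS]mulrAC -exprSr prednK ?multiplicity_gt0 //.
  rewrite (eq_big_seq (fun U' => beta U' ^+ (multiplicity H A U').-1)) // => U'.
  by rewrite in_fsetD1 => /andP[/negbTE ->].
have [c c0 cE] := BbarE dA.
exists (c^-1 *: k); apply: (Bbar_mulI).
rewrite -hE consE dbar_bar // hk prodE cE -!scalerAr -scalerAl.
by rewrite scalerA mulVf // scale1r mulrA.
Qed.

End ImageOfDbar.

(** * Localization at a subspace of H *)

Section Localization.
Variables (K : fieldType) (n : nat).
Local Notation S := {mpoly K[n]}.
Local Notation subspace := {vspace 'rV[K]_n}.
Variables (alpha : subspace -> linform K n) (H : subspace).
Variable beta : subspace -> Sbar (alpha H).
Local Notation a := (alpha H).
Local Notation bara := (bar (alpha H)).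
Variable A : {fset subspace}.
Hypothesis dA : arrangement_data beta A.
Variable Y : subspace.
Hypothesis YH : (Y <= H)%VS.

Lemma mem_localization L : (L \in localization A Y) = (L \in A) && (Y <= L)%VS.
Proof. by rewrite !inE. Qed.

Lemma restriction_localization U :
  U \in restriction (localization A Y) H <-> U \in restriction A H /\ (Y <= U)%VS.
Proof.
split.
  case/imfsetP => L /=; rewrite in_fsetD1 mem_localization => /and3P[LH LA YL] ->.
  by split; [apply: mem_restriction; rewrite in_fsetD1 LH|rewrite subv_cap YL].
case=> /restriction_mem[L]; rewrite in_fsetD1 => /andP[LH LA] ->.
rewrite subv_cap => /andP[YL _]; apply: mem_restriction.
by rewrite in_fsetD1 LH mem_localization LA.
Qed.

Lemma localization_data : arrangement_data beta (localization A Y).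
Proof.
split=> [L||L|U].
- by rewrite mem_localization => /andP[LA _]; apply: (ad_arr dA).
- by rewrite mem_localization (ad_H dA).
- by rewrite mem_localization => /andP[LA _]; apply: (ad_form dA).
- by case/restriction_localization=> UA _; apply: (ad_rform dA).
Qed.

Lemma multiplicity_localization U : (Y <= U)%VS ->
  multiplicity H (localization A Y) U = multiplicity H A U.
Proof.
move=> YU; rewrite /multiplicity -!size_filter; apply/perm_size/uniq_perm.
- by rewrite filter_uniq // fset_uniq.
- by rewrite filter_uniq // fset_uniq.
move=> L; rewrite !mem_filter; case: eqP => //= LU.
rewrite !in_fsetD1 mem_localization; case: (L != H) => //=.
by rewrite -[RHS]andbT; congr (_ && _); rewrite -LU in YU; apply: subv_trans YU (capvSl _ _).
Qed.

Lemma Bbar_localization : exists b, Bbar beta A = b * Bbar beta (localization A Y).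
Proof.
have [c c0 ->] := BbarE dA; have [d d0 ->] := BbarE localization_data.
pose m U := beta U ^+ (multiplicity H A U).-1.
exists ((c / d) *: \prod_(U <- restriction A H | ~~ (Y <= U)%VS) m U).
rewrite -scalerAr -scalerAl scalerA [d * _]mulrC divfK //; congr (_ *: _).
rewrite (bigID (fun U : subspace => (Y <= U)%VS)) /= mulrC; congr (_ * _).
rewrite -big_filter [RHS]big_seq_cond.
under [RHS]eq_bigr => U.
  rewrite andbT => /restriction_localization[_ YU]; rewrite multiplicity_localization //; over.
rewrite -big_seq_cond; apply: perm_big; apply: uniq_perm.
- by rewrite filter_uniq // fset_uniq.
- exact: fset_uniq.
move=> U; rewrite mem_filter; apply/andP/idP => [[YU UA]|/restriction_localization[]//].
by apply/restriction_localization.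
Qed.

Definition away_forms := [seq L <- enum_fset (A `\ H) | ~~ (Y <= L)%VS].

(** Write eta = Bbar eta' and take a local preimage theta of the local Bbar times eta'. Multiplied
    by the forms of all hyperplanes of A' that do not contain Y, theta becomes logarithmic for A';
    the factor b' lifts the quotient of Bbar by its local counterpart. *)
Lemma away_killed q eta : dbar_surjective beta (localization A Y) q.+1 ->
  dbar_codomain beta A (p := q.+1) eta ->
  exists2 theta, logder (fun L => alpha L : S) (A `\ H) q.+1 theta &
    dbar theta = (fun g => bara (\prod_(L <- away_forms) (alpha L : S)) * eta g).
Proof.
move=> surj [eta' [me he] ->].
have [b bE] := Bbar_localization; have [b' hb] := bar_surj b.
have [|theta /logderP[mt ht] dt] := surj (fun g => Bbar beta (localization A Y) * eta' g).
  exists eta' => //; split=> // U /restriction_localization[UA _]; exact: he.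
set Q := \prod_(L <- _) _.
exists (fun f => (Q * b') * theta f); last first.
  apply/funext => g; rewrite dbarM dt rmorphM /= hb bE; ring.
apply/logderP; split=> [|L]; first exact: multider_scale.
rewrite in_fsetD1 => /andP[LH LA] g; case YL : (Y <= L)%VS.
  have [|k ->] := ht L _ g; first by rewrite in_fsetD1 LH mem_localization LA YL.
  by exists (Q * b' * k); rewrite mulrCA.
have LQ : L \in away_forms by rewrite mem_filter YL in_fsetD1 LH LA.
rewrite /Q (big_rem L) //=.
by eexists; rewrite -!mulrA; congr (_ * _).
Qed.

End Localization.

(** * Koszul cochains of degree one, semilinear maps, function modules *)

Section KoszulDegreeOne.
Variable R : comNzRingType.
Implicit Types (M : lmodType R) (ys : seq R).

Definition unit_bits s i : bitseq := mkseq (fun j => j == i) s.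

Lemma unit_bitsP s i : (i < s)%N -> weight_of s 1 (unit_bits s i).
Proof.
move=> si; split; first by rewrite size_mkseq.
rewrite /unit_bits /mkseq count_map (eq_count (a2 := pred1 i)) => [|j]; last by rewrite /=.
by rewrite count_uniq_mem ?iota_uniq // mem_iota /= si.
Qed.

Lemma unit_bits0 s : unit_bits s.+1 0 = true :: nseq s false.
Proof.
rewrite /unit_bits /mkseq /=; congr cons; rewrite (iotaDl 1 0) -map_comp.
have gen j : [seq (eq_op^~ 0%N \o addn 1) i | i <- iota j s] = nseq s false.
  by elim: s j => //= s IH j; rewrite IH.
exact: gen.
Qed.

Lemma unit_bitsS s i : unit_bits s.+1 i.+1 = false :: unit_bits s i.
Proof.
rewrite /unit_bits /mkseq /=; congr cons; rewrite (iotaDl 1 0) -map_comp.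
by apply: eq_map => j.
Qed.

Lemma weight0_bits s b : weight_of s 0 b -> b = nseq s false.
Proof.
elim: s b => [|s IH] [|[] b] [//=] [sb]; rewrite add0n => cb.
by congr cons; apply: IH.
Qed.

Lemma weight1_bits s b : weight_of s 1 b -> exists2 i, (i < s)%N & b = unit_bits s i.
Proof.
elim: s b => [|s IH] [|[] b] [//=] [sb].
  by case=> cb; exists 0%N => //; rewrite unit_bits0; congr cons; apply: weight0_bits.
rewrite add0n => cb; have [i si ->] := IH b (conj sb cb).
by exists i.+1 => //; rewrite unit_bitsS.
Qed.

Lemma koszul_unit_bits M ys (c : bitseq -> M) i : (i < size ys)%N ->
  koszul ys c (unit_bits (size ys) i) = ys`_i *: c (nseq (size ys) false).
Proof.
elim: ys c i => [//|y ys IH] c [|i] si; rewrite [size _]/=; last by rewrite unit_bitsS /= IH.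
rewrite unit_bits0 /= koszul_weight0 ?subr0 ?size_nseq //.
by rewrite count_nseq.
Qed.

Lemma koszul_closed M ys w (D : set M) (c : bitseq -> M) :
  (forall x y, D x -> D y -> D (x - y)) -> (forall r x, D x -> D (r *: x)) -> D 0 ->
  (forall b, weight_of (size ys) w b -> D (c b)) ->
  forall b, weight_of (size ys) w.+1 b -> D (koszul ys c b).
Proof.
move=> DB DZ D0 Dc b wb.
have gen zs t (c' : bitseq -> M) : (forall u, D (c' u)) -> D (koszul zs c' t).
  elim: zs t c' => [|y zs IH] [|[] t] c' Dc' //=; last by apply: IH.
  by apply: DB; [apply: DZ|apply: IH].
(* Values of c at other weights are unconstrained, so those outside D are replaced by 0. *)
rewrite (eq_koszul (w := w) (c' := fun t => if `[< D (c t) >] then c t else 0)) //; last first.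
  by move=> t /Dc h; rewrite asboolT.
by apply: gen => u; case: asboolP.
Qed.

(** Meant for [dbar], which is linear only along the morphism S -> Sbar, so that the base ring
    changes with it. *)
Lemma koszul_semilinear (R' : comNzRingType) (h : R -> R') M (N : lmodType R')
    (D : M -> N) ys (c : bitseq -> M) b :
  D 0 = 0 -> (forall x y, D (x - y) = D x - D y) ->
  (forall y x, D (y *: x) = h y *: D x) ->
  D (koszul ys c b) = koszul (map h ys) (fun t => D (c t)) b.
Proof.
move=> D0 DB DZ; elim: ys c b => [|y ys IH] c [|[] b] //=.
by rewrite DB DZ IH.
Qed.

Lemma in_ideal_fct (T : Type) (M : lmodType R) ys (m : T -> M) :
  in_ideal ys m <-> forall t, in_ideal ys (m t).
Proof.
elim: ys m => [|y ys IH] m /=.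
  by split=> [-> //|h]; apply/funext.
split=> [[a /IH h] t|h]; first by exists (a t); apply: h.
by have /choice[a ha] := h; exists a; apply/IH.
Qed.

(** Meant for the module of all functions from tuples to S, in which D^p(A) lives; membership in the
    ideal is pointwise there. *)
Lemma weakly_regular_fct (T : Type) (M : lmodType R) ys :
  weakly_regular M ys -> weakly_regular (T -> M) ys.
Proof.
elim: ys => //= y ys IH [/IH rys ry]; split=> // m.
by rewrite !in_ideal_fct => h t; apply: ry; apply: h.
Qed.

End KoszulDegreeOne.

(** * Simultaneous division of preimages *)

Section KoszulSurjectivity.
Variables (K : fieldType) (n : nat).
Local Notation S := {mpoly K[n]}.
Local Notation subspace := {vspace 'rV[K]_n}.
Variables (alpha : subspace -> linform K n) (H : subspace).
Variable beta : subspace -> Sbar (alpha H).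
Local Notation a := (alpha H).
Local Notation bara := (bar (alpha H)).
Local Notation form := (fun L => alpha L : S).
Variable A : {fset subspace}.
Hypothesis dA : arrangement_data beta A.
Variable q : nat.
Local Notation V := (('I_q.+1 -> S) -> S^o).
Local Notation Vbar := (('I_q -> Sbar a) -> (Sbar a)^o).

Definition dbar_im (eta : Vbar) : Prop :=
  exists2 theta, logder form (A `\ H) q.+1 theta & dbar (H := H) theta = eta.

Lemma dbar_koszul (ys : seq S) (c : bitseq -> V) b :
  (dbar (H := H) (koszul ys c b : ('I_q.+1 -> S) -> S) : Vbar) =
  koszul (map bara ys) (fun t => dbar (H := H) (c t : ('I_q.+1 -> S) -> S) : Vbar) b.
Proof.
apply: (koszul_semilinear (D := fun x : V => dbar (H := H) (x : ('I_q.+1 -> S) -> S) : Vbar)) => [|x y|y x].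
- by apply/funext => g; rewrite /dbar /= rmorph0.
- by apply/funext => g; rewrite dbarB.
- by apply/funext => g; rewrite (dbarM y).
Qed.

Lemma logder_sub p B (x y : ('I_p -> S) -> S^o) :
  logder form B p x -> logder form B p y -> logder form B p (x - y).
Proof.
move=> hx hy; have := logder_add hx (logder_scale (-1) hy).
by congr (logder _ _ _); apply/funext => f; rewrite mulN1r.
Qed.

Variables (k : nat) (Ls : seq subspace).
Hypothesis resM : has_projective_resolution (logder form A q.+1 : set V) k.
Hypothesis LsA : {subset Ls <= A}.
Hypothesis iLs : independent (map form Ls).
Hypothesis sLs : size Ls = (k + 3)%N.

(** There are at least two forms, and two independent forms are not both multiples of alpha_L. *)
Lemma form_outside L : L \in A -> exists2 L', L' \in Ls & ~ divides (form L) (form L').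
Proof.
move=> LA; case: Ls sLs iLs LsA => [|L1 [|L2 Ls']]; rewrite ?addn3 // => _ [_ _ [v v1 v2]] sub.
have L12 : L1 != L2.
  by apply: contraNneq v1 => ->; rewrite v2 // mem_head.
have L1A : L1 \in A by apply: sub; rewrite mem_head.
have L2A : L2 \in A by apply: sub; rewrite !inE eqxx orbT.
case: (eqVneq L L1) => [->|LL1].
  by exists L2; [rewrite !inE eqxx orbT|apply: (form_not_divides dA)].
by exists L1; [rewrite mem_head|apply: (form_not_divides dA)].
Qed.

(* With dbar(theta_i) = y_i eta, the cochain y_i theta_j - y_j theta_i lies in D^p(A);
   as H^2(ys; D^p(A)) = 0, the theta_i can be corrected to a multiple of the y_i. *)
Lemma koszul_surjectivity (eta : Vbar) :
  (forall L, L \in Ls -> dbar_im (fun g => bara (form L) * eta g)) -> dbar_im eta.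
Proof.
move=> him; have [P [d [e [projP P0 eM e0 exd]]]] := resM.
set ys := map form Ls; set s := size ys.
have sE : s = (k + 3)%N by rewrite /s size_map.
have rys := independent_regular iLs; rewrite -/ys in rys.
have [theta htheta] : exists theta : bitseq -> V, forall i, (i < s)%N ->
    logder form (A `\ H) q.+1 (theta (unit_bits s i)) /\
    dbar (H := H) (theta (unit_bits s i)) = (fun g => bara ys`_i * eta g).
  have /choice[th hth] : forall b, exists t : V, forall i, (i < s)%N -> b = unit_bits s i ->
    logder form (A `\ H) q.+1 t /\ dbar (H := H) t = (fun g => bara ys`_i * eta g).
    move=> b; case: (pselect (exists2 i, (i < s)%N & b = unit_bits s i)) => [[i si ->]|no].
      have [|t ht dt] := him (nth H Ls i); first by rewrite mem_nth // -(size_map form).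
      exists t => j sj /(congr1 (fun b => nth false b i)); rewrite !nth_mkseq // eqxx.
      by move/esym/eqP => <-; split=> //; rewrite dt (nth_map H) // -(size_map form).
    by exists 0 => i si bi; case: no; exists i.
  by exists th => i si; apply: hth.
have thN b : weight_of s 1 b -> logder form (A `\ H) q.+1 (theta b).
  by move/weight1_bits => [i si ->]; have [] := htheta i si.
have thd b : weight_of s 1 b -> (dbar (H := H) (theta b) : Vbar) = koszul (map bara ys) (fun=> eta) b.
  move/weight1_bits => [i si ->]; have [_ ->] := htheta i si.
  have -> : s = size (map bara ys) by rewrite size_map.
  have si' : (i < size (map bara ys))%N by rewrite size_map.
  rewrite (koszul_unit_bits _ si'); apply/funext => g.
  have -> // : (map bara ys)`_i = bara ys`_i by rewrite (nth_map (0 : S)).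
have uM b : weight_of s 2 b -> logder form A q.+1 (koszul ys theta b).
  move=> wb; apply/(dbar_kernel _ _ (ad_H dA)); split.
    apply: (@koszul_closed _ V ys 1 (logder form (A `\ H) q.+1 : set V) theta _ _ _ thN b wb).
    - by move=> x y; apply: logder_sub.
    - by move=> r x; apply: logder_scale.
    - exact: logder0.
  (* [dbar] turns theta into the coboundary of eta, so the square of the Koszul differential
     appears. *)
  rewrite dbar_koszul; transitivity (koszul (map bara ys) (koszul (map bara ys) (fun=> eta)) b).
    have sm : size (map bara ys) = s by rewrite size_map.
    have Et t : weight_of (size (map bara ys)) 1 t ->
        (dbar (H := H) (theta t) : Vbar) = koszul (map bara ys) (fun=> eta) t.
      by rewrite sm; apply: thd.
    by apply: (@eq_koszul _ Vbar (map bara ys) 1 _ _ Et b); rewrite sm.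
  exact: (@koszul_koszul _ Vbar (map bara ys) (fun=> eta) b).
(* With w = 2 and i = 0 the bound reads 2 + k < k + 3. *)
have [|||mu hmu] := @koszul_exact_resolution _ P d k ys projP P0 exd rys 0 V e 2 e0 _ (koszul ys theta).
- by move=> _; rewrite -/s sE; lia.
- by move=> b wb; apply/eM; apply: uM.
- by move=> b _; rewrite koszul_koszul.
have muM b : logder form A q.+1 (e (mu b)) by apply/eM; exists (mu b).
have s1 : (1 < size ys)%N by rewrite -/s sE; lia.
have rV : weakly_regular V ys by apply: weakly_regular_fct.
(* The corrected theta is a cocycle of degree 1 in the module of all functions, where ys is regular
   as well; so its entries are the y_i t0 for a single t0. *)
have [|t ht] := @koszul_exact _ V ys 1 rV s1 (fun b => theta b - e (mu b)).
  by move=> b wb; rewrite koszulB hmu // subrr.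
pose t0 : V := t (nseq s false).
have t0E i : (i < s)%N -> (fun f => ys`_i * t0 f) = theta (unit_bits s i) - e (mu (unit_bits s i)) :> V.
  by move=> si; rewrite ht ?koszul_unit_bits //; apply: unit_bitsP.
have t0N i : (i < s)%N -> logder form (A `\ H) q.+1 (fun f => ys`_i * t0 f).
  move=> si; rewrite (t0E i si); apply: logder_sub; first by case: (htheta i si).
  by case: (muM (unit_bits s i)) => mt hh; split=> // L; rewrite in_fsetD1 => /andP[_]; apply: hh.
have nthE L : L \in Ls -> exists2 i, (i < s)%N & ys`_i = form L.
  move=> LLs; exists (index L Ls); first by rewrite /s size_map index_mem.
  by rewrite (nth_map H) ?index_mem // nth_index.
have s0 : (0 < s)%N by rewrite sE addn3.
(* alpha_L divides the values y_i t0 (alpha_L, g) for every i, and some y_i is not divisible by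
   alpha_L, so t0 is logarithmic. Cancelling a y_i not divisible by alpha_H gives dbar t0 = eta. *)
exists t0.
  apply/logderP; split.
    have [mt _] := t0N 0%N s0; apply: multider_cancel mt => x y; apply: mulfI.
    by rewrite /ys (nth_map H) ?linform_neq0 // -(size_map form).
  move=> L LA g; have [L' L'Ls nLL'] : exists2 L', L' \in Ls & ~ divides (form L) (form L').
    by apply: form_outside; move: LA; rewrite in_fsetD1 => /andP[].
  have [i si yi] := nthE L' L'Ls.
  have /logderP[_ /(_ L LA g)] := t0N i si; rewrite yi => /linform_prime[//|].
  exact.
have [L' L'Ls nHL'] := form_outside (ad_H dA).
have [i si yi] := nthE L' L'Ls.
apply/funext => g; apply: (@Sbar_mulI _ _ _ (bara ys`_i)).
  by rewrite yi => /bar_eq0.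
rewrite -(dbarM (H := H)) t0E // dbarB; case: (htheta i si) => _ ->.
have /(dbar_kernel _ _ (ad_H dA))[_ ->] := muM (unit_bits s i).
by rewrite subr0.
Qed.

End KoszulSurjectivity.

(** * Surjectivity when the rank is at least k + 2 *)

Section GlobalSurjectivity.
Variables (K : fieldType) (n : nat).
Local Notation S := {mpoly K[n]}.
Local Notation subspace := {vspace 'rV[K]_n}.

Lemma subv_bigcap_seq (r : seq subspace) (X : subspace) :
  (X <= \bigcap_(U <- r) U)%VS = all (fun U => X <= U)%VS r.
Proof.
elim: r => [|U r IH]; first by rewrite big_nil subvf.
by rewrite big_cons subv_cap IH.
Qed.

Lemma bigcap_seq_sub (r : seq subspace) U : U \in r -> (\bigcap_(L <- r) L <= U)%VS.
Proof.
by move=> Ur; have := subvv (\bigcap_(L <- r) L)%VS; rewrite subv_bigcap_seq => /allP; apply.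
Qed.

Variables (alpha : subspace -> linform K n) (H : subspace).
Variable beta : subspace -> Sbar (alpha H).
Local Notation a := (alpha H).
Local Notation bara := (bar (alpha H)).
Local Notation form := (fun L => alpha L : S).
Variable A : {fset subspace}.
Hypothesis dA : arrangement_data beta A.

Definition center : subspace := (\bigcap_(L <- A) L)%VS.

Lemma flat_in_lattice (Ls : seq subspace) : {subset Ls <= A} -> H \in Ls ->
  in_lattice H (restriction A H) (\bigcap_(L <- Ls) L)%VS.
Proof.
move=> LsA HLs.
pose E := [fset (L :&: H)%VS | L in [fset L in A `\ H | L \in Ls]].
exists E.
  apply/fsubsetP => U /imfsetP[L /=]; rewrite inE /= => /andP[LA _] ->.
  exact: mem_restriction.
apply/eqP; rewrite eqEsubv; apply/andP; split.
  rewrite subv_cap subv_bigcap_seq; apply/andP; split.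
    exact: bigcap_seq_sub.
  apply/allP => U /imfsetP[L /=]; rewrite inE /= => /andP[_ LLs] ->.
  by rewrite subv_cap !bigcap_seq_sub.
rewrite subv_bigcap_seq; apply/allP => L LLs.
case: (eqVneq L H) => [->|LH]; first exact: capvSl.
have LE : (L :&: H)%VS \in E.
  by apply/imfsetP; exists L => //=; rewrite !inE /= LH LLs (LsA _ LLs).
apply: subv_trans (capvSr _ _) _.
exact: subv_trans (bigcap_seq_sub LE) (capvSl _ _).
Qed.

(** While the codimension is below k, the intersection is too large to lie in the center, so some
    hyperplane of A lowers its dimension by exactly 1. *)
Lemma flat_of_codim k (Ls : seq subspace) j :
  (\dim center + k <= n)%N -> {subset Ls <= A} -> H \in Ls ->
  (\dim (\bigcap_(L <- Ls) L)%VS + j = n)%N -> (j <= k)%N ->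
  exists Y, [/\ in_lattice H (restriction A H) Y, (Y <= \bigcap_(L <- Ls) L)%VS
              & (\dim Y + k = n)%N].
Proof.
move=> rk; have [m] := ubnP (k - j); elim: m j Ls => // m IH j Ls kj LsA HLs dX jk.
case: (ltnP j k) => [ltjk|lekj]; last first.
  exists (\bigcap_(L <- Ls) L)%VS; split=> //; first exact: flat_in_lattice.
  by lia.
have : ~~ (\bigcap_(L <- Ls) L <= center)%VS.
  by apply/negP => /dimvS; lia.
rewrite subv_bigcap_seq -has_predC => /hasP[L LA /= nXL].
have [|||||Y [lY YX dY]] := IH j.+1 (L :: Ls).
- by lia.
- by move=> M; rewrite inE => /orP[/eqP ->|/LsA].
- by rewrite inE HLs orbT.
- by have := dim_cap_hyperplane dA LA nXL; rewrite big_cons capvC; lia.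
- by [].
by exists Y; split=> //; apply: subv_trans YX _; rewrite big_cons capvSr.
Qed.

Variable q : nat.
Local Notation V := (('I_q.+1 -> S) -> S^o).
Local Notation Vbar := (('I_q -> Sbar a) -> (Sbar a)^o).
Local Notation im := (@dbar_im K n alpha H A q).

Lemma dbar_imM f (eta : Vbar) : im eta -> im (fun g => bara f * eta g).
Proof.
case=> theta ht dt; exists (fun x => f * theta x); first exact: logder_scale.
by apply/funext => g; rewrite dbarM dt.
Qed.

(** In the shortest tail of s whose product still sends eta into the image, L is the head and f the
    product of the rest. *)
Lemma find_killing_form (s : seq subspace) (eta : Vbar) :
  im (fun g => bara (\prod_(L <- s) form L) * eta g) -> ~ im eta ->
  exists2 L, L \in s & exists f, ~ im (fun g => bara f * eta g) /\
    im (fun g => bara (form L) * (bara f * eta g)).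
Proof.
elim: s => [|L s IH].
  rewrite big_nil => him nim; case: nim; move: him.
  by congr im; apply/funext => g; rewrite rmorph1 mul1r.
move=> him nim; case: (pselect (im (fun g => bara (\prod_(L <- s) form L) * eta g))).
  by move/IH/(_ nim) => [M Ms hM]; exists M => //; rewrite inE Ms orbT.
move=> nims; exists L; first exact: mem_head.
exists (\prod_(M <- s) form M); split=> //; move: him.
by congr im; apply/funext => g; rewrite big_cons rmorphM /= mulrA.
Qed.

Variable k : nat.
Hypothesis resM : has_projective_resolution (logder form A q.+1 : set V) k.
Hypothesis surj : surjective_in_codim beta A q.+1 (k + 2).
Hypothesis rank_ge : (\dim center + (k + 2) <= n)%N.

Lemma codomainM f (eta : Vbar) : dbar_codomain beta A (p := q.+1) eta ->
  dbar_codomain beta A (p := q.+1) (fun g => bara f * eta g).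
Proof.
case=> eta' he ->; exists (fun g => bara f * eta' g); first exact: logder_scale.
by apply/funext => g; rewrite mulrCA.
Qed.

(** One form is added per step, starting with alpha_H. The new L does not contain the flat Y, hence
    not the intersection of the earlier hyperplanes, which contains Y; so its form is independent of
    theirs. eta is replaced by a multiple outside the image, which the earlier forms still send into
    the image. *)
Lemma killed_by_forms (eta0 : Vbar) j : dbar_codomain beta A (p := q.+1) eta0 ->
  ~ im eta0 -> (j <= k + 2)%N ->
  exists (Ls : seq subspace) (eta : Vbar),
    [/\ {subset Ls <= A}, H \in Ls, independent (map form Ls), size Ls = j.+1
      & [/\ (\dim (\bigcap_(L <- Ls) L)%VS + j.+1 = n)%N,
            dbar_codomain beta A (p := q.+1) eta, ~ im eta
          & forall L, L \in Ls -> im (fun g => bara (form L) * eta g)]].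
Proof.
move=> c0 n0; elim: j => [_|j IH jk].
  exists [:: H], eta0; split=> //.
  - by move=> L; rewrite inE => /eqP ->; apply: (ad_H dA).
  - by rewrite inE.
  - exact: linform_independent.
  split=> //; first by rewrite big_seq1 addn1; apply: (ad_arr dA); apply: (ad_H dA).
  move=> L; rewrite inE => /eqP ->; exists (fun=> 0); first exact: logder0.
  by apply/funext => g; rewrite bar_form mul0r /dbar rmorph0.
have [|Ls [eta [LsA HLs iLs sLs [dX ce ne kill]]]] := IH; first by lia.
have [|Y [lY YX dY]] := flat_of_codim rank_ge LsA HLs dX; first by lia.
have YH : (Y <= H)%VS.
  by have [E _ ->] := lY; apply: capvSl.
have [theta ht dt] := away_killed dA YH (surj lY dY) ce.
have [|L Laway [f [nf kf]]] := find_killing_form (s := away_forms H A Y) _ ne.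
  by exists theta.
move: Laway; rewrite mem_filter in_fsetD1 => /and3P[nYL LH LA].
have nXL : ~~ (\bigcap_(L <- Ls) L <= L)%VS.
  by apply: contraNN nYL; apply: subv_trans.
exists (L :: Ls), (fun g => bara f * eta g); split.
- by move=> M; rewrite inE => /orP[/eqP ->|/LsA].
- by rewrite inE HLs orbT.
- split=> //=; first exact: linform_homog.
  have /subvPn[v vX nvL] := nXL; exists v.
    by apply: contraNneq nvL => h; apply/(in_formE dA).
  move=> z /mapP[M MLs ->]; apply/(in_formE dA); first exact: LsA.
  exact: (subvP (bigcap_seq_sub MLs)).
- by rewrite /= sLs.
split=> //.
- by have := dim_cap_hyperplane dA LA nXL; rewrite big_cons capvC; lia.
- exact: codomainM.
move=> M; rewrite inE => /orP[/eqP -> //|MLs].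
have := dbar_imM f (kill M MLs); congr im.
by apply/funext => g; rewrite mulrCA.
Qed.

Lemma global_surjectivity : dbar_surjective beta A q.+1.
Proof.
move=> eta ce; apply: contrapT => neta.
have nim : ~ im eta by case=> theta ht dt; apply: neta; exists theta.
have [Ls [eta' [LsA _ iLs sLs [_ _ ne kill]]]] := killed_by_forms ce nim (leqnn _).
by apply: ne; apply: (koszul_surjectivity dA resM LsA iLs _ kill); rewrite sLs -addnS.
Qed.

End GlobalSurjectivity.

(** * Extension of K-linear maps by Zorn's lemma *)

Section PartialLinear.
Variables (K : fieldType) (n : nat).
Local Notation S := {mpoly K[n]}.
Implicit Types (X Q : lmodType S).

Definition linear_over (C : set S) X Q (g : X -> Q) : Prop :=
  (forall x y, g (x + y) = g x + g y) /\
  (forall c x, C c -> g (c *: x) = c *: g x).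

Definition constants : set S := [set c | exists k : K, c = k%:MP].

Lemma linear_over0 C X Q (g : X -> Q) : linear_over C g -> g 0 = 0.
Proof.
by case=> gD _; have /eqP := gD 0 0; rewrite addr0 -subr_eq subrr eq_sym => /eqP.
Qed.

Lemma linear_over_sum C X Q (g : X -> Q) (I : Type) (r : seq I) (F : I -> X) :
  linear_over C g -> g (\sum_(i <- r) F i) = \sum_(i <- r) g (F i).
Proof. by move=> gl; apply: (big_morph g) => [x y|]; [case: gl|apply: linear_over0 gl]. Qed.

(** The graph of a partial K-linear map; given the first two clauses, the third makes it
    single-valued. *)
Definition linear_graph X Q (G : set (X * Q)) : Prop :=
  [/\ forall u v, G u -> G v -> G (u.1 + v.1, u.2 + v.2),
      forall (k : K) u, G u -> G (k%:MP *: u.1, k%:MP *: u.2)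
    & forall q, G (0, q) -> q = 0].

Lemma linear_graph_extension X Q (G0 : set (X * Q)) : linear_graph G0 -> G0 (0, 0) ->
  exists2 F : X -> Q, linear_over constants F & forall u, G0 u -> F u.1 = u.2.
Proof.
move=> lG0 G00.
pose P : set (set (X * Q)) := [set G | G = set0 \/ ((G0 `<=` G)%classic /\ linear_graph G)].
have [|G [[G0e|[G0G lG]] Gmax]] := Zorn_bigcup (P := P).
- move=> F FP Ftot; case: (pselect (exists2 G, F G & G <> set0)) => [[G1 FG1 G1n]|no]; last first.
    left; apply/seteqP; split=> // u [G FG Gu]; case: no; exists G => // G0'.
    by rewrite G0' in Gu.
  have FL G u : F G -> G u -> (G0 `<=` G)%classic /\ linear_graph G.
    by move=> FG Gu; case: (FP G FG) => // e; rewrite e in Gu.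
  right; split.
    have [u G1u] : exists u, G1 u by apply/set0P/eqP.
    by move=> v G0v; exists G1 => //; apply: (FL G1 u FG1 G1u).1.
  split.
  + move=> u v [Gu FGu Gu'] [Gv FGv Gv'].
    have [D _ _] := (FL Gu u FGu Gu').2; have [D' _ _] := (FL Gv v FGv Gv').2.
    case: (Ftot Gu Gv FGu FGv) => sub.
      by exists Gv => //; apply: D' => //; apply: sub.
    by exists Gu => //; apply: D => //; apply: sub.
  + move=> k u [Gu FGu Gu']; have [_ Z _] := (FL Gu u FGu Gu').2.
    by exists Gu => //; apply: Z.
  + move=> q [Gu FGu Gu']; have [_ _ E] := (FL Gu _ FGu Gu').2.
    exact: E.
- exfalso; apply: (Gmax G0); last by right; split.
  by rewrite G0e; split=> // /(_ _ G00).
have [D Z E] := lG.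
have B u v : G u -> G v -> G (u.1 - v.1, u.2 - v.2).
  move=> Gu Gv; have := D _ _ Gu (Z (-1) _ Gv).
  by rewrite /= mpolyCN mpolyC1 !scaleN1r.
have tot x : exists q, G (x, q).
  apply: contrapT => nx.
  (* x is adjoined to the domain with value 0. *)
  pose G' : set (X * Q) := [set u | exists (c : K) v, G v /\ u = (v.1 + c%:MP *: x, v.2)].
  apply: (Gmax G').
    split=> [u Gu|sub].
      by exists 0, u; split=> //; rewrite mpolyC0 scale0r addr0; case: u {Gu}.
    apply: nx; exists 0; apply: sub; exists 1, (0, 0); split; first exact: G0G.
    by rewrite mpolyC1 scale1r add0r.
  right; split.
    move=> u /G0G Gu; exists 0, u; split=> //.
    by rewrite mpolyC0 scale0r addr0; case: u {Gu}.
  split.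
  - move=> _ _ [c [u [Gu ->]]] [e [v [Gv ->]]]; exists (c + e), (u.1 + v.1, u.2 + v.2).
    by split; [exact: D|rewrite /= mpolyCD scalerDl addrACA].
  - move=> k _ [c [u [Gu ->]]]; exists (k * c), (k%:MP *: u.1, k%:MP *: u.2).
    by split; [exact: Z|rewrite /= mpolyCM scalerDr scalerA].
  - move=> q [c [[x1 q1] [Gu [/= e1 ->]]]].
    have [c0|c0] := eqVneq c 0.
      by move: e1; rewrite c0 mpolyC0 scale0r addr0 => e1; apply: E; rewrite e1.
    case: nx; exists ((- c^-1)%:MP *: q1); have := Z (- c^-1) _ Gu; congr G; congr pair.
    rewrite /= -[x1]addr0 -(subrr (c%:MP *: x)) addrA -e1 add0r scalerN scalerA.
    by rewrite -mpolyCM mulNr mulVf // mpolyCN mpolyC1 scaleN1r opprK.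
have /choice[F hF] := tot; exists F; last first.
  move=> u /G0G Gu; apply/eqP; rewrite -subr_eq0; apply/eqP; apply: E.
  by have := B _ _ (hF u.1) Gu; rewrite /= subrr.
split=> [x y|c x [k ->]].
  apply/eqP; rewrite -subr_eq0; apply/eqP; apply: E.
  by have := B _ _ (hF (x + y)) (D _ _ (hF x) (hF y)); rewrite /= subrr.
apply/eqP; rewrite -subr_eq0; apply/eqP; apply: E.
by have := B _ _ (hF (k%:MP *: x)) (Z k _ (hF x)); rewrite /= subrr.
Qed.

End PartialLinear.

(** * Commutators with a coordinate *)

Section Coordinates.
Variables (K : fieldType) (n : nat).
Local Notation S := {mpoly K[n]}.
Implicit Types (X Q : lmodType S).

Variables (w : 'I_n -> S) (b : 'I_n -> 'rV[K]_n).
Hypothesis w_homog : forall i, w i \is 1.-homog.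
Hypothesis w_dual : forall i j, (w i).@[b j 0] = (i == j)%:R.
Hypothesis w_gen : forall i, 'X_i = \sum_j b j 0 i *: w j.

(* the expansion of f in powers of w_t with coefficients free of w_t *)
Definition expand t : S -> {poly S} :=
  mmap (polyC \o @mpolyC n K)
    (fun i => ('X_i)%:P + (b t 0 i)%:MP%:P * ('X - (w t)%:P)).

HB.instance Definition _ t := GRing.RMorphism.on (expand t).

Lemma expandC t c : expand t c%:MP = c%:MP%:P.
Proof. exact: mmapC. Qed.

Lemma expandX t i :
  expand t 'X_i = ('X_i)%:P + (b t 0 i)%:MP%:P * ('X - (w t)%:P).
Proof. by rewrite /expand mmapX mmap1U. Qed.

Lemma expand_linear t f : f \is 1.-homog ->
  expand t f = f%:P + (f.@[b t 0])%:MP%:P * ('X - (w t)%:P).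
Proof.
move=> hf; rewrite meval_linear // {1 2}(dhomog1E hf) !raddf_sum /= mulr_suml -big_split /=.
apply: eq_bigr => i _; rewrite -!mul_mpolyC !rmorphM /= expandC expandX mulrDr.
by rewrite mulrA.
Qed.

Lemma expandD t x y : expand t (x + y) = expand t x + expand t y.
Proof. exact: (rmorphD (expand t)). Qed.

Lemma expandM t x y : expand t (x * y) = expand t x * expand t y.
Proof. exact: (rmorphM (expand t)). Qed.

Definition free_of t : set S := [set c | expand t c = c%:P].

Lemma free_ofC t k : free_of t k%:MP.
Proof. exact: expandC. Qed.

Lemma free_ofw t i : i != t -> free_of t (w i).
Proof.
move=> it; rewrite /free_of /= expand_linear // w_dual (negbTE it).
by rewrite mpolyC0 polyC0 mul0r addr0.
Qed.

Lemma expandw t : expand t (w t) = 'X.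
Proof. by rewrite expand_linear // w_dual eqxx mpolyC1 mul1r addrC subrK. Qed.

Lemma expandK t f : (expand t f).[w t] = f.
Proof.
pose s : {rmorphism S -> S} := horner_eval (w t) \o expand t.
apply: (mpoly_morph_ext (s1 := s) (s2 := idfun)) => [c|i] /=.
  by rewrite expandC /horner_eval hornerC.
by rewrite expandX /horner_eval !hornerE subrr mulr0 addr0.
Qed.

Section Sol.
Variables (t : 'I_n) (Q : lmodType S).
Implicit Type g : S -> Q.

(** Minus the solution at w_t^e f for f free of w_t, found by unrolling sol (w_t x) = w_t sol x - g
    x from sol f = 0. For e = 0 the sum is empty, so [e.-1] is harmless. *)
Definition sol_coef g (f : S) (e : nat) : Q :=
  \sum_(c < e) w t ^+ (e.-1 - c) *: g (w t ^+ c * f).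

(* solves w_t (sol g f) - sol g (w_t f) = g f, f being expanded in powers of w_t *)
Definition sol g (f : S) : Q :=
  - \sum_(e < size (expand t f)) sol_coef g (expand t f)`_e e.

Definition is_additive g := forall x y, g (x + y) = g x + g y.

Lemma is_additive0 g : is_additive g -> g 0 = 0.
Proof. by move=> gD; have /eqP := gD 0 0; rewrite addr0 -subr_eq subrr eq_sym => /eqP. Qed.

Lemma solE g f N : is_additive g -> (size (expand t f) <= N)%N ->
  sol g f = - \sum_(e < N) sol_coef g (expand t f)`_e e.
Proof.
move=> gD sN; congr (- _); rewrite (big_ord_widen N (fun e => sol_coef g (expand t f)`_e e)) //.
rewrite big_mkcond /=; apply: eq_bigr => e _; case: ltnP => // se.
by rewrite nth_default // /sol_coef big1 // => c _; rewrite mulr0 is_additive0 ?scaler0.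
Qed.

Lemma solD g : is_additive g -> is_additive (sol g).
Proof.
move=> gD x y; pose N := (size (expand t x) + size (expand t y))%N.
have sx : (size (expand t x) <= N)%N by rewrite leq_addr.
have sy : (size (expand t y) <= N)%N by rewrite leq_addl.
have sxy : (size (expand t (x + y)) <= N)%N.
  rewrite expandD; apply: (leq_trans (size_polyD _ _)); rewrite geq_max.
  by apply/andP; exact: conj sx sy.
rewrite !(solE (N := N)) // -opprD -big_split /=; congr (- _); apply: eq_bigr => e _.
rewrite -big_split /=; apply: eq_bigr => c _.
by rewrite expandD coefD mulrDr gD scalerDr.
Qed.

Lemma sol_spec g f : is_additive g -> w t *: sol g f - sol g (w t * f) = g f.
Proof.
move=> gD; pose N := size (expand t f).
have sX : (size (expand t (w t * f)) <= N.+1)%N.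
  rewrite expandM expandw mulrC; have [->|f0] := eqVneq (expand t f) 0.
    by rewrite mul0r size_poly0.
  by rewrite size_mulX.
rewrite (solE gD sX) (solE gD (leqnn N)) scalerN opprK addrC.
rewrite big_ord_recl expandM expandw /sol_coef big_ord0 add0r scaler_sumr -sumrB.
have fE : f = \sum_(e < N) w t ^+ e * (expand t f)`_e.
  by rewrite -{1}(expandK t f) horner_coef; apply: eq_bigr => e _; rewrite mulrC.
have gsum := big_morph g gD (is_additive0 gD).
rewrite [in RHS]fE gsum; apply: eq_bigr => e _.
rewrite coefXM /= big_ord_recr /= subnn expr0 scale1r addrAC scaler_sumr -sumrB.
rewrite big1 ?add0r // => c _.
rewrite !add0n scalerA -exprS; have -> : ((e.-1 - c).+1 = e - c)%N by have := ltn_ord c; lia.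
by rewrite subrr.
Qed.

(** psi multiplies the coefficients of the expansion and leaves the powers of w_t alone. Hence [sol]
    keeps linearity over the coordinates other than w_t. *)
Lemma sol_free g psi f : free_of t psi -> is_additive g ->
  sol g (psi * f) = sol (fun x => g (psi * x)) f.
Proof.
move=> fp gD; have gD' : is_additive (fun x => g (psi * x)) by move=> x y; rewrite mulrDr gD.
have sN : (size (expand t (psi * f)) <= size (expand t f))%N.
  rewrite expandM fp mul_polyC; exact: size_scale_leq.
have E1 := solE gD sN.
rewrite E1.
apply: (congr1 -%R).
apply: eq_bigr => e _.
rewrite /sol_coef; apply: eq_bigr => c _; rewrite expandM fp coefCM; congr (_ *: g _).
by rewrite mulrCA.
Qed.

Lemma eq_sol g g' f : g =1 g' -> sol g f = sol g' f.
Proof.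
move=> gg'; rewrite /sol; congr GRing.opp; apply: eq_bigr => e _.
by rewrite /sol_coef; apply: eq_bigr => c _; rewrite gg'.
Qed.

Lemma sol_sum (I : finType) (G : I -> S -> Q) f :
  sol (fun x => \sum_i G i x) f = \sum_i sol (G i) f.
Proof.
rewrite /sol [RHS]sumrN; apply: (congr1 -%R).
rewrite [RHS]exchange_big /=; apply: eq_bigr => e _.
rewrite /sol_coef [RHS]exchange_big /=; apply: eq_bigr => c _.
by rewrite scaler_sumr.
Qed.

Lemma solZ r g f : sol (fun x => r *: g x) f = r *: sol g f.
Proof.
rewrite /sol scalerN scaler_sumr; congr (- _); apply: eq_bigr => e _.
rewrite /sol_coef scaler_sumr; apply: eq_bigr => c _.
by rewrite !scalerA mulrC.
Qed.

End Sol.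

(** Generators of K[w_i : i < t]; for t = n this is all of S, by [w_gen]. *)
Definition scalars (t : nat) : set S :=
  [set c | constants c \/ exists2 i : 'I_n, (i < t)%N & c = w i].

Lemma scalars_free (t : 'I_n) c : scalars t c -> free_of t c.
Proof.
case=> [[k ->]|[i it ->]]; first exact: free_ofC.
by apply: free_ofw; apply: contraTneq it => ->; rewrite ltnn.
Qed.

Lemma linear_over_scalars X Q (g : X -> Q) : linear_over (scalars n) g ->
  forall c x, g (c *: x) = c *: g x.
Proof.
move=> gl; have [gD gZ] := gl.
have gC k x : g (k%:MP *: x) = k%:MP *: g x by apply: gZ; left; exists k.
have gw i x : g (w i *: x) = w i *: g x by apply: gZ; right; exists i.
have gM c d : (forall x, g (c *: x) = c *: g x) -> (forall x, g (d *: x) = d *: g x) ->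
    forall x, g ((c * d) *: x) = (c * d) *: g x.
  by move=> hc hd x; rewrite -!scalerA hc hd.
have gX i x : g ('X_i *: x) = 'X_i *: g x.
  rewrite w_gen !scaler_suml (linear_over_sum _ _ gl).
  by apply: eq_bigr => j _; rewrite -mul_mpolyC; apply: (gM).
elim/mpolyind => [|k m c _ _ IH] x; first by rewrite !scale0r; apply: linear_over0 gl.
rewrite !scalerDl gD IH; congr (_ + _); rewrite -mul_mpolyC; apply: (gM) => // {}x.
rewrite mpolyXE_id; elim/big_ind: _ x => [x|c1 c2|i _]; first by rewrite !scale1r.
  exact: gM.
elim: (m i) => [|e IHe] x; first by rewrite expr0 !scale1r.
by rewrite exprS; apply: gM.
Qed.

(** What it takes to make a map commute with w_t: its failure to do so has to be the commutator of
    w_t with some e that can be subtracted. *)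
Definition solvable (t : 'I_n) X : Prop :=
  forall Q (g : X -> Q), linear_over (scalars t) g ->
  exists2 e : X -> Q, linear_over (scalars t) e &
    forall x, w t *: e x - e (w t *: x) = g x.

(** On the multiples of one q the equation is solved by [sol] for f |-> g (f q); the dual basis adds
    these solutions up, its functionals being S-linear. *)
Lemma projective_solvable t X : projective_module X -> solvable t X.
Proof.
move=> /dual_basis_exists[phi [supp [phi0 phiE]]] Q g gl; have [gD gZ] := gl.
pose G q (f : S) := g (f *: q).
have GD q : is_additive (G q) by move=> x y; rewrite /G scalerDl gD.
pose e x := \sum_(q <- undup (supp x)) sol t (G q) (phi q x : S).
have sol0 q : sol t (G q) 0 = 0 by apply: is_additive0; apply: solD.
have eE x s : uniq s -> {subset supp x <= s} -> e x = \sum_(q <- s) sol t (G q) (phi q x : S).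
  move=> us ss; rewrite [RHS](bigID (fun q => q \in supp x)) /= [X in _ = _ + X]big1; last first.
    by move=> q nq; rewrite phi0.
  rewrite addr0 -[RHS]big_filter; apply: perm_big; apply: uniq_perm.
  - exact: undup_uniq.
  - exact: filter_uniq.
  - by move=> q; rewrite mem_undup mem_filter; apply/idP/andP => [h|[]//]; split=> //; apply: ss.
exists e.
  split=> [x y|c x hc].
    pose s := undup (supp x ++ supp y ++ supp (x + y)).
    have us : uniq s by apply: undup_uniq.
    rewrite !(eE _ s) //; try by move=> q hq; rewrite mem_undup !mem_cat hq ?orbT.
    by rewrite -big_split; apply: eq_bigr => q _; rewrite linearD solD.
  pose s := undup (supp x ++ supp (c *: x)).
  have us : uniq s by apply: undup_uniq.
  rewrite !(eE _ s) //; try by move=> q hq; rewrite mem_undup !mem_cat hq ?orbT.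
  rewrite scaler_sumr; apply: eq_bigr => q _; rewrite linearZ.
  rewrite (sol_free _ (scalars_free hc)) // -solZ; apply: eq_sol => f.
  by rewrite /G -scalerA gZ.
move=> x; pose s := undup (supp x ++ supp (w t *: x)).
have us : uniq s by apply: undup_uniq.
rewrite !(eE _ s) //; try by move=> q hq; rewrite mem_undup !mem_cat hq ?orbT.
rewrite scaler_sumr -sumrB (eq_bigr (fun q => G q (phi q x : S))); last first.
  by move=> q _; rewrite linearZ sol_spec.
rewrite -(linear_over_sum _ _ gl) -phiE //.
by move=> q hq; rewrite mem_undup !mem_cat hq.
Qed.

Section FiniteFree.
Variables (I J : finType) (Phi : I -> J -> S).
Local Notation F2 := (I -> S^o).
Local Notation F1 := (J -> S^o).

Definition matrix_map (v : F1) : F2 := fun i => \sum_j Phi i j * v j.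

Definition basis_fct (T : finType) (i : T) : T -> S^o := fun j => (j == i)%:R.

Lemma fct_sum_basis (T : finType) (u : T -> S^o) : u = \sum_i (u i : S) *: basis_fct i.
Proof.
apply/funext => j; rewrite fct_sumE (bigD1 j) //= big1 => [|i ij].
  by rewrite addr0 /basis_fct /GRing.scale /= /GRing.scale /= eqxx mulr1.
by rewrite /basis_fct /GRing.scale /= /GRing.scale /= eq_sym (negbTE ij) mulr0.
Qed.

(** The third property holds because [sol] passes through entries free of w_t: e composed with the
    matrix is [sol] of g composed with the matrix, that is of 0. *)
Lemma finite_free_solvable (t : 'I_n) Q (g : F2 -> Q) : linear_over (scalars t) g ->
  exists e : F2 -> Q, [/\ linear_over (scalars t) e,
    forall x, w t *: e x - e (w t *: x) = g x &
    (forall i j, free_of t (Phi i j)) -> (forall v, g (matrix_map v) = 0) ->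
    forall v, e (matrix_map v) = 0].
Proof.
move=> gl; have [gD gZ] := gl.
pose G i (f : S) := g (f *: (basis_fct i : F2)).
have GD i : is_additive (G i) by move=> x y; rewrite /G scalerDl gD.
exists (fun u => \sum_i sol t (G i) (u i : S)); split.
- split=> [x y|c x hc].
    rewrite -big_split /=; apply: eq_bigr => i _.
    by rewrite -(solD t (GD i)).
  rewrite scaler_sumr; apply: eq_bigr => i _.
  rewrite (sol_free (x i : S) (scalars_free hc) (GD i)) -solZ; apply: eq_sol => f.
  by rewrite /G -scalerA gZ.
- move=> x; rewrite scaler_sumr -sumrB [in RHS](fct_sum_basis x) (linear_over_sum _ _ gl).
  by apply: eq_bigr => i _; apply: sol_spec.
move=> Pfree gP v.
have -> : \sum_i sol t (G i) (matrix_map v i : S) =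
          \sum_j sol t (fun x => \sum_i G i (Phi i j * x)) (v j : S).
  under eq_bigr => i _.
    rewrite /matrix_map (big_morph (sol t (G i)) (solD t (GD i)) (is_additive0 (solD t (GD i)))).
    over.
  rewrite exchange_big /=; apply: eq_bigr => j _; rewrite sol_sum.
  by apply: eq_bigr => i _; rewrite sol_free.
rewrite big1 // => j _; have E x : \sum_i G i (Phi i j * x) = 0.
  rewrite -[RHS](gP (fun k => if k == j then x else 0)) -(linear_over_sum _ _ gl).
  rewrite [X in _ = g X]fct_sum_basis; congr g; apply: eq_bigr => i _.
  congr (_ *: _); rewrite /matrix_map (bigD1 j) //= eqxx big1 ?addr0 // => k kj.
  by rewrite (negbTE kj) mulr0.
have -> : sol t (fun x => \sum_i G i (Phi i j * x)) (v j : S) = sol t (fun=> 0) (v j : S).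
  exact: eq_sol.
rewrite /sol big1 ?oppr0 // => e _.
by rewrite /sol_coef big1 // => c _; rewrite scaler0.
Qed.

End FiniteFree.

(** * Extending linear maps along an exact complex *)

Section Extension.
Variables (X : nat -> lmodType S) (d : forall i, {linear X i.+1 -> X i}).
Hypothesis exact_d : forall i x, d i x = 0 <-> exists y, d i.+1 y = x.
Variable Q : lmodType S.

Lemma dlin i : linear_over setT (d i).
Proof. by split=> [x y|c x _]; rewrite ?linearD ?linearZ. Qed.

(** Maps on the image of d_j, seen as maps on X j.+1 that vanish on the kernel, extend to X j: an
    Ext vanishing over K[w_i : i < t]. *)
Definition extends_at (t j : nat) : Prop :=
  forall f : X j.+1 -> Q, linear_over (scalars t) f -> (forall x, d j x = 0 -> f x = 0) ->
  exists2 F : X j -> Q, linear_over (scalars t) F & forall x, F (d j x) = f x.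

Lemma extends_base j : extends_at 0 j.
Proof.
move=> f fl fd; have [fD fZ] := fl; have [dD dZ] := dlin j.
pose G0 : set (X j * Q) := [set u | exists x, u = (d j x, f x)].
have d0 : d j 0 = 0 := linear_over0 (dlin j).
have f0 : f 0 = 0 := linear_over0 fl.
have [||F [FD FZ] FE] := @linear_graph_extension K n (X j) Q G0.
- split.
  + by move=> _ _ [x ->] [y ->]; exists (x + y); rewrite dD fD.
  + by move=> k _ [x ->]; exists (k%:MP *: x); rewrite dZ // fZ //; left; exists k.
  + by move=> q [x [dx ->]]; apply: fd.
- by exists 0; rewrite d0 f0.
- exists F; last by move=> x; apply: (FE (d j x, f x)); exists x.
  by split=> // c x [|[]//]; apply: FZ.
Qed.

Definition commutator (t : 'I_n) (M : lmodType S) (F : M -> Q) (x : M) : Q := w t *: F x - F (w t *: x).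

Lemma commutator_linear (t : 'I_n) (M : lmodType S) (F : M -> Q) :
  linear_over (scalars t) F -> linear_over (scalars t) (commutator t (F : M -> Q)).
Proof.
case=> FD FZ; split=> [x y|c x hc]; rewrite /commutator.
  by rewrite FD !scalerDr FD opprD addrACA.
rewrite (FZ c x hc) [w t *: (c *: x)]scalerA [w t * c]mulrC -[(c * w t) *: x]scalerA.
by rewrite (FZ c _ hc) scalerBr !scalerA [w t * c]mulrC.
Qed.

Lemma scalarsS (t : 'I_n) (M : lmodType S) (F : M -> Q) :
  linear_over (scalars t) F -> (forall x, F (w t *: x) = w t *: F x) ->
  linear_over (scalars t.+1) F.
Proof.
move=> [FD FZ] Fw; split=> // c x [hc|[i it ->]]; first by apply: FZ; left.
move: it; rewrite ltnS leq_eqVlt => /orP[/eqP/val_inj -> //|it].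
by apply: FZ; right; exists i.
Qed.

Lemma scalarsW (t : 'I_n) (M : lmodType S) (F : M -> Q) :
  linear_over (scalars t.+1) F -> linear_over (scalars t) F /\
  forall x, F (w t *: x) = w t *: F x.
Proof.
move=> [FD FZ]; split; last by move=> x; apply: FZ; right; exists t.
split=> // c x [hc|[i it ->]]; apply: FZ; first by left.
by right; exists i => //; apply: leq_trans it _.
Qed.

(* F commutes with multiplication by w_t up to a map of the form g o d; solving
   [w_t, e] = g and subtracting e o d makes F linear over w_t as well. *)
Lemma extends_step (t : 'I_n) j : solvable t (X j) ->
  extends_at t j.+1 -> extends_at t j -> extends_at t.+1 j.+1.
Proof.
move=> sX Ej1 Ej f /scalarsW[fl fw] fd.
have [F Fl FE] := Ej1 f fl fd; have [FD FZ] := Fl.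
have [dD dZ] := dlin j; have [_ dZ1] := dlin j.+1.
have [|g gl gE] := Ej (commutator t F) (commutator_linear Fl).
  move=> x /exact_d[y <-]; rewrite /commutator -dZ1 // !FE fw.
  by rewrite subrr.
have [e el eE] := sX Q g gl; have [eD eZ] := el.
exists (fun x => F x - e (d j x)).
  apply: scalarsS.
    split=> [x y|c x hc]; first by rewrite FD dD eD opprD addrACA.
    by rewrite FZ // dZ // eZ // scalerBr.
  move=> x; rewrite dZ // scalerBr.
  have -> : F (w t *: x) = w t *: F x - g (d j x) by rewrite gE /commutator opprB addrC subrK.
  have -> : e (w t *: d j x) = w t *: e (d j x) - g (d j x) by rewrite -eE opprB addrC subrK.
  by rewrite opprB addrA subrK.
move=> x; rewrite FE (_ : d j (d j.+1 x) = 0) ?(linear_over0 el) ?subr0 //.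
by apply/exact_d; exists x.
Qed.

(** At the bottom there is no further differential to factor through, so e itself has to vanish on
    the image of d_0; [finite_free_solvable] provides this for coordinates absent from the
    matrix. *)
Lemma extends_step0 (t : 'I_n) :
  (forall g : X 0 -> Q, linear_over (scalars t) g -> (forall v, g (d 0 v) = 0) ->
   exists e : X 0 -> Q, [/\ linear_over (scalars t) e,
     forall x, w t *: e x - e (w t *: x) = g x & forall v, e (d 0 v) = 0]) ->
  extends_at t 0 -> extends_at t.+1 0.
Proof.
move=> sX E0 f /scalarsW[fl fw] fd.
have [F Fl FE] := E0 f fl fd; have [FD FZ] := Fl; have [_ dZ] := dlin 0.
have [|e [el eE e0]] := sX (commutator t F) (commutator_linear Fl).
  by move=> x; rewrite /commutator -dZ // !FE fw subrr.
have [eD eZ] := el; exists (fun x => F x - e x); last by move=> x; rewrite e0 subr0.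
apply: scalarsS.
  split=> [x y|c x hc]; first by rewrite FD eD opprD addrACA.
  by rewrite FZ // eZ // scalerBr.
move=> x; rewrite scalerBr.
have -> : e (w t *: x) = w t *: e x - commutator t F x by rewrite -eE opprB addrC subrK.
by rewrite /commutator opprB addrA [F _ + _]addrC subrK.
Qed.

Variable m : nat.
Hypothesis mn : (m <= n)%N.
Hypothesis sol_all : forall t j, solvable t (X j).
Hypothesis sol_bottom : forall t : 'I_n, (t < m)%N -> forall g : X 0 -> Q,
  linear_over (scalars t) g -> (forall v, g (d 0 v) = 0) ->
  exists e : X 0 -> Q, [/\ linear_over (scalars t) e,
    forall x, w t *: e x - e (w t *: x) = g x & forall v, e (d 0 v) = 0].

Lemma extends_free t j : (t <= m)%N -> extends_at t j.
Proof.
elim: t j => [|t IH] j tm; first exact: extends_base.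
have tn : (t < n)%N by apply: leq_trans tm mn.
case: j => [|j].
  by apply: (extends_step0 (t := Ordinal tn)); [apply: sol_bottom|apply: IH; apply: ltnW].
by apply: (extends_step (t := Ordinal tn)); [|apply: IH; apply: ltnW|apply: IH; apply: ltnW].
Qed.

(** A form of Hilbert's syzygy theorem: the first m coordinates cost nothing, and each of the other
    n - m shifts the range of the extension property by one position. *)
Lemma extends_linear j (f : X j.+1 -> Q) : (n - m <= j)%N -> linear f ->
  (forall x, d j x = 0 -> f x = 0) -> exists2 F : X j -> Q, linear F & forall x, F (d j x) = f x.
Proof.
move=> nmj fl fd.
have E s i : (s <= n - m)%N -> (s <= i)%N -> extends_at (m + s) i.
  elim: s i => [|s IH] i sn si; first by rewrite addn0; apply: extends_free.
  case: i si => // i si; have sn' : (m + s < n)%N by lia.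
  rewrite addnS; apply: (extends_step (t := Ordinal sn')) => //; apply: IH; lia.
have [||F Fl FE] := E (n - m)%N j (leqnn _) nmj f.
- split=> [x y|c x _]; first by have := fl 1 x y; rewrite !scale1r.
  have f0 : f 0 = 0 by have := fl (-1) 0 0; rewrite scaler0 addr0 scaleN1r addNr.
  by have := fl c x 0; rewrite f0 !addr0.
- exact: fd.
rewrite subnKC // in Fl; exists F => // c x y; have [FD _] := Fl.
by rewrite FD linear_over_scalars.
Qed.

End Extension.
End Coordinates.

(** * Direct summands cut out by idempotents *)

Section FixedSubmodule.
Variables (R : comNzRingType) (M : lmodType R) (f : {linear M -> M}).

Definition fixed : pred M := fun x => f x == x.

Lemma fixed_submod_closed : submod_closed fixed.
Proof.
split=> [|c x y]; rewrite !unfold_in /fixed; first by rewrite linear0.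
by move=> /eqP fx /eqP fy; rewrite linearP fx fy.
Qed.

HB.instance Definition _ := GRing.isSubmodClosed.Build R M fixed fixed_submod_closed.

Record fixed_sub := FixedSub { fixed_val :> M; _ : fixed_val \in fixed }.

HB.instance Definition _ := [isSub for fixed_val].
HB.instance Definition _ := [Choice of fixed_sub by <:].
HB.instance Definition _ := [SubChoice_isSubLmodule of fixed_sub by <:].

Lemma fixedP (x : fixed_sub) : f (fixed_val x) = fixed_val x.
Proof. by case: x => x /= /eqP. Qed.

Lemma fixed_val_linear : linear fixed_val.
Proof. by move=> c x y; exact: (linearP (val : fixed_sub -> M)). Qed.

Hypothesis f_idem : forall x, f (f x) = f x.

Lemma to_fixed_subproof x : f x \in fixed.
Proof. by rewrite unfold_in /fixed f_idem. Qed.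

Definition to_fixed (x : M) : fixed_sub := FixedSub (to_fixed_subproof x).

Lemma to_fixed_linear : linear to_fixed.
Proof.
move=> c x y; apply: val_inj.
by rewrite [RHS]fixed_val_linear /= linearP.
Qed.

Lemma fixed_projective : projective_module M -> projective_module fixed_sub.
Proof.
move=> projM N1 N2 g h gsurj.
have [i iE] := linear_of_fun fixed_val_linear.
have [r rE] := linear_of_fun to_fixed_linear.
have [l lE] := projM N1 N2 g (h \o r) gsurj.
exists (l \o i) => x; rewrite /= lE /= rE iE; congr (h _).
by apply: val_inj; rewrite /= fixedP.
Qed.

End FixedSubmodule.

(** * Shortening a resolution whose differential d_k has a retraction *)

Section ShortenResolution.
Variables (R : comNzRingType) (V : lmodType R) (M : set V) (k : nat).
Variables (P : nat -> lmodType R) (d : forall i, {linear P i.+1 -> P i}).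
Variable e : {linear P 0%N -> V}.
Hypothesis projP : forall i, projective_module (P i).
Hypothesis eM : forall v, M v <-> exists x, e x = v.
Hypothesis exact_e : forall x, e x = 0 <-> exists y, d 0%N y = x.
Hypothesis exact_d : forall i x, d i x = 0 <-> exists y, d i.+1 y = x.
Variable rho : {linear P k -> P k.+1}.
Hypothesis rhoK : forall x, rho (d k x) = x.

(** The idempotents that cut out the shorter resolution: the identity below k, 1 - d_k rho at k, and
    0 above. By the last clause they move x only by a boundary up to position k. *)
Lemma truncation_exists i : exists f : {linear P i -> P i},
  [/\ (i < k)%N -> f =1 id, (k < i)%N -> f =1 (fun=> 0),
      forall x, f (f x) = f x,
      i = k -> forall y, f (d i y) = 0
    & forall x, exists y, f x = x - d i y \/ (k < i)%N].
Proof.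
have [ik|[ki|ik]] : (i < k)%N \/ ((k < i)%N \/ i = k) by lia.
- have [f fE] := linear_of_fun (fun (a : R) (x y : P i) => erefl (a *: x + y)).
  exists f; split.
  + by move=> _ x; rewrite fE.
  + by move=> ki; exfalso; lia.
  + by move=> x; rewrite !fE.
  + by move=> eik; exfalso; lia.
  + by move=> x; exists 0; left; rewrite fE linear0 subr0.
- have lin0 : linear (fun _ : P i => 0 : P i) by move=> a x y; rewrite scaler0 addr0.
  have [f fE] := linear_of_fun lin0; exists f; split.
  + by move=> ik; exfalso; lia.
  + by move=> _ x; rewrite fE.
  + by move=> x; rewrite !fE.
  + by move=> eik; exfalso; lia.
  + by move=> x; exists 0; right.
- subst i; have lin : linear (fun x => x - d k (rho x)).
    by move=> a x y; rewrite (linearP rho) (linearP (d k)) scalerBr opprD addrACA.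
  have [f fE] := linear_of_fun lin; exists f; split.
  + by rewrite ltnn.
  + by rewrite ltnn.
  + move=> x; rewrite [LHS]fE; suff -> : rho (f x) = 0 by rewrite linear0 subr0.
    by rewrite fE linearB /= rhoK subrr.
  + by move=> _ y; rewrite fE rhoK subrr.
  + by move=> x; exists (rho x); left; rewrite fE.
Qed.

(** As rho d_k = 1, P k is the direct sum of im d_k and ker rho; ker rho takes the place of P k, and
    0 that of everything above. *)
Lemma shorten_resolution : has_projective_resolution M k.
Proof.
have [eps heps] : exists eps : forall i, {linear P i -> P i}, forall i,
  [/\ (i < k)%N -> eps i =1 id, (k < i)%N -> eps i =1 (fun=> 0),
      forall x, eps i (eps i x) = eps i x,
      i = k -> forall y, eps i (d i y) = 0
    & forall x, exists y, eps i x = x - d i y \/ (k < i)%N].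
  exists (fun i => sval (cid (truncation_exists i))) => i.
  exact: svalP (cid (truncation_exists i)).
have idem i x : eps i (eps i x) = eps i x by case: (heps i).
pose P' i : lmodType R := fixed_sub (eps i).
have val_lin i := @fixed_val_linear R (P i) (eps i).
have to_lin i := to_fixed_linear (idem i).
have [d' d'E] : exists d' : forall i, {linear P' i.+1 -> P' i}, forall i x,
    fixed_val (d' i x) = eps i (d i (fixed_val x)).
  have ex i : exists f : {linear P' i.+1 -> P' i}, forall x,
      fixed_val (f x) = eps i (d i (fixed_val x)).
    have [v vE] := linear_of_fun (val_lin i.+1); have [t tE] := linear_of_fun (to_lin i).
    by exists (t \o d i \o v) => x; rewrite /= tE vE.
  by exists (fun i => sval (cid (ex i))) => i; exact: svalP (cid (ex i)).
have [v0 v0E] := linear_of_fun (val_lin 0%N).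
have dd i y : d i (d i.+1 y) = 0 by apply/exact_d; exists y.
have ed y : e (d 0%N y) = 0 by apply/exact_e; exists y.
have e_eps x : e (eps 0%N x) = e x.
  by case: (heps 0%N) => _ _ _ _ /(_ x)[y [->|//]]; rewrite linearB ed subr0.
have eps_d i y : eps i (d i (eps i.+1 y)) = eps i (d i y).
  case: (heps i.+1) => _ epsk _ _ /(_ y)[z [->|ki]]; first by rewrite linearB dd subr0.
  rewrite epsk // linear0 linear0; move: ki; rewrite ltnS leq_eqVlt => /orP[/eqP ik|ki].
    by case: (heps i) => _ _ _ /(_ (esym ik)) ->.
  by case: (heps i) => _ /(_ ki) ->.
have lift i x : fixed_val (x : P' i) = eps i (fixed_val x) by rewrite fixedP.
exists P', d', (e \o v0); split.
- by move=> i; apply: fixed_projective => //; apply: idem.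
- by move=> i ki x; apply: val_inj; rewrite /= lift; case: (heps i) => _ /(_ ki) ->.
- move=> v; rewrite eM; split=> [[x <-]|[x <-]]; last by exists (v0 x).
  by exists (to_fixed (idem 0%N) x); rewrite /= v0E e_eps.
- move=> x; rewrite /= v0E; split=> [/exact_e[y yx]|[y <-]]; last by rewrite d'E e_eps ed.
  exists (to_fixed (idem 1%N) y); apply: val_inj; rewrite /= d'E /= eps_d yx.
  exact: fixedP.
- move=> i x; split=> [dx|[y <-]]; last first.
    by apply: val_inj; rewrite /= !d'E eps_d dd linear0.
  have dx0 : eps i (d i (fixed_val x)) = 0 by rewrite -d'E dx.
  have [y yx] : exists y, d i.+1 y = fixed_val x.
    case: (ltnP i k) => [ik|ki].
      by apply/exact_d; case: (heps i) => /(_ ik) epsE _ _ _ _; rewrite -(epsE (d i (fixed_val x))).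
    exists 0; rewrite linear0 lift; case: (heps i.+1) => _ epsk _ _ _.
    by rewrite epsk.
  exists (to_fixed (idem i.+2) y); apply: val_inj; rewrite /= d'E /= eps_d yx.
  exact: fixedP.
Qed.

End ShortenResolution.

(** * Coordinates adapted to a subspace *)

Section CoordinateChange.
Variables (K : fieldType) (n : nat).
Local Notation S := {mpoly K[n]}.

(** A basis of T is completed by one of a complement, and the inverse matrix gives the dual forms.
    Linear forms vanishing on T then do not involve w_i for i < dim T. *)
Lemma adapted_coordinates (T : {vspace 'rV[K]_n}) :
  exists (w : 'I_n -> S) (b : 'I_n -> 'rV[K]_n),
  [/\ forall i, w i \is 1.-homog, forall i j, (w i).@[b j 0] = (i == j)%:R,
      forall i, 'X_i = \sum_j b j 0 i *: w j
    & forall i : 'I_n, (i < \dim T)%N -> b i \in T].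
Proof.
pose s := vbasis T ++ vbasis T^C.
have dn : \dim {:'rV[K]_n} = n by rewrite dimvf /dim /= mul1n.
have ss : size s == n.
  have := dimvS (subvf T); rewrite dn => dT; apply/eqP.
  by rewrite size_cat !size_tuple dimv_compl dn; lia.
have fs : free s.
  rewrite cat_free !(basis_free (vbasisP _)) /= !(span_basis (vbasisP _)).
  by apply/directv_addP; rewrite capv_compl.
pose b (i : 'I_n) : 'rV[K]_n := s`_i.
pose B : 'M[K]_n := \matrix_i b i.
have Bu : B \in unitmx.
  rewrite -row_free_unit; apply: inj_row_free => v vB.
  have /freeP h := (fs : free (Tuple ss)).
  apply/rowP => i; rewrite mxE; apply: (h (fun i => v 0 i)).
  rewrite -[RHS]vB mulmx_sum_row; apply: eq_bigr => j _.
  by rewrite rowK.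
pose w (j : 'I_n) : S := \sum_i (invmx B) i j *: 'X_i.
have hw j : w j \is 1.-homog by apply: rpred_sum => i _; apply: rpredZ; apply: dhomog1X.
exists w, b; split=> //.
- move=> i j; rewrite /w raddf_sum /=.
  transitivity ((B *m invmx B) j i); last by rewrite mulmxV // mxE eq_sym.
  rewrite mxE; apply: eq_bigr => l _; rewrite mevalZ mevalXU mulrC; congr (_ * _).
  by rewrite mxE.
- move=> i; rewrite /w.
  transitivity (\sum_l (invmx B *m B) l i *: 'X_l : S).
    rewrite mulVmx // (bigD1 i) //= mxE eqxx scale1r big1 ?addr0 // => l li.
    by rewrite mxE (negbTE li) scale0r.
  under eq_bigr => l _ do rewrite mxE scaler_suml.
  rewrite exchange_big /=; apply: eq_bigr => j _; rewrite scaler_sumr.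
  by apply: eq_bigr => l _; rewrite scalerA mulrC mxE.
- move=> i iT; rewrite /b nth_cat size_tuple iT; apply: vbasis_mem.
  by rewrite mem_nth // size_tuple.
Qed.

End CoordinateChange.

(** * Testing multiderivations on tuples of variables *)

Section LogDerivationsOnVariables.
Variables (K : fieldType) (n : nat).
Local Notation S := {mpoly K[n]}.

Lemma idfunZ (c : K) (f : S) : (idfun : {rmorphism S -> S}) (c *: f) = c *: idfun f.
Proof. by []. Qed.

Lemma multider_formula p (theta : ('I_p -> S) -> S) f : multiderivation theta ->
  theta f = mder_of (idfun : {rmorphism S -> S}) (fun s => theta (fun i => 'X_(s i))) f.
Proof.
move=> mt; have := @multider_along _ _ _ (idfun : {rmorphism S -> S}) idfunZ p theta mt.
exact: mder_along_formula.
Qed.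

Lemma multider_of p (c : {ffun 'I_p -> 'I_n} -> S) :
  (forall (s : {ffun 'I_p -> 'I_n}) i j, i != j -> s i = s j -> c s = 0) ->
  (forall (s : {ffun 'I_p -> 'I_n}) i j, i != j -> c [ffun k => s (tperm i j k)] = - c s) ->
  multiderivation (mder_of (idfun : {rmorphism S -> S}) c).
Proof.
move=> c0 cN; have [lin lei] := mder_of_along idfunZ c; split=> // f i j ij fij.
by apply: (@mder_of_alternating _ _ _ _ _ c f i j _ _ ij fij) => s; [apply: (c0 s i j ij)|apply: (cN s i j ij)].
Qed.

Lemma multider_values0 p (theta : ('I_p -> S) -> S) (s : 'I_p -> 'I_n) i j :
  multiderivation theta -> i != j -> s i = s j -> theta (fun k => 'X_(s k)) = 0.
Proof. by case=> _ _ alt ij sij; apply: (alt _ i j ij); rewrite sij. Qed.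

Lemma multider_cons_linear q (theta : ('I_q.+1 -> S) -> S) y f :
  multiderivation theta -> y \is 1.-homog ->
  theta (cons_arg y f) = \sum_m y@_(U_(m))%MM *: theta (cons_arg 'X_m f).
Proof.
move=> mt hy; rewrite {1}(dhomog1E hy).
elim: (index_enum _) => [|m r IH].
  by rewrite !big_nil -(set_arg_cons0 0) multider_set0.
rewrite !big_cons -IH -(set_arg_cons0 0) multider_setD // multider_setZ //.
by rewrite !set_arg_cons0.
Qed.

Lemma multider_cons_along q (theta : ('I_q.+1 -> S) -> S) y :
  multiderivation theta ->
  mder_along (idfun : {rmorphism S -> S}) (fun f => theta (cons_arg y f)).
Proof.
case=> lin lei _; split=> [f i c x z|f i x z]; rewrite -!set_arg_consS.
  exact: lin.
exact: lei.
Qed.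

Lemma logder_on_variables (I : choiceType) (alpha : I -> S) (A : {fset I}) q
    (theta : ('I_q.+1 -> S) -> S) :
  multiderivation theta ->
  (forall L, L \in A -> forall s : {ffun 'I_q -> 'I_n}, exists k,
     theta (cons_arg (alpha L) (fun i => 'X_(s i))) = alpha L * k) ->
  logder alpha A q.+1 theta.
Proof.
move=> mt h; apply/logderP; split=> // L LA g.
rewrite (mder_along_formula idfunZ g (multider_cons_along (alpha L) mt)) /mder_of.
have /choice[k hk] := h L LA.
exists (\sum_(s : {ffun 'I_q -> 'I_n}) (\prod_i (g i)^`M(s i)) * k s); rewrite mulr_sumr.
by apply: eq_bigr => s _; rewrite hk mulrCA.
Qed.

Definition cons_index q (m : 'I_n) (s : {ffun 'I_q -> 'I_n}) : {ffun 'I_q.+1 -> 'I_n} :=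
  [ffun i => if unlift ord0 i is Some j then s j else m].

Lemma cons_indexE q (m : 'I_n) (s : {ffun 'I_q -> 'I_n}) :
  (fun i => 'X_(cons_index m s i)) = cons_arg 'X_m (fun i => 'X_(s i)) :> (_ -> S).
Proof.
by apply/funext => i; rewrite ffunE /cons_arg; case: (unlift ord0 i).
Qed.

End LogDerivationsOnVariables.

(** * D^p(A) as the kernel of a matrix *)

Section Presentation.
Variables (K : fieldType) (n : nat).
Local Notation S := {mpoly K[n]}.
Local Notation subspace := {vspace 'rV[K]_n}.
Variables (alpha : subspace -> linform K n) (A : {fset subspace}) (q : nat).
Local Notation form := (fun L => alpha L : S).
Local Notation V := (('I_q.+1 -> S) -> S^o).

Local Notation idx := {ffun 'I_q.+1 -> 'I_n}.
Local Notation idx' := {ffun 'I_q -> 'I_n}.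
Local Notation unknowns := (idx + (A * idx'))%type.
Local Notation equations :=
  ((idx * 'I_q.+1 * 'I_q.+1) + (idx * 'I_q.+1 * 'I_q.+1) + (A * idx'))%type.

(* D^p(A) is the set of solutions of this linear system: the unknowns are the
   values of theta on tuples of variables and the quotients
   theta (alpha_L, x_s) / alpha_L *)
Definition system (u : unknowns -> S^o) (eq : equations) : S^o :=
  match eq with
  | inl (inl (s, i, j)) => if (i != j) && (s i == s j) then u (inl s) else 0
  | inl (inr (s, i, j)) =>
      if i != j then u (inl [ffun k => s (tperm i j k)]) + u (inl s) else 0
  | inr (L, s) => \sum_m ((form (val L))@_(U_(m))%MM)%:MP * u (inl (cons_index m s))
                  - form (val L) * u (inr (L, s))
  end.

Lemma system_linear : linear (system : (unknowns -> S^o) -> (equations -> S^o)).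
Proof.
move=> c u v; apply/funext => -[[[[s i] j]|[[s i] j]]|[L s]] /=.
- rewrite -[RHS]/(c * system u (inl (inl (s, i, j))) + system v (inl (inl (s, i, j)))) /=.
  by case: ifP => // _; rewrite mulr0 addr0.
- rewrite -[RHS]/(c * system u (inl (inr (s, i, j))) + system v (inl (inr (s, i, j)))) /=.
  case: ifP => // _; last by rewrite mulr0 addr0.
  rewrite -[(c *: u + v) (inl s)]/(c * u (inl s) + v (inl s)).
  rewrite -[(c *: u + v) (inl [ffun k => s (tperm i j k)])]/(c * u (inl [ffun k => s (tperm i j k)]) + v (inl [ffun k => s (tperm i j k)])).
  by rewrite mulrDr addrACA.
- rewrite -[RHS]/(c * system u (inr (L, s)) + system v (inr (L, s))) /=.
  rewrite mulrBr mulr_sumr addrACA -big_split /= -opprD; congr (_ - _).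
    apply: eq_bigr => m _.
    rewrite -[(c *: u + v) _]/(c * u (inl (cons_index m s)) + v (inl (cons_index m s))).
    by rewrite mulrDr mulrCA.
  rewrite -[(c *: u + v) _]/(c * u (inr (L, s)) + v (inr (L, s))).
  by rewrite mulrDr mulrCA.
Qed.

Lemma system_solution (u : unknowns -> S^o) : system u = (fun=> 0) ->
  logder form A q.+1 (mder_of (idfun : {rmorphism S -> S}) (fun s => u (inl s) : S)) /\
  forall (L : A) (s : idx'), mder_of (idfun : {rmorphism S -> S}) (fun s => u (inl s) : S)
    (cons_arg (form (val L)) (fun i => 'X_(s i))) = form (val L) * (u (inr (L, s)) : S).
Proof.
move=> Eu; set theta := mder_of _ _.
have mt : multiderivation theta.
  apply: multider_of => [s i j ij sij|s i j ij].
    by have := congr1 (fun f => f (inl (inl (s, i, j)))) Eu; rewrite /= ij sij eqxx.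
  have := congr1 (fun f => f (inl (inr (s, i, j)))) Eu; rewrite /= ij => /eqP.
  by rewrite addr_eq0 => /eqP.
have E (L : A) (s : idx') : theta (cons_arg (form (val L)) (fun i => 'X_(s i))) =
    form (val L) * (u (inr (L, s)) : S).
  have := congr1 (fun f => f (inr (L, s))) Eu => /= /eqP; rewrite subr_eq0 => /eqP <-.
  rewrite multider_cons_linear ?linform_homog //; apply: eq_bigr => m _.
  by rewrite -cons_indexE /theta mder_ofX mul_mpolyC.
split=> //; apply: logder_on_variables => // L LA s.
by exists (u (inr ([` LA], s))); rewrite (E [` LA] s).
Qed.

Lemma solution_of_logder theta : logder form A q.+1 theta ->
  exists u : unknowns -> S^o, [/\ system u = (fun=> 0),
    forall s : idx, u (inl s) = theta (fun i => 'X_(s i)) &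
    forall (L : A) (s : idx'), theta (cons_arg (form (val L)) (fun i => 'X_(s i))) =
       form (val L) * (u (inr (L, s)) : S)].
Proof.
move=> /logderP[mt ht].
have /choice[g hg] : forall Ls : A * idx', exists k,
    theta (cons_arg (form (val Ls.1)) (fun i => 'X_(Ls.2 i))) = form (val Ls.1) * k.
  by case=> L s; apply: ht; apply: valP.
exists (fun x : unknowns => match x with inl s => theta (fun i => 'X_(s i)) | inr Ls => g Ls end).
split=> // [|L s]; last by rewrite -(hg (L, s)).
apply/funext => -[[[[s i] j]|[[s i] j]]|[L s]] /=.
- case: ifP => // /andP[ij /eqP sij]; exact: (multider_values0 mt ij sij).
- case: ifP => // ij.
  have -> : (fun l => 'X_([ffun k => s (tperm i j k)] l)) =
            (fun k => (fun l => 'X_(s l)) (tperm i j k)) :> ('I_q.+1 -> S).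
    by apply/funext => l; rewrite ffunE.
  by rewrite (multider_swap (fun l => 'X_(s l)) mt ij) addNr.
- rewrite -(hg (L, s)) /= multider_cons_linear ?linform_homog //; apply/eqP.
  rewrite subr_eq0; apply/eqP; apply: eq_bigr => m _.
  by rewrite cons_indexE mul_mpolyC.
Qed.

Lemma system_matrix (v : unknowns -> S^o) :
  system v = matrix_map (fun i (j : unknowns) => system (@basis_fct K n _ j) i : S) v.
Proof.
have [phi phiE] := linear_of_fun system_linear.
rewrite -phiE {1}(fct_sum_basis v) linear_sum; apply/funext => i.
rewrite fct_sumE; apply: eq_bigr => j _; rewrite linearZ phiE.
by rewrite -[LHS]/((v j : S) * (system (@basis_fct K n _ j) i : S)) mulrC.
Qed.

Section Shorten.
Variables (P : nat -> lmodType S) (d : forall i, {linear P i.+1 -> P i}).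
Variables (e : {linear P 0%N -> V}) (k : nat).
Hypothesis projP : forall i, projective_module (P i).
Hypothesis P0 : forall x : P k.+2, x = 0.
Hypothesis eM : forall v, logder form A q.+1 v <-> exists x, e x = v.
Hypothesis exact_e : forall x, e x = 0 <-> exists y, d 0%N y = x.
Hypothesis exact_d : forall i x, d i x = 0 <-> exists y, d i.+1 y = x.
Variable T : subspace.
Hypothesis TA : forall L, L \in A -> forall v : 'rV[K]_n, v \in T -> (form L).@[v 0] = 0.
Hypothesis rkT : (n - \dim T <= k.+2)%N.

Local Notation F1 := (unknowns -> S^o).
Local Notation F2 := (equations -> S^o).

(** x goes to the values of e x on variables together with their quotients by alpha_L, which are
    unique as alpha_L is not 0. Replacing e by this map prolongs the resolution by two free
    modules. *)
Lemma presentation_exists : exists D : {linear P 0%N -> F1},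
  (forall u, system u = (fun=> 0) <-> exists x, D x = u) /\
  (forall x, D x = 0 <-> exists y, d 0%N y = x).
Proof.
pose good (x : P 0%N) (u : F1) := (forall s : idx, u (inl s) = e x (fun i => 'X_(s i))) /\
    forall (L : A) (s : idx'), e x (cons_arg (form (val L)) (fun i => 'X_(s i))) =
       form (val L) * (u (inr (L, s)) : S).
have ex x : exists u, good x u /\ system u = (fun=> 0).
  have /solution_of_logder[u [h1 h2 h3]] : logder form A q.+1 (e x) by apply/eM; exists x.
  by exists u.
have uniq x u u' : good x u -> good x u' -> u = u'.
  move=> [h1 h2] [h1' h2']; apply/funext => -[s|[L s]]; first by rewrite h1 h1'.
  apply: (@linform_mulI _ _ (alpha (val L))); rewrite -h2 -h2'.
  by [].
have /choice[D hD] := ex.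
have linD : linear D.
  move=> c x y; apply: (uniq (c *: x + y)); first by case: (hD (c *: x + y)).
  have [[hx gx] _] := hD x; have [[hy gy] _] := hD y.
  split=> [s|L s]; rewrite linearP.
    rewrite -[LHS]/((c : S) * D x (inl s) + D y (inl s)) hx hy.
    by [].
  rewrite -[LHS]/((c : S) * (e x (cons_arg (form (val L)) (fun i => 'X_(s i))) : S) + (e y (cons_arg (form (val L)) (fun i => 'X_(s i))) : S)).
  rewrite gx gy -[X in _ = _ * X]/((c : S) * D x (inr (L, s)) + D y (inr (L, s))).
  by rewrite mulrDr mulrCA.
have [F FE] := linear_of_fun linD; exists F; split.
  move=> u; split=> [Eu|[x <-]]; last by rewrite FE; case: (hD x).
  have [/eM[x ex'] hL] := system_solution Eu; exists x; rewrite FE.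
  apply: (uniq x); first by case: (hD x).
  by split=> [s|L s]; rewrite ex' ?mder_ofX // hL.
move=> x; rewrite -exact_e FE; have [[h1 h2] _] := hD x; split=> [D0|e0].
  have [mt _] : logder form A q.+1 (e x) by apply/eM; exists x.
  apply/funext => f; rewrite (multider_formula f mt) /mder_of big1 // => s _.
  by rewrite -h1 D0 mulr0.
apply: (uniq x) => //; split=> [s|L s]; rewrite e0 //.
by rewrite mulr0.
Qed.

(** In the prolonged complex d_k sits at position k + 2, and it is injective as P k.+2 = 0. The dim
    T coordinates along T do not occur in the system, so extending the identity of P k.+1 takes n -
    dim T <= k + 2. *)
Lemma retraction_exists : exists rho : {linear P k -> P k.+1}, forall x, rho (d k x) = x.
Proof.
have [w [b [hw wb wg bT]]] := adapted_coordinates T.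
have [D [exD1 exD2]] := presentation_exists.
have [phi phiE] := linear_of_fun system_linear.
pose X (i : nat) : lmodType S := match i with 0 => F2 | 1 => F1 | i'.+2 => P i' end.
pose dX (i : nat) : {linear X i.+1 -> X i} :=
  match i return {linear X i.+1 -> X i} with 0 => phi | 1 => D | i'.+2 => d i' end.
have exX i x : dX i x = 0 <-> exists y, dX i.+1 y = x.
  case: i x => [|[|i]] x; [|exact: exD2|exact: exact_d].
  by rewrite -exD1 -phiE.
(* The entries of the matrix are built from constants and from forms of A, which vanish on T. *)
have freeP (t : 'I_n) i (j : unknowns) : (t < \dim T)%N -> free_of w b t (system (@basis_fct K n _ j) i : S).
  move=> tT.
  have f0 : free_of w b t 0 by rewrite /free_of /= -mpolyC0; apply: expandC.
  have fD c c' : free_of w b t c -> free_of w b t c' -> free_of w b t (c + c').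
    by rewrite /free_of /= => h h'; rewrite expandD h h' polyCD.
  have fM c c' : free_of w b t c -> free_of w b t c' -> free_of w b t (c * c').
    by rewrite /free_of /= => h h'; rewrite expandM h h' polyCM.
  have fN c : free_of w b t c -> free_of w b t (- c).
    by move=> fc; rewrite -mulN1r -mpolyC1 -mpolyCN; apply: (fM) => //; apply: free_ofC.
  have fb x : free_of w b t (@basis_fct K n _ j x : S).
    by rewrite /basis_fct -mpolyC_nat; apply: free_ofC.
  have ff (L : A) : free_of w b t (form (val L)).
    rewrite /free_of /= expand_linear ?linform_homog // (TA (valP L)) ?bT //.
    by rewrite mpolyC0 polyC0 mul0r addr0.
  case: i => [[[[s i] i']|[[s i] i']]|[L s]] /=.
  - by case: ifP => // _; apply: fb.
  - by case: ifP => // _; apply: (fD); apply: (fb).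
  - apply: (fD); last by apply: (fN); apply: (fM); [exact: ff|exact: fb].
    elim/big_ind: _ => [//|x y|m _]; first exact: fD.
    by apply: (fM); [apply: free_ofC|apply: fb].
(* For the two free modules only the first two properties are wanted, so a zero matrix is
   supplied. *)
have solX (t : 'I_n) j : solvable w t (X j).
  case: j => [|[|j]]; last exact: (projective_solvable hw wb (@projP j)).
    move=> Q g gl; have [e' [el eE _]] := finite_free_solvable hw wb (fun _ (_ : unit) => 0) gl.
    by exists e'.
  move=> Q g gl; have [e' [el eE _]] := finite_free_solvable hw wb (fun _ (_ : unit) => 0) gl.
  by exists e'.
have Tn : (\dim T <= n)%N.
  by apply: leq_trans (dimvS (subvf T)) _; rewrite dimvf /dim /= mul1n.
have [|||rho lrho rhoE] := @extends_linear K n w b wg X dX exX (P k.+1) (\dim T) Tn solX _ k.+2 id rkT.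
- move=> t tT g gl gd.
  have [e' [el eE ed]] := finite_free_solvable hw wb (fun i (j : unknowns) => system (@basis_fct K n _ j) i : S) gl.
  exists e'; split=> // v; rewrite /dX /= phiE system_matrix; apply: ed => [i j|{}v].
    exact: freeP.
  by rewrite -system_matrix -phiE; apply: gd.
- by [].
- move=> x /exX[y <-]; rewrite /dX /= (P0 y).
  exact: linear0.
- have [r rE] := linear_of_fun lrho; exists r => x; rewrite rE.
  exact: rhoE.
Qed.

End Shorten.
End Presentation.

(** * Exterior multiplication by a constant derivation *)

Section Wedge.
Variables (K : fieldType) (n : nat).
Local Notation S := {mpoly K[n]}.

Definition directional (v : 'rV[K]_n) (f : S) : S := \sum_i v 0 i *: f^`M(i).

Lemma directionalP v c f g : directional v (c *: f + g) = c *: directional v f + directional v g.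
Proof.
rewrite /directional scaler_sumr -big_split /=; apply: eq_bigr => i _.
by rewrite linearP scalerDr !scalerA mulrC.
Qed.

Lemma directionalM v f g : directional v (f * g) = f * directional v g + g * directional v f.
Proof.
rewrite /directional !mulr_sumr -big_split /=; apply: eq_bigr => i _.
by rewrite mderivM scalerDr -!scalerAr addrC [g * _]mulrC.
Qed.

Lemma mderiv_linear (f : S) i : f \is 1.-homog -> f^`M(i) = (f@_U_(i))%:MP.
Proof.
move=> hf; rewrite {1}(dhomog1E hf) linear_sum (bigD1 i) //= mderivZ mderiv_var eqxx.
rewrite big1 => [|j ji]; first by rewrite addr0 mpolyC1 -alg_mpolyC.
by rewrite mderivZ mderiv_var (negbTE ji) mpolyC0 scaler0.
Qed.

Lemma directional_linear v f : f \is 1.-homog -> directional v f = (f.@[v 0])%:MP.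
Proof.
move=> hf; rewrite meval_linear // /directional (raddf_sum (@mpolyC n K)) /=; apply: eq_bigr => i _.
by rewrite mderiv_linear // -!alg_mpolyC scalerA mulrC.
Qed.

Variables (q : nat) (v : 'rV[K]_n) (eta : ('I_q -> S) -> S).
Hypothesis meta : multiderivation eta.

Definition wedge (f : 'I_q.+1 -> S) : S :=
  \sum_(a < q.+1) (-1) ^+ (a : nat) * (directional v (f a) * eta (fun i => f (lift a i))).

Lemma set_arg_lift (f : 'I_q.+1 -> S) i x :
  (fun k => set_arg f i x (lift i k)) = (fun k => f (lift i k)).
Proof. by apply/funext => k; rewrite set_arg_neq // eq_sym neq_lift. Qed.

Lemma set_arg_lift_neq (f : 'I_q.+1 -> S) a j x :
  (fun k => set_arg f (lift a j) x (lift a k)) = set_arg (fun k => f (lift a k)) j x.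
Proof. by apply/funext => k; rewrite /set_arg (inj_eq lift_inj). Qed.

(** The transposition sends i to j, so it induces a bijection s between the remaining positions; its
    parity compares the two terms of [wedge] that survive for equal arguments i and j. *)
Lemma tperm_lift_perm (i j : 'I_q.+1) : exists s : 'S_q, tperm i j = lift_perm i j s.
Proof.
have /choice[g hg] : forall k, exists k', tperm i j (lift i k) = lift j k'.
  move=> k; case: (unliftP j (tperm i j (lift i k))) => [k' ->|/eqP e]; first by exists k'.
  have : lift i k != i by rewrite eq_sym neq_lift.
  by rewrite -(inj_eq (@perm_inj _ (tperm i j))) tpermL e.
have gI : injective g.
  move=> k l kl; apply: (@lift_inj _ i); apply: (@perm_inj _ (tperm i j)).
  by rewrite !hg kl.
exists (perm gI); apply/permP => x; case: (unliftP i x) => [k ->|->].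
  by rewrite hg lift_perm_lift permE.
by rewrite tpermL lift_perm_id.
Qed.

Lemma wedge_multider : multiderivation wedge.
Proof.
have [lin lei alt] := meta; split=> [f i c x y|f i x y|f i j ij fij].
- rewrite /wedge scaler_sumr -big_split /=; apply: eq_bigr => a _.
  rewrite !scalerAr -mulrDr; congr (_ * _).
  case: (unliftP a i) => [l ->|->]; last by rewrite !set_argE !set_arg_lift directionalP mulrDl -scalerAl scalerAr.
  by rewrite !set_arg_lift_neq lin !set_arg_neq ?neq_lift // mulrDr.
- rewrite /wedge !mulr_sumr -big_split /=; apply: eq_bigr => a _.
  rewrite ![_ * ((-1) ^+ _ * _)]mulrCA -mulrDr; congr (_ * _).
  case: (unliftP a i) => [l ->|->]; last by rewrite !set_argE !set_arg_lift directionalM mulrDl !mulrA.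
  rewrite !set_arg_lift_neq lei !set_arg_neq ?neq_lift // mulrDr.
  by rewrite ![directional v (f a) * (_ * _)]mulrCA.
rewrite /wedge (bigD1 i) //= (bigD1 j) /= 1?eq_sym // big1 ?addr0 => [|a /andP[ai aj]]; last first.
  case: (unliftP a i) ai => [i' ei|->]; last by rewrite eqxx.
  case: (unliftP a j) aj => [j' ej|->]; last by rewrite eqxx.
  move=> _ _; rewrite (alt _ i' j') ?mulr0 // -?ei -?ej //.
  by apply: contraNneq ij => e; rewrite ei ej e.
have [s es] := tperm_lift_perm i j.
have -> : (fun k : 'I_q => f (lift i k)) = (fun k : 'I_q => (fun l : 'I_q => f (lift j l)) (s k)).
  apply/funext => k; rewrite -(lift_perm_lift i j s k) -es.
  by case: tpermP => [->|->|].
rewrite (multider_perm (fun l : 'I_q => f (lift j l)) s meta) fij.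
(* The transposition is odd, and its parity is that of i + j plus that of s. *)
have os : (-1) ^+ (s : bool) = - ((-1) ^+ (i : nat) * (-1) ^+ (j : nat)) :> S.
  have := odd_tperm i j; rewrite ij es odd_lift_perm.
  rewrite -[(-1) ^+ (i : nat)]signr_odd -[(-1) ^+ (j : nat)]signr_odd.
  by case: (odd i) (odd j) (odd_perm s) => -[] [] //= _;
    rewrite !(expr0, expr1, mulr1, mul1r, mulN1r, opprK).
rewrite os; set D := directional _ _; set E := eta _.
have ii : (-1) ^+ (i : nat) * (-1) ^+ (i : nat) = 1 :> S by rewrite -expr2 sqrr_sign.
transitivity ((1 - (-1) ^+ (i : nat) * (-1) ^+ (i : nat)) * ((-1) ^+ (j : nat) * (D * E))).
  by ring.
by rewrite ii subrr mul0r.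
Qed.

End Wedge.

(** * The case A = {H} and the distinction by rank *)

Section NoOtherHyperplane.
Variables (K : fieldType) (n : nat).
Local Notation S := {mpoly K[n]}.
Local Notation subspace := {vspace 'rV[K]_n}.
Variables (alpha : subspace -> linform K n) (H : subspace).
Variable beta : subspace -> Sbar (alpha H).
Local Notation a := (alpha H).
Local Notation bara := (bar (alpha H)).
Local Notation form := (fun L => alpha L : S).

(** The values on variables are lifted by [lift_bar], which respects 0 and signs and hence
    alternation. *)
Lemma lift_multider q (eta : ('I_q -> Sbar a) -> Sbar a) : multiderivation eta ->
  exists2 eta' : ('I_q -> S) -> S, multiderivation eta' &
    forall f, bara (eta' f) = eta (fun i => bara (f i)).
Proof.
move=> me; have [_ _ alt] := me.
pose c (s : {ffun 'I_q -> 'I_n}) := lift_bar (eta (fun i => bara 'X_(s i))).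
exists (mder_of (idfun : {rmorphism S -> S}) c).
  apply: multider_of => [s i j ij sij|s i j ij]; rewrite /c.
    by rewrite (alt _ i j ij) ?sij // rmorph0.
  rewrite -rmorphN -(multider_swap _ me ij); congr lift_bar; congr eta.
  by apply/funext => k; rewrite ffunE.
move=> f; rewrite (mder_along_formula (@barZ _ _ a) f (multider_along (@barZ _ _ a) me)).
rewrite /mder_of rmorph_sum; apply: eq_bigr => s _; rewrite rmorphM rmorph_prod /= /c.
by rewrite lift_barK.
Qed.

(** A lift of eta is wedged with the derivation along v, where a(v) = 1. At (a, f) the first term
    gives eta; all others contain the lift with a among its arguments, which vanishes modulo a. *)
Lemma dbar_onto_multider q (eta : ('I_q -> Sbar a) -> Sbar a) : multiderivation eta ->
  exists2 theta, multiderivation theta & dbar (H := H) (p := q.+1) theta = eta.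
Proof.
move=> me; have [eta' me' eE] := lift_multider me.
exists (wedge (lift_form_vec a) eta'); first exact: wedge_multider.
apply/funext => g; have [f ->] := lift_args g.
rewrite dbar_bar; last exact: wedge_multider.
rewrite /wedge big_ord_recl expr0 mul1r cons_arg0 directional_linear ?linform_homog //.
rewrite lift_form_vecE mpolyC1 mul1r rmorphD /=.
have -> : (fun i => cons_arg (a : S) f (lift ord0 i)) = f by apply/funext => i; rewrite cons_argS.
rewrite eE rmorph_sum big1 ?addr0 // => i _; rewrite !rmorphM /= eE.
case: q eta me eta' me' eE g f i => [|q] eta me eta' me' eE g f i; first by case: i.
rewrite (_ : eta _ = 0) ?mulr0 //.
set h := (fun _ => _); have -> : h = set_arg h ord0 0; last exact: multider_set0.
rewrite -[LHS](set_arg_id _ ord0); congr set_arg; rewrite /h.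
have -> : lift (lift ord0 i) ord0 = ord0 :> 'I_q.+2 by apply: val_inj.
by rewrite cons_arg0 bar_form.
Qed.

Variable A : {fset subspace}.
Hypothesis dA : arrangement_data beta A.

Lemma lone_hyperplane_surjective q : A `\ H = fset0 -> dbar_surjective beta A q.+1.
Proof.
move=> A0 eta [eta' [me _] ->].
have [theta mt dt] := dbar_onto_multider (multider_scale (Bbar beta A) me).
by exists theta => //; apply/logderP; split=> // L; rewrite A0 in_fset0.
Qed.

Lemma low_rank : (n <= \dim (center A) + 1)%N -> A `\ H = fset0.
Proof.
move=> rk; apply/fsetP => L; rewrite in_fset0 in_fsetD1; apply/negbTE/negP => /andP[LH LA].
have sub M : M \in A -> center A = M.
  move=> MA; apply/eqP; rewrite eqEdim bigcap_seq_sub //=.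
  by have := ad_arr dA MA; lia.
by case/eqP: LH; rewrite -(sub L LA) (sub H (ad_H dA)).
Qed.

(* D^p(A) is extended from S in codim (center A) variables, where Hilbert's syzygy
   theorem bounds its projective dimension; hence a rank below k + 2 forces k = 0
   and rank 1. *)
Lemma surjective_of_codim q k :
  projective_dimension (logder form A q.+1 : set (('I_q.+1 -> S) -> S^o)) k ->
  (k < n - 2)%N -> surjective_in_codim beta A q.+1 (k + 2) ->
  dbar_surjective beta A q.+1.
Proof.
move=> [res kmin] kn surj.
case: (leqP (\dim (center A) + (k + 2)) n) => [rk|rk].
  exact: (global_surjectivity dA res surj rk).
(* The rank is at most k + 1. For k = 0 this leaves only H; for positive k the retraction yields a
   shorter resolution. *)
case: k res kmin kn surj rk => [|k] res kmin kn surj rk.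
  by apply: lone_hyperplane_surjective; apply: low_rank; lia.
have [P [d [e [projP P0 eM e0 ed]]]] := res.
have [|||rho rhoK] := @retraction_exists K n alpha A q P d e k projP _ eM e0 ed (center A).
- by move=> x; apply: P0.
- move=> L LA v vT; apply/(in_formE dA) => //.
  exact: (subvP (bigcap_seq_sub LA)).
- by lia.
have := kmin k (shorten_resolution projP eM e0 ed rhoK).
by rewrite ltnn.
Qed.

End NoOtherHyperplane.

(** * Dimensions of subspaces *)

Section Dimension.
Variable K : fieldType.
Implicit Types V W X : lmodType K.

Definition lincomb_closed V (U : set V) :=
  U 0 /\ forall (c : K) u v, U u -> U v -> U (c *: u + v).

Lemma lincomb_closed_sum V (U : set V) m (c : 'I_m -> K) (b : 'I_m -> V) :
  lincomb_closed U -> (forall i, U (b i)) -> U (\sum_i c i *: b i).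
Proof.
move=> [U0 UP] Ub; elim: (index_enum _) => [|i r IH]; first by rewrite big_nil.
by rewrite big_cons; apply: UP.
Qed.

Lemma has_dimension_intro V (U : set V) m (b : 'I_m -> V) :
  lincomb_closed U -> (forall i, U (b i)) ->
  (forall c : 'I_m -> K, \sum_i c i *: b i = 0 -> forall i, c i = 0) ->
  (forall v, U v -> exists c : 'I_m -> K, v = \sum_i c i *: b i) ->
  has_dimension U m.
Proof.
move=> cU Ub ind gen; exists b; split=> [x y /= xy|v].
  apply/rowP => i; apply/eqP; rewrite -subr_eq0; apply/eqP.
  apply: (ind (fun i => x 0 i - y 0 i)).
  under eq_bigr do rewrite scalerBl.
  by rewrite sumrB xy subrr.
split=> [/gen[c ->]|[c ->]]; last exact: lincomb_closed_sum.
by exists (\row_i c i); apply: eq_bigr => i _; rewrite mxE.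
Qed.

Lemma has_dimension_elim V (U : set V) m : has_dimension U m -> exists b : 'I_m -> V,
  [/\ forall i, U (b i),
      forall c : 'I_m -> K, \sum_i c i *: b i = 0 -> forall i, c i = 0
    & forall v, U v -> exists c : 'I_m -> K, v = \sum_i c i *: b i].
Proof.
move=> [b [inj gen]]; exists b; split=> [i|c c0 i|v /gen[c ->]]; last by exists (c 0).
  apply/gen; exists (delta_mx 0 i); rewrite (bigD1 i) //= mxE !eqxx scale1r big1 ?addr0 // => j ji.
  by rewrite mxE (negbTE ji) andbF scale0r.
have /inj/rowP/(_ i) : \sum_i (\row_i c i) 0 i *: b i = \sum_i (0 : 'rV[K]_m) 0 i *: b i.
  rewrite [RHS]big1 => [|j _]; last by rewrite mxE scale0r.
  by rewrite -[RHS]c0; apply: eq_bigr => j _; rewrite mxE.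
by rewrite !mxE.
Qed.

Lemma has_dimension_leq V (U : set V) m m' :
  has_dimension U m -> has_dimension U m' -> (m <= m')%N.
Proof.
move=> /has_dimension_elim[b [Ub ind _]] /has_dimension_elim[b' [_ _ gen]].
have /choice[C CE] : forall i, exists c : 'I_m' -> K, b i = \sum_j c j *: b' j.
  by move=> i; apply: gen.
pose M := \matrix_(i, j) C i j.
have : row_free M.
  apply: inj_row_free => v vM; apply/rowP => i; rewrite mxE; apply: (ind (v 0)) => {i}.
  under eq_bigr => i _ do rewrite CE scaler_sumr.
  rewrite exchange_big big1 //= => j _.
  transitivity ((\sum_i v 0 i * C i j) *: b' j).
    by rewrite scaler_suml; apply: eq_bigr => i _; rewrite scalerA.
  have e : \sum_i v 0 i * C i j = (v *m M) 0 j.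
    by rewrite mxE; apply: eq_bigr => i _; rewrite mxE.
  by rewrite e vM mxE scale0r.
by move=> /eqP <-; apply: rank_leq_col.
Qed.

Lemma dimensionE V (U : set V) m : has_dimension U m -> dimension U = m.
Proof.
move=> Um; rewrite /dimension; case: xgetP => [m' _ /= Um'|no]; last by case: (no m).
by apply/eqP; rewrite eqn_leq (has_dimension_leq Um Um') (has_dimension_leq Um' Um).
Qed.

(** J bounds the length of free families by N, and a free family of maximal length generates. *)
Lemma has_dimension_exists V (U : set V) N (J : {linear V -> 'rV[K]_N}) :
  lincomb_closed U -> (forall u, U u -> J u = 0 -> u = 0) -> exists m, has_dimension U m.
Proof.
move=> cU injJ.
pose free m := `[< exists b : 'I_m -> V, (forall i, U (b i)) /\
  forall c : 'I_m -> K, \sum_i c i *: b i = 0 -> forall i, c i = 0 >].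
have free0 : exists m, free m.
  by exists 0%N; apply/asboolP; exists (fun=> 0); split=> [[]//|c _ []].
have bound m : free m -> (m <= N)%N.
  move=> /asboolP[b [Ub ind]].
  have : row_free (\matrix_i J (b i)).
    apply: inj_row_free => v vM; apply/rowP => i; rewrite mxE; apply: (ind (v 0)) => {i}.
    apply: injJ; first exact: lincomb_closed_sum.
    rewrite -[RHS]vM mulmx_sum_row linear_sum; apply: eq_bigr => i _.
    by rewrite linearZ /= rowK.
  by move=> /eqP <-; apply: rank_leq_col.
case: (ex_maxnP free0 bound) => m /asboolP[b [Ub ind]] mmax.
exists m; apply: (has_dimension_intro cU Ub ind) => v Uv.
apply: contrapT => nv.
suff /mmax : free m.+1 by rewrite ltnn.
apply/asboolP; exists (fun i => if unlift ord0 i is Some j then b j else v); split.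
  by move=> i; case: (unlift ord0 i).
move=> c; rewrite big_ord_recl unlift_none.
under eq_bigr do rewrite liftK.
have [c0|c0] := eqVneq (c ord0) 0.
  rewrite c0 scale0r add0r => /(ind (fun i => c (lift ord0 i))) h i.
  by case: (unliftP ord0 i) => [j ->|->].
move=> /eqP; rewrite addr_eq0 => /eqP e; case: nv.
exists (fun i => - (c ord0)^-1 * c (lift ord0 i)).
under eq_bigr do rewrite -scalerA.
by rewrite -scaler_sumr scaleNr -scalerN -e scalerA mulVf // scale1r.
Qed.

(** Rank-nullity for T on U', with kernel U and image identified with Z through J. *)
Lemma has_dimension_add V W X (T : {linear V -> X}) (J : {linear W -> X})
    (U U' : set V) (Z : set W) m m' :
  lincomb_closed U' -> (forall u, U u <-> U' u /\ T u = 0) ->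
  (forall w, J w = 0 -> w = 0) ->
  (forall u, U' u -> exists2 w, Z w & T u = J w) ->
  (forall w, Z w -> exists2 u, U' u & T u = J w) ->
  has_dimension U m -> has_dimension Z m' -> has_dimension U' (m + m').
Proof.
move=> cU' UE injJ img surj /has_dimension_elim[b [Ub ind gen]] /has_dimension_elim[z [Zz indz genz]].
have /choice[y yE] : forall i, exists u, U' u /\ T u = J (z i).
  by move=> i; have [u] := surj _ (Zz i); exists u.
pose e (i : 'I_(m + m')) := match fintype.split i with inl j => b j | inr k => y k end.
have el j : e (lshift m' j) = b j by rewrite /e (unsplitK (inl _ j)).
have er j : e (rshift m j) = y j by rewrite /e (unsplitK (inr _ j)).
have sumE c : \sum_i c i *: e i = \sum_j c (lshift m' j) *: b j + \sum_j c (rshift m j) *: y j.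
  by rewrite big_split_ord /=; congr (_ + _); apply: eq_bigr => j _; rewrite ?el ?er.
have TE c : T (\sum_i c i *: e i) = J (\sum_j c (rshift m j) *: z j).
  rewrite sumE linearD !linear_sum big1 ?add0r => [|j _].
    by apply: eq_bigr => j _; rewrite !linearZ /= (yE j).2.
  by rewrite linearZ /= ((UE (b j)).1 (Ub j)).2 scaler0.
apply: (@has_dimension_intro _ _ _ e) => // [i|c c0|v Uv].
- rewrite /e; case: (fintype.split i) => j; last exact: (yE j).1.
  exact: ((UE (b j)).1 (Ub j)).1.
- have c2 j : c (rshift m j) = 0.
    by apply: (indz (fun j => c (rshift m j))); apply: injJ; rewrite -TE c0 linear0.
  have c1 j : c (lshift m' j) = 0.
    apply: (ind (fun j => c (lshift m' j))); rewrite -[RHS]c0 sumE [X in _ = _ + X]big1 ?addr0 // => k _.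
    by rewrite c2 scale0r.
  by move=> i; rewrite -(splitK i); case: (fintype.split i).
have [w Zw Tv] := img _ Uv; have [c2 wE] := genz _ Zw.
have [|c1 vE] := gen (v - \sum_j c2 j *: y j).
  apply/UE; split.
    rewrite addrC -scaleN1r; apply: cU'.2 => //.
    by apply: lincomb_closed_sum => // j; apply: (yE j).1.
  rewrite linearB /= Tv wE; apply/eqP; rewrite subr_eq0 !linear_sum; apply/eqP/eq_bigr => j _.
  by rewrite !linearZ /= (yE j).2.
exists (fun i => match fintype.split i with inl j => c1 j | inr k => c2 k end); rewrite sumE.
under eq_bigr do rewrite (unsplitK (inl _ _)).
under [X in _ = _ + X]eq_bigr do rewrite (unsplitK (inr _ _)).
by rewrite -vE subrK.
Qed.

End Dimension.

(** * Homogeneous components *)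

Section HomogeneousComponents.
Variables (K : fieldType) (n : nat).
Local Notation S := {mpoly K[n]}.
Implicit Types (b f x : S).

Lemma pihomog_homogM d j b x : b \is d.-homog ->
  pihomog mdeg j (b * x) = if (d <= j)%N then b * pihomog mdeg (j - d) x else 0.
Proof.
move=> hb; rewrite {1}(pihomog_partitionE (leqnn (mmeasure mdeg x))) mulr_sumr linear_sum /=.
have compE i : pihomog mdeg j (b * pihomog mdeg i x) =
    if (d + i == j)%N then b * pihomog mdeg i x else 0.
  have hi : b * pihomog mdeg i x \is (d + i).-homog by apply: dhomogM => //; apply: pihomogP.
  by case: eqVneq => [<-|ne]; [rewrite pihomog_dE|rewrite (pihomog_ne0 ne)].
under eq_bigr do rewrite compE.
case: leqP => [dj|jd]; last by rewrite big1 // => i _; rewrite ifF //; lia.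
case: (ltnP (j - d) (mmeasure mdeg x)) => [lt|le].
  rewrite (bigD1 (Ordinal lt)) //= subnKC // eqxx big1 ?addr0 // => i ni.
  rewrite ifF //; apply: contra_neqF ni => /eqP e; apply: val_inj => /=; lia.
rewrite big1 => [|i _]; last by rewrite ifF //; have := ltn_ord i; lia.
rewrite pihomogE big_seq_cond big1 ?mulr0 // => m /andP[/mmeasure_mnm_lt lt /eqP mE].
by have := lt mdeg; rewrite mE ltnNge le.
Qed.

Lemma dhomog_divl d j b x : b \is d.-homog -> b != 0 -> b * x \is j.-homog ->
  if (d <= j)%N then is_true (x \is (j - d).-homog) else x = 0.
Proof.
move=> hb b0 hbx; have := pihomog_homogM j x hb; rewrite (pihomog_dE hbx).
case: leqP => _ /eqP; last by rewrite mulf_eq0 (negbTE b0) => /eqP.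
by rewrite (inj_eq (mulfI b0)) => /eqP ->; apply: pihomogP.
Qed.

Lemma dhomogC (c : K) : c%:MP \is [in K[n], 0.-homog].
Proof. by rewrite -alg_mpolyC; apply/dhomogZ/dhomog1. Qed.

(** Since the d/dx_i have degree 0, the component of degree j is read off from the values on
    variables. *)
Definition component j p (theta : ('I_p -> S) -> S) : ('I_p -> S) -> S :=
  mder_of (idfun : {rmorphism S -> S}) (fun s => pihomog mdeg j (theta (fun i => 'X_(s i)))).

Lemma component_multider j p theta : multiderivation theta ->
  multiderivation (@component j p theta).
Proof.
move=> mt; apply: multider_of => [s i k ik sik|s i k ik].
  by rewrite (multider_values0 mt ik sik) linear0.
rewrite -linearN -(multider_swap _ mt ik); congr (pihomog _ _ (theta _)).
by apply/funext => l; rewrite ffunE.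
Qed.

Lemma component_homog j p theta (f : 'I_p -> S) : (forall i, f i \is 1.-homog) ->
  @component j p theta f \is j.-homog.
Proof.
move=> hf; apply: rpred_sum => s _; rewrite -[j]add0n; apply: dhomogM; last exact: pihomogP.
elim/big_ind: _ => [|x y hx hy|i _]; first exact: dhomog1.
  exact: (dhomogM hx hy).
by rewrite mderiv_linear //; apply: dhomogC.
Qed.

Lemma component_cons j q theta y (s : {ffun 'I_q -> 'I_n}) :
  multiderivation theta -> y \is 1.-homog ->
  @component j q.+1 theta (cons_arg y (fun i => 'X_(s i))) =
  pihomog mdeg j (theta (cons_arg y (fun i => 'X_(s i)))).
Proof.
move=> mt hy; rewrite (multider_cons_linear _ (component_multider j mt) hy).
rewrite (multider_cons_linear _ mt hy) linear_sum; apply: eq_bigr => m _.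
by rewrite linearZ /= -cons_indexE /component mder_ofX.
Qed.

Lemma component_logder (I : choiceType) (alpha : I -> S) (A : {fset I}) j q theta :
  (forall L, alpha L \is 1.-homog) -> logder alpha A q.+1 theta ->
  logder alpha A q.+1 (component j theta).
Proof.
move=> ha /logderP[mt h]; apply: logder_on_variables; first exact: component_multider.
move=> L LA s; rewrite component_cons //.
have [k ->] := h L LA (fun i => 'X_(s i)); rewrite (pihomog_homogM _ _ (ha L)).
by case: ifP => _; [exists (pihomog mdeg (j - 1) k)|exists 0; rewrite mulr0].
Qed.

Variable a : linform K n.

Lemma bar_component j f : Sbar_gr j (bar a f) -> bar a (pihomog mdeg j f) = bar a f.
Proof.
move=> [g hg fg]; have /bar_eq0[h fh] : bar a (f - g) = 0 by rewrite rmorphB /= fg subrr.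
have -> : f = g + (a : S) * h by rewrite -fh addrC subrK.
rewrite linearD /= (pihomog_dE hg) (pihomog_homogM _ _ (linform_homog a)).
rewrite !rmorphD /=; congr (_ + _).
have a0 : bar a (a : S) = 0 by apply/bar_eq0; exists 1; rewrite mulr1.
by case: ifP => _; rewrite ?rmorph0 ?rmorphM /= a0 ?mul0r.
Qed.

Lemma Sbar_grM i j (x y : Sbar a) : Sbar_gr i x -> Sbar_gr j y -> Sbar_gr (i + j) (x * y).
Proof. by move=> /Sbar_grP hx /Sbar_grP hy; apply/Sbar_grP; rewrite rmorphM; apply: dhomogM. Qed.

Lemma Sbar_gr_divl i j (x y : Sbar a) : Sbar_gr i x -> x <> 0 -> Sbar_gr j (x * y) ->
  if (i <= j)%N then Sbar_gr (j - i) y else y = 0.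
Proof.
move=> /Sbar_grP hx x0 /Sbar_grP; rewrite rmorphM /= => /(dhomog_divl hx).
have lx0 : lift_bar x != 0.
  by apply/eqP => e; apply: x0; rewrite -[x]lift_barK e rmorph0.
move=> /(_ lx0); case: ifP => _; first by move=> ?; apply/Sbar_grP.
by move=> e; rewrite -[y]lift_barK e rmorph0.
Qed.

End HomogeneousComponents.

(** * Finite dimension of the graded pieces, for S and Sbar at once *)

Section GradedPieces.
Variables (K : fieldType) (R : comAlgType K) (gr : nat -> set R).

Definition homog_part (j : nat) p (M : set (('I_p -> R) -> R)) : set (('I_p -> R) -> R) :=
  [set theta | M theta /\
    forall f : 'I_p -> R, (forall i, gr 1%N (f i)) -> gr j (theta f)].

Variables (n : nat) (h : {rmorphism {mpoly K[n]} -> R}) (l : R -> {mpoly K[n]}).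
Hypothesis hZ : forall c f, h (c *: f) = c *: h f.
Hypothesis hsurj : forall x, exists f, h f = x.
Hypothesis lP : forall (c : K) x y, l (c *: x + y) = c *: l x + l y.
Hypothesis lK : cancel l h.
Hypothesis grP : forall j x, gr j x <-> l x \is j.-homog.
Hypothesis grX : forall i, gr 1%N (h 'X_i).

Lemma homog_part_closed (I : choiceType) (alpha : I -> R) (A : {fset I}) p j :
  lincomb_closed (homog_part j (logder alpha A p)).
Proof.
split=> [|c u v [Du hu] [Dv hv]]; split.
- exact: logder0.
- have l0 : l 0 = 0 by have := lP (-1) 0 0; rewrite scaler0 addr0 scaleN1r addNr.
  by move=> f _; apply/grP; rewrite [X in l X](_ : _ = 0) // l0; apply: dhomog0.
- have := logder_add (logder_scale (c *: 1) Du) Dv.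
  rewrite (_ : (fun f => _) = c *: u + v) //; apply/funext => f.
  by rewrite -scalerAl mul1r.
move=> f hf; apply/grP; rewrite [X in l X](_ : _ = c *: u f + v f) // lP.
by apply: dhomogD; [apply: dhomogZ|]; apply/grP; [apply: hu|apply: hv].
Qed.

(** A homogeneous theta is determined by finitely many coefficients of its values on variables. This
    excludes the default value 0 of [dimension] for infinite-dimensional spaces. *)
Lemma homog_part_dimension (I : choiceType) (alpha : I -> R) (A : {fset I}) p j :
  exists m, has_dimension (homog_part j (logder alpha A p)) m.
Proof.
pose F : finType := ({ffun 'I_p -> 'I_n} * 'X_{1..n < j.+1})%type.
pose w (k : 'I_#|F|) : {ffun 'I_p -> 'I_n} * 'X_{1..n < j.+1} := enum_val k.
pose J (theta : ('I_p -> R) -> R) : 'rV[K]_#|F| :=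
  \row_k (l (theta (fun i => h 'X_((w k).1 i))))@_(bmnm (w k).2).
have linJ : linear J.
  by move=> c u v; apply/rowP => k; rewrite !mxE -mcoeffZ -mcoeffD -lP.
have [J' J'E] := linear_of_fun linJ.
apply: (@has_dimension_exists _ _ _ _ J'); first exact: homog_part_closed.
move=> theta [[mt _] ht]; rewrite J'E => J0.
apply: (multider_ext (h := h)) => //; first exact: multider0.
move=> s; set x := theta _.
have hx : l x \is j.-homog by apply/grP; apply: ht.
suff lx0 : l x = 0 by rewrite -[x]lK lx0 rmorph0.
apply/mpolyP => m; rewrite mcoeff0.
have [mj|mj] := eqVneq (mdeg m) j; last exact: dhomog_nemf_coeff hx mj.
have mlt : (mdeg m < j.+1)%N by rewrite mj.
have /rowP/(_ (enum_rank ([ffun i => s i], BMultinom mlt) : 'I_#|F|)) := J0.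
rewrite !mxE /w enum_rankK /= => <-; congr (l (theta _))@_m.
by apply/funext => i; rewrite ffunE.
Qed.

End GradedPieces.

(** * Graded pieces of the exact sequence *)

Section HilbertFunctions.
Variables (K : fieldType) (n : nat).
Local Notation S := {mpoly K[n]}.
Local Notation subspace := {vspace 'rV[K]_n}.
Variables (alpha : subspace -> linform K n) (H : subspace).
Variable beta : subspace -> Sbar (alpha H).
Local Notation a := (alpha H).
Local Notation bara := (bar (alpha H)).
Local Notation form := (fun L => alpha L : S).

Lemma S_dimension (I : choiceType) (gamma : I -> S) (A : {fset I}) p j :
  lincomb_closed (homog_part (@S_gr K n) j (logder gamma A p)) /\
  exists m, has_dimension (homog_part (@S_gr K n) j (logder gamma A p)) m.
Proof.
have lP (c : K) (x y : S) : id (c *: x + y) = c *: id x + id y by [].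
split; first by apply: (@homog_part_closed _ _ _ n id lP).
apply: (@homog_part_dimension K S (@S_gr K n) n (idfun : {rmorphism S -> S}) id) => //.
  by move=> x; exists x.
by move=> i; apply: dhomog1X.
Qed.

Lemma Sbar_dimension (I : choiceType) (gamma : I -> Sbar a) (A : {fset I}) p j :
  exists m, has_dimension (homog_part (@Sbar_gr K n a) j (logder gamma A p)) m.
Proof.
apply: (@homog_part_dimension K (Sbar a) (@Sbar_gr K n a) n bara (@lift_bar K n a)).
- exact: barZ.
- exact: bar_surj.
- by move=> c x y; rewrite rmorphD /= lift_barZ.
- exact: lift_barK.
- exact: Sbar_grP.
by move=> i; exists 'X_i => //; apply: dhomog1X.
Qed.

Variable A : {fset subspace}.
Hypothesis dA : arrangement_data beta A.
Local Notation d := (#|` A `\ H| - #|` restriction A H|)%N.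

Lemma Bbar_neq0 : Bbar beta A <> 0.
Proof.
move=> B0; have /(Bbar_mulI dA)/eqP : Bbar beta A * 1 = Bbar beta A * 0 by rewrite B0 !mul0r.
by rewrite oner_eq0.
Qed.

(** d is the sum of multiplicity - 1 over A^H; multiplicities are positive, so the truncated
    subtraction in d is a true one. *)
Lemma Bbar_degree : Sbar_gr d (Bbar beta A).
Proof.
have sizeE : (#|` A `\ H| = \sum_(U <- restriction A H) multiplicity H A U)%N.
  rewrite -sum1_size (partition_big_imfset _ (fun L => (L :&: H)%VS)) /= -/(restriction A H).
  by apply: eq_bigr => U _; rewrite sum1_count.
have -> : d = (\sum_(U <- restriction A H) (multiplicity H A U).-1)%N.
  have -> : #|` restriction A H| = (\sum_(U <- restriction A H) 1)%N by rewrite sum1_size.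
  rewrite sizeE !big_seq -sumnB /= => [|U UA]; last exact: multiplicity_gt0.
  by apply: eq_bigr => U _; rewrite subn1.
have [c _ ->] := BbarE dA; apply/Sbar_grP; rewrite lift_barZ; apply: dhomogZ; apply/Sbar_grP.
rewrite big_seq [X in Sbar_gr _ X]big_seq.
apply: (big_ind2 (fun i (x : Sbar a) => Sbar_gr i x)) => [|i x j y|U UA].
- by apply/Sbar_grP; rewrite rmorph1; apply: dhomog1.
- exact: Sbar_grM.
have [y [hy yb _ _]] := restriction_lift dA UA.
exists (y ^+ (multiplicity H A U).-1); last by rewrite rmorphXn /= yb.
by have := dhomogMn (multiplicity H A U).-1 hy; rewrite mul1n.
Qed.

Variable q : nat.
Local Notation D' j := (homog_part (@S_gr K n) j (logder form (A `\ H) q.+1)).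
Local Notation D j := (homog_part (@S_gr K n) j (logder form A q.+1)).
Local Notation DH j := (homog_part (@Sbar_gr K n a) j (logder beta (restriction A H) q)).

Lemma homog_part_kernel j theta : D j theta <-> D' j theta /\ dbar (alpha := alpha) (H := H) theta = (fun=> 0).
Proof.
split=> [[/(dbar_kernel _ _ (ad_H dA))[D't t0] ht]|[[D't ht] t0]] //.
by split=> //; apply/(dbar_kernel _ _ (ad_H dA)).
Qed.

(** Dividing by Bbar lowers degrees by d; for j < d this makes eta vanish on variables, hence
    altogether. *)
Lemma homog_part_image j theta : D' j theta -> exists2 eta,
  if (d <= j)%N then DH (j - d) eta else eta = (fun=> 0) &
  dbar (alpha := alpha) (H := H) theta = (fun g => Bbar beta A * eta g).
Proof.
move=> [Dt ht]; have [eta De te] := dbar_image dA Dt; exists eta => //.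
have deg g : (forall i, Sbar_gr 1 (g i)) ->
    if (d <= j)%N then Sbar_gr (j - d) (eta g) else eta g = 0.
  move=> hg; apply: (Sbar_gr_divl Bbar_degree Bbar_neq0).
  rewrite -[X in Sbar_gr j X](congr1 (fun k => k g) te).
  have /choice[f hf] : forall i, exists f, S_gr 1 f /\ g i = bara f.
    by move=> i; have [f ? ?] := hg i; exists f.
  have -> : g = (fun i => bara (f i)) by apply/funext => i; rewrite (hf i).2.
  rewrite dbar_bar; last exact: Dt.1.
  exists (theta (cons_arg (a : S) f)) => //; apply: ht => i.
  case: (unliftP ord0 i) => [k ->|->]; rewrite ?cons_argS ?cons_arg0; first exact: (hf k).1.
  exact: linform_homog.
case: ifP deg => dj deg; first by [].
apply: (multider_ext (@barZ _ _ a) (@bar_surj _ _ a) De.1 (@multider0 _ _ _)) => s.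
by apply: deg => i; exists 'X_(s i) => //; apply: dhomog1X.
Qed.

(** A preimage need not be homogeneous, but its component of degree j is again one, the target being
    homogeneous of degree j. *)
Lemma homog_part_surjective j eta : dbar_surjective beta A q.+1 -> (d <= j)%N ->
  DH (j - d) eta -> exists2 theta, D' j theta &
    dbar (alpha := alpha) (H := H) theta = (fun g => Bbar beta A * eta g).
Proof.
move=> surj dj [De he]; have [|theta Dt te] := surj (fun g => Bbar beta A * eta g).
  by exists eta.
have mt := Dt.1; have mc := component_multider j mt.
exists (component j theta).
  split; first by apply: component_logder => // L; apply: linform_homog.
  by move=> f hf; apply: component_homog.
refine (@multider_ext _ _ _ bara (@barZ _ _ a) q _ _ (@bar_surj _ _ a) (dbar_multider alpha H mc)
  (multider_scale (Bbar beta A) De.1) _) => s.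
rewrite (dbar_bar alpha H (fun i => 'X_(s i)) mc).
have -> : (fun i => 'X_(s i)) = (fun i => 'X_([ffun i => s i] i)) :> ('I_q -> S).
  by apply/funext => i; rewrite ffunE.
rewrite component_cons //; last exact: linform_homog.
have tsE : bara (theta (cons_arg (a : S) (fun i => 'X_([ffun i => s i] i)))) =
    Bbar beta A * eta (fun i => bara 'X_(s i)).
  rewrite -(dbar_bar alpha H _ mt) te; congr (_ * eta _).
  by apply/funext => i; rewrite ffunE.
rewrite bar_component tsE // -[j](subnKC dj); apply: Sbar_grM; first exact: Bbar_degree.
by apply: he => i; exists 'X_(s i) => //; apply: dhomog1X.
Qed.

Lemma Hilb_addition j : dbar_surjective beta A q.+1 ->
  Hilb (@S_gr K n) (logder form (A `\ H) q.+1) j =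
  (Hilb (@S_gr K n) (logder form A q.+1) j +
   if d <= j then Hilb (@Sbar_gr K n a) (logder beta (restriction A H) q) (j - d) else 0)%N.
Proof.
move=> surj; rewrite /Hilb -!/(homog_part _ _ _).
have [cl' _] := S_dimension form (A `\ H) q.+1 j.
have [_ [m Dm]] := S_dimension form A q.+1 j.
case: leqP => [dj|jd]; last first.
  rewrite addn0; congr dimension; apply/seteqP; split=> theta; last by case/homog_part_kernel.
  move=> Dt; apply/homog_part_kernel; split=> //.
  have [eta] := homog_part_image Dt; rewrite leqNgt jd /= => -> ->.
  by apply/funext => g; rewrite mulr0.
have [m' DHm'] := Sbar_dimension beta (restriction A H) q (j - d).
rewrite (dimensionE Dm) (dimensionE DHm'); apply: dimensionE.
have [T TE] : exists T : {linear (('I_q.+1 -> S) -> S) -> (('I_q -> Sbar a) -> Sbar a)},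
    T =1 dbar (alpha := alpha) (H := H) (p := q.+1).
  apply: linear_of_fun => c u v; apply/funext => g /=.
  by rewrite rmorphD /= barZ.
have [J JE] : exists J : {linear (('I_q -> Sbar a) -> Sbar a) -> (('I_q -> Sbar a) -> Sbar a)},
    J =1 (fun eta g => Bbar beta A * eta g).
  apply: linear_of_fun => c u v; apply/funext => g /=.
  by rewrite -[LHS]/(Bbar beta A * (c *: u g + v g)) mulrDr -scalerAr.
apply: (has_dimension_add (T := T) (J := J) cl' _ _ _ _ Dm DHm').
- by move=> theta; rewrite TE; apply: homog_part_kernel.
- move=> eta; rewrite JE => e; apply/funext => g; apply: (Bbar_mulI dA).
  by rewrite mulr0 [LHS](congr1 (fun k => k g) e).
- move=> theta Dt; have [eta] := homog_part_image Dt; rewrite dj => De te.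
  by exists eta => //; rewrite TE JE.
move=> eta De; have [theta Dt te] := homog_part_surjective surj dj De.
by exists theta => //; rewrite TE JE.
Qed.

End HilbertFunctions.

(** * Power series and the value t = -1 *)

Section PowerSeries.
Variable T : comNzRingType.
Implicit Types (p q : {poly T}) (u v : nat -> T).

(** Truncation to a polynomial, from which associativity is inherited. *)
Lemma psmul_coef q u N m : (m <= N)%N -> (q *ps u) m = (q * \poly_(i < N.+1) u i)`_m.
Proof.
move=> mN; rewrite coefM; apply: eq_bigr => i _.
by rewrite coef_poly ltnS (leq_trans (leq_subr _ _)).
Qed.

Lemma psmulA p q u m : ((p * q) *ps u) m = (p *ps (q *ps u)) m.
Proof.
rewrite (psmul_coef _ _ (leqnn m)) -mulrA coefM; apply: eq_bigr => i _.
by rewrite (psmul_coef _ _ (leq_subr i m)).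
Qed.

Lemma eq_psmul q u v m : u =1 v -> (q *ps u) m = (q *ps v) m.
Proof. by move=> uv; apply: eq_bigr => i _; rewrite uv. Qed.

Lemma psmulD q u v m : (q *ps (fun j => u j + v j)) m = (q *ps u) m + (q *ps v) m.
Proof. by rewrite -big_split; apply: eq_bigr => i _; rewrite mulrDr. Qed.

Lemma psmul_sum q k (u : 'I_k -> nat -> T) m :
  (q *ps (fun j => \sum_i u i j)) m = \sum_i (q *ps u i) m.
Proof. by rewrite exchange_big /=; apply: eq_bigr => i _; rewrite mulr_sumr. Qed.

Lemma psmulXn d u m : ('X^d *ps u) m = if (d <= m)%N then u (m - d)%N else 0.
Proof.
rewrite (psmul_coef _ _ (leqnn m)) coefXnM coef_poly ltnNge.
by case: (leqP d m) => //= _; rewrite ltnS leq_subr.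
Qed.

Lemma psmulN q u m : (- q *ps u) m = - (q *ps u) m.
Proof. by rewrite -sumrN; apply: eq_bigr => i _; rewrite coefN mulNr. Qed.

End PowerSeries.

Lemma psmul_at_t c (q : {poly {poly int}}) (u : nat -> {poly int}) m :
  ((q *ps u) m).[c] = (map_poly (horner_eval c) q *ps at_t c u) m.
Proof.
rewrite /psmul horner_sum; apply: eq_bigr => i _.
by rewrite hornerM coef_map.
Qed.

(** At t = -1 the factor t (x - 1) - 1 becomes -x, whence the sign and the exponent d + 1. *)
Lemma tx1_at_minus1 d : map_poly (horner_eval (-1)) ('X^d * tx1) = - 'X^(d.+1).
Proof.
rewrite rmorphM /= map_polyXn /tx1 rmorphB rmorphM rmorphB /= !rmorph1 map_polyX map_polyC /=.
rewrite /horner_eval hornerX exprSr.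
by rewrite polyCN mulN1r opprB addrAC subrr add0r mulrN.
Qed.

Theorem theorem1p7 (K : fieldType) (n : nat)
    (A : {fset {vspace 'rV[K]_n}}) (H : {vspace 'rV[K]_n})
    (alpha : {vspace 'rV[K]_n} -> linform K n)
    (beta : {vspace 'rV[K]_n} -> Sbar (alpha H)) :
  arrangement A ->
  H \in A ->
  (forall L, L \in A -> defining_form (alpha L) L) ->
  (forall U, U \in restriction A H -> defining_form_in H (beta U) U) ->
  (forall p, (p <= n)%N ->
     exists k : nat,
       [/\ projective_dimension
             (logder (fun L => alpha L : {mpoly K[n]}) A p
                : set (('I_p -> {mpoly K[n]}) -> {mpoly K[n]}^o)) k,
           (k < n - 2)%N
         & surjective_in_codim beta A p (k + 2)]) ->
  let d := (#|` A `\ H| - #|` restriction A H|)%N in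
  let PsiA := Psi (@S_gr K n) (fun L => alpha L : {mpoly K[n]}) A n in
  let PsiA' := Psi (@S_gr K n) (fun L => alpha L : {mpoly K[n]}) (A `\ H) n in
  let PsiAH := Psi (@Sbar_gr K n (alpha H)) beta (restriction A H) n.-1 in
  (forall m, PsiA' m = PsiA m + (('X^d * tx1) *ps PsiAH) m) /\
  (forall m, at_t (-1) PsiA' m =
     at_t (-1) PsiA m - ('X^(d.+1) *ps at_t (-1) PsiAH) m).
Proof.
move=> arrA HA formA rformA hyp d PsiA PsiA' PsiAH.
have dA : arrangement_data beta A by [].
have surj q : (q < n)%N -> dbar_surjective beta A q.+1.
  move=> qn; have [k [pd kn sc]] := hyp q.+1 qn.
  exact: (surjective_of_codim dA pd kn sc).
have n0 : n.-1.+1 = n by have [k [_ kn _]] := hyp 0%N (leq0n n); lia.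
have first m : PsiA' m = PsiA m + (('X^d * tx1) *ps PsiAH) m.
  (* The terms p = 0 agree, since the logarithmic condition is void there. *)
  rewrite /PsiA' /PsiA /Psi !big_ord_recl -addrA; congr (_ + _).
    apply: eq_psmul => j; congr (_%:R); rewrite /Hilb; congr dimension.
    by apply/seteqP; split=> theta /= [/logder0P mt ht]; split=> //; apply/logder0P.
  rewrite /PsiAH /Psi psmul_sum n0 -big_split /=; apply: eq_bigr => q _.
  (* For p = q + 1 one factor t (x - 1) - 1 is split off, and x^d realises the shift by d in
     [Hilb_addition]. *)
  rewrite /bump /= add1n -psmulA -mulrA -exprS [_ * tx1 ^+ _]mulrC psmulA -psmulD.
  apply: eq_psmul => j; rewrite (Hilb_addition dA j (surj q (ltn_ord q))) natrD psmulXn.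
  by congr (_ + _); case: ifP.
split=> // m; rewrite /at_t first hornerD psmul_at_t tx1_at_minus1 psmulN.
by [].
Qed.
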